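(* Let $\mathbf{k}$ be an algebraically closed field of characteristic $p=2$ and $V=\mathbf{k}^3$ (so $n=3$). Let $k\geq 1$ and $2^k\leq d\leq e\leq 2^{k+1}-2$ be integers. Write $d=(d_k\cdots d_0)_2$ and $e=(e_k\cdots e_0)_2$ for the binary expansions, and for each $i=1,\dots,k$ let $$l_i(d)=(d_k\cdots d_{i+1})_2,\qquad r_i(d)=(d_{i-1}\cdots d_0)_2,$$ and define $l_i(e),r_i(e)$ analogously. Set $$I=\{i:1\leq i\leq k,\ d_i=e_i=1,\ l_i(d)=l_i(e),\ r_i(e)\leq 2^i-2\}.$$ Then $$h^1(d,e)=\sum_{i\in I}F^{2^{i+1}}\left(\mathcal{N}_{l_i(d)}\right)\cdot s^{(2^i)}_{(r_i(e)-1+2^{i+1},\,r_i(d))}.$$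
   Context: $\mathbf{P}=\mathbb{P}V=\operatorname{Proj}(\operatorname{Sym}V)\simeq\mathbf{P}^2$, with tautological sequence $0\to\mathcal{R}\to V\otimes\mathcal{O}_{\mathbf{P}}\to\mathcal{O}_{\mathbf{P}}(1)\to 0$. $D^d$ is the $d$-th divided power functor, $D^d\mathcal{R}=(\operatorname{Sym}^d(\mathcal{R}^{\vee}))^{\vee}$, and $\mathcal{F}(e)=\mathcal{F}\otimes\mathcal{O}_{\mathbf{P}}(e)$. $h^1(d,e)=[H^1(\mathbf{P},D^d\mathcal{R}(e-1))]$ is the character of this $\operatorname{SL}_3$-representation in $A=\mathbb{Z}[x_1,x_2,x_3]/\langle x_1x_2x_3-1\rangle$ (with $[V]=x_1+x_2+x_3$). $(c_j\cdots c_0)_2=\sum_i c_i2^i$ with $c_i\in\{0,1\}$; the empty expansion is $0$ (so $l_k(d)=0$). For $q$ a power of $2$, $F^q:A\to A$ is the ring endomorphism $x_i\mapsto x_i^q$. The $q$-truncated symmetric functions are $$h^{(q)}_m=\sum_{a_1+a_2+a_3=m,\ 0\leq a_i<q}x_1^{a_1}x_2^{a_2}x_3^{a_3},\qquad s^{(q)}_{(a,b)}=h^{(q)}_ah^{(q)}_b-h^{(q)}_{a+1}h^{(q)}_{b-1}$$ (with $h^{(q)}_m=0$ for $m<0$). The Nim character functions are $$\mathcal{N}_m=\sum_{a+b+c=2m,\ a\oplus b\oplus c=0}x_1^ax_2^bx_3^c\in A,$$ the sum over non-negative integers $a,b,c$, where $\oplus$ is the Nim-sum (bitwise xor of binary expansions).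 *)

(* Defs.v *)
From HB Require Import structures.
From mathcomp Require Import all_boot all_order all_fingroup all_algebra.
From mathcomp Require Import generic_quotient ring_quotient boolp.
From mathcomp Require Export mpoly.

Set Implicit Arguments.
Unset Strict Implicit.
Unset Printing Implicit Defensive.

Import GRing.Theory.
Local Open Scope ring_scope.
Local Open Scope quotient_scope.

Definition relA : {mpoly int[3]} := \prod_(i < 3) 'X_i - 1.

Definition idealA : {pred {mpoly int[3]}} :=
  fun f => `[< exists g : {mpoly int[3]}, f = g * relA >].

Lemma idealAP f : reflect (exists g, f = g * relA) (f \in idealA).
Proof. exact: asboolP. Qed.

Lemma idealA_closed : idealr_closed idealA.
Proof.
split=> [||a u v /idealAP[g ->] /idealAP[h ->]].
- by apply/idealAP; exists 0; rewrite mul0r.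
- apply/idealAP=> -[g /(congr1 (meval (fun=> 1)))].
  rewrite rmorph1 rmorphM rmorphB rmorph1 rmorph_prod /=.
  rewrite big1 => [|i _]; last by rewrite mevalXU.
  by rewrite subrr mulr0.
- by apply/idealAP; exists (a * g + h); rewrite mulrDl mulrA.
Qed.

HB.instance Definition _ := isIdealr.Build {mpoly int[3]} idealA idealA_closed.

Notation A := {ideal_quot idealA}.

Definition toA (f : {mpoly int[3]}) : A := \pi_A f.

Lemma toA_is_zmod_morphism : zmod_morphism toA.
Proof. by move=> f g; rewrite /toA !piE. Qed.
Lemma toA_is_monoid_morphism : monoid_morphism toA.
Proof. by split=> [|f g]; rewrite /toA !piE. Qed.
HB.instance Definition _ :=
  GRing.isZmodMorphism.Build {mpoly int[3]} A toA toA_is_zmod_morphism.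
HB.instance Definition _ :=
  GRing.isMonoidMorphism.Build {mpoly int[3]} A toA toA_is_monoid_morphism.

Lemma toAP f g : reflect (exists h, f - g = h * relA) (toA f == toA g).
Proof. by rewrite /toA -Quotient.idealrBE; exact: idealAP. Qed.

Definition xA (i : 'I_3) : A := toA 'X_i.

(* Independent of the representative by [frobE]. *)
Definition frob_poly (q : nat) (f : {mpoly int[3]}) : {mpoly int[3]} :=
  f \mPo [tuple 'X_i ^+ q | i < 3].
Definition frob (q : nat) (a : A) : A := toA (frob_poly q (repr a)).

Lemma frobE q f : frob q (toA f) = toA (frob_poly q f).
Proof.
apply/eqP/toAP; have /eqP/toAP[h Eh] : toA (repr (toA f)) = toA f.
  exact: reprK.
have EX (i : 'I_3) : frob_poly q 'X_i = 'X_i ^+ q.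
  by rewrite /frob_poly comp_mpolyXU -tnth_nth tnth_mktuple.
exists (frob_poly q h * \sum_(i < q) (\prod_(j < 3) 'X_j) ^+ i).
rewrite /frob_poly -rmorphB Eh rmorphM -mulrA; congr (_ * _).
rewrite mulrC /relA -subrX1 rmorphB rmorph1 rmorph_prod /= -prodrXl.
by congr (_ - _); apply: eq_bigr => i _; exact: EX.
Qed.

Lemma frob_is_zmod_morphism q : zmod_morphism (frob q).
Proof.
move=> a b; rewrite -[a]reprK -[b]reprK -!/(toA _) -rmorphB !frobE.
by rewrite -rmorphB /frob_poly -rmorphB.
Qed.
Lemma frob_is_monoid_morphism q : monoid_morphism (frob q).
Proof.
split=> [|a b].
  have := frobE q 1; rewrite /frob_poly (rmorph1 (comp_mpoly _)).
  by rewrite (rmorph1 toA).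
rewrite -[a]reprK -[b]reprK -!/(toA _) -rmorphM !frobE.
by rewrite -rmorphM /frob_poly -rmorphM.
Qed.
HB.instance Definition _ q :=
  GRing.isZmodMorphism.Build A A (frob q) (frob_is_zmod_morphism q).
HB.instance Definition _ q :=
  GRing.isMonoidMorphism.Build A A (frob q) (frob_is_monoid_morphism q).

Lemma frob_xA q i : frob q (xA i) = xA i ^+ q.
Proof.
rewrite frobE /frob_poly comp_mpolyXU -tnth_nth tnth_mktuple.
exact: (rmorphXn toA).
Qed.

Definition monA (a b c : nat) : A :=
  xA 0 ^+ a * xA 1 ^+ b * xA (inord 2) ^+ c.

(* The degree is an integer, so that h_m = 0 for m < 0. *)
Definition htrunc (q : nat) (m : int) : A :=
  \sum_(a < q) \sum_(b < q) \sum_(c < q | (a + b + c)%N%:Z == m) monA a b c.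

Definition strunc (q : nat) (a b : int) : A :=
  htrunc q a * htrunc q b - htrunc q (a + 1) * htrunc q (b - 1).

Definition nimsum (a b : nat) : nat := Nat.lxor a b.

Definition nimchar (m : nat) : A :=
  \sum_(a < (2 * m).+1) \sum_(b < (2 * m).+1) \sum_(c < (2 * m).+1
     | (a + b + c == 2 * m)%N && (nimsum (nimsum a b) c == 0)%N) monA a b c.

Definition digit (n i : nat) : nat := (n %/ 2 ^ i) %% 2.

(* (c_(j-1) ... c_0)_2 *)
Definition binval (j : nat) (c : nat -> nat) : nat := \sum_(i < j) c i * 2 ^ i.

Definition ldig (k i n : nat) : nat :=
  binval (k - i) (fun j => digit n (i.+1 + j)).
Definition rdig (i n : nat) : nat := binval i (digit n).

Definition inI (k d e i : nat) : bool :=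
  [&& (1 <= i <= k)%N, digit d i == 1%N, digit e i == 1%N,
      ldig k i d == ldig k i e & (rdig i e <= 2 ^ i - 2)%N].

(*  P = Proj S with S = Sym V = F[x_1,x_2,x_3].  All the sheaves below are
    locally free, hence determined by their generic fibres together with the
    modules of sections over the affine opens U_I = D_+(\prod_(i in I) x_i),
    I nonempty, which are submodules of the generic fibre with the inclusions
    as restriction maps.  It is convenient to extend the scalars of the generic
    fibres from F(P) to Frac S, so that all the twists O(m) become subsheaves
    of the same constant sheaf. *)

Section Cohomology.
Variable F : fieldType.

Notation S := {mpoly F[3]}.
Notation K := {fraction S}.
Local Notation "p %:F" := (@FracField.tofrac S p).

(* O(m)(U_I), the degree m part of the localization of S at the x_i, i in I *)
Definition OP (m : int) (I : {set 'I_3}) (f : K) : Prop :=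
  exists (n N : nat) (g : S),
    [/\ n%:Z = m + (N * #|I|)%N%:Z, g \is n.-homog &
        f = g%:F / (\prod_(i in I) 'X_i)%:F ^+ N].

(* V (x) O -> O(1) at the generic point; u stands for \sum_i x_i (x) u_i. *)
Definition taut (u : 'rV[K]_3) : K^o := \sum_(i < 3) ('X_i)%:F * u 0 i.

Lemma taut_is_linear : linear taut.
Proof.
move=> a u v; rewrite /taut scaler_sumr -big_split /=; apply: eq_bigr => i _.
by rewrite !mxE mulrDr /GRing.scale /= mulrCA.
Qed.
HB.instance Definition _ :=
  GRing.isLinear.Build K 'rV[K]_3 K^o *:%R taut taut_is_linear.

Definition Rgen : {vspace 'rV[K]_3} := lker (linfun taut).
Notation RK := (subvs_of Rgen).
Notation RKdual := 'Hom(RK, K^o).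

Lemma memRgen u : (u \in Rgen) = (taut u == 0).
Proof. by rewrite memv_ker lfunE. Qed.

Definition Rsheaf (I : {set 'I_3}) (u : RK) : Prop :=
  forall i, OP 0 I (vsval u 0 i).

Definition Rdual (I : {set 'I_3}) (lam : RKdual) : Prop :=
  forall u, Rsheaf I u -> OP 0 I (lam u).

(* D^d R = (Sym^d (R^dual))^dual, where by the universal property of Sym^d a
   linear form on Sym^d N is a symmetric d-linear form on N. *)
Definition form (d : nat) : Type := {ffun 'I_d -> RKdual} -> K.

Definition upd d (l : {ffun 'I_d -> RKdual}) (i : 'I_d) (x : RKdual) :=
  [ffun j => if j == i then x else l j].

Definition multilin d (phi : form d) : Prop :=
  forall l i (c : K) x y,
    phi (upd l i (c *: x + y)) = c * phi (upd l i x) + phi (upd l i y).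

Definition symmetric_form d (phi : form d) : Prop :=
  forall (l : {ffun 'I_d -> RKdual}) (s : 'S_d),
    phi [ffun j => l (s j)] = phi l.

Definition DR (d : nat) (I : {set 'I_3}) (phi : form d) : Prop :=
  [/\ multilin phi, symmetric_form phi &
      forall l : {ffun 'I_d -> RKdual},
        (forall j, Rdual I (l j)) -> OP 0 I (phi l)].

(* The tensor product of sections over the affine open U_I, inside the generic
   fibre. *)
Definition twist d (G : {set 'I_3} -> form d -> Prop) (m : int)
    (I : {set 'I_3}) (phi : form d) : Prop :=
  exists (n : nat) (f : 'I_n -> K) (psi : 'I_n -> form d),
    [/\ forall j, OP m I (f j), forall j, G I (psi j) &
        forall l, phi l = \sum_j f j * psi j l].

(* Cech complex of the cover U_1, U_2, U_3, with cochains indexed by all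
   tuples of indices. *)
Definition cochain1 (d : nat) : Type := 'I_3 -> 'I_3 -> form d.

Definition cocycle1 d (G : {set 'I_3} -> form d -> Prop) (z : cochain1 d) :=
  (forall i j, G [set i; j] (z i j)) /\
  (forall i j h l, z j h l - z i h l + z i j l = 0).

Definition coboundary1 d (G : {set 'I_3} -> form d -> Prop) (z : cochain1 d) :=
  exists b : 'I_3 -> form d,
    (forall i, G [set i] (b i)) /\ (forall i j l, z i j l = b j l - b i l).

(* The diagonal maximal torus of SL_3; t acts on V by x_i |-> t_i x_i, hence on S by substitution. *)
Definition torus (t : 'I_3 -> F) : Prop := \prod_(i < 3) t i = 1.
Definition tinv (t : 'I_3 -> F) : 'I_3 -> F := fun i => (t i)^-1.

Definition sigma (t : 'I_3 -> F) (p : S) : S :=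
  p \mPo [tuple t i *: 'X_i | i < 3].

Lemma sigma_is_zmod_morphism t : zmod_morphism (sigma t).
Proof. exact: comp_mpoly_is_additive. Qed.
Lemma sigma_is_monoid_morphism t : monoid_morphism (sigma t).
Proof.
by split; [exact: comp_mpoly1 | exact: (comp_mpoly_is_multiplicative _).1].
Qed.
HB.instance Definition _ t :=
  GRing.isZmodMorphism.Build S S (sigma t) (sigma_is_zmod_morphism t).
HB.instance Definition _ t :=
  GRing.isMonoidMorphism.Build S S (sigma t) (sigma_is_monoid_morphism t).

Lemma sigmaX t i : sigma t 'X_i = t i *: 'X_i.
Proof. by rewrite /sigma comp_mpolyXU -tnth_nth tnth_mktuple. Qed.

(* The induced automorphism of Frac S, see [sigmaKE]. *)
Definition sigmaK (t : 'I_3 -> F) (f : K) : K :=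
  (sigma t (\n_(repr f)))%:F / (sigma t (\d_(repr f)))%:F.

(* Semilinear with respect to [sigmaK t]; the projection is the identity, see
   [vsval_actR]. *)
Definition actV (t : 'I_3 -> F) (u : 'rV[K]_3) : 'rV[K]_3 :=
  \row_i ((t i)%:MP%:F * sigmaK t (u 0 i)).
Definition actR (t : 'I_3 -> F) (u : RK) : RK :=
  vsproj Rgen (actV t (vsval u)).

(* [linfun] does not change the function, see [actRdualE]. *)
Definition actRdual (t : 'I_3 -> F) (lam : RKdual) : RKdual :=
  linfun (fun u => sigmaK t (lam (actR (tinv t) u)) : K^o).

Lemma torus_neq0 t : torus t -> forall i, t i != 0.
Proof.
move=> t1 i; apply: contra_eq_neq t1 => ti0.
by rewrite (bigD1 i) //= ti0 mul0r eq_sym oner_eq0.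
Qed.

Lemma torus_tinv t : torus t -> torus (tinv t).
Proof. by rewrite /torus /tinv prodfV => ->; rewrite invr1. Qed.

Lemma tinvK t : tinv (tinv t) = t.
Proof. by apply/funext => i; rewrite /tinv invrK. Qed.

Lemma sigmaVK t : torus t -> cancel (sigma t) (sigma (tinv t)).
Proof.
move=> t1 p; elim/mpolyind: p => [|c m p _ _ IH]; first by rewrite !rmorph0.
rewrite !(rmorphD (sigma _)) /= IH; congr (_ + _).
rewrite -[c *: _]mul_mpolyC !(rmorphM (sigma _)) /= {1}/sigma.
rewrite /sigma !comp_mpolyC; congr (_ * _).
rewrite mpolyXE_id !(rmorph_prod (sigma _)) /=.
apply: eq_bigr => i _; rewrite !(rmorphXn (sigma _)) /= sigmaX; congr (_ ^+ _).
rewrite -mul_mpolyC (rmorphM (sigma _)) /= sigmaX {1}/sigma comp_mpolyC.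
by rewrite mul_mpolyC scalerA /tinv divff ?scale1r // torus_neq0.
Qed.

Lemma sigma_eq0 t p : torus t -> (sigma t p == 0) = (p == 0).
Proof.
move=> t1; apply/eqP/eqP => [p0|->]; last exact: rmorph0.
by rewrite -[p](sigmaVK t1) p0 rmorph0.
Qed.

Lemma fracE (f : K) : f = (\n_(repr f))%:F / (\d_(repr f))%:F.
Proof.
have d0 : (\d_(repr f))%:F != 0 by rewrite tofrac_eq0 denom_ratioP.
apply: (mulIf d0); rewrite divfK //.
rewrite -{1}[f]reprK; unlock FracField.tofrac.
rewrite -[LHS]FracField.pi_mul; apply/eqmodP; rewrite /= FracField.equivfE.
rewrite /FracField.mulf !numden_Ratio ?mulf_neq0 ?oner_neq0 ?denom_ratioP //.
by rewrite !mulr1 mulrC.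
Qed.

Lemma sigmaKE t p q : torus t -> q != 0 ->
  sigmaK t (p%:F / q%:F) = (sigma t p)%:F / (sigma t q)%:F.
Proof.
move=> t1 q0; rewrite /sigmaK; set f := p%:F / q%:F.
have d0 : \d_(repr f) != 0 by rewrite denom_ratioP.
have /eqP := fracE f; rewrite {1}/f eqr_div ?tofrac_eq0 // -!tofracM tofrac_eq.
move=> /eqP /(congr1 (sigma t)); rewrite !(rmorphM (sigma _)) /= => E.
by apply/eqP; rewrite eqr_div ?tofrac_eq0 ?sigma_eq0 // -!tofracM tofrac_eq E.
Qed.

Lemma sigmaK_tofrac t p : torus t -> sigmaK t p%:F = (sigma t p)%:F.
Proof.
move=> t1; have := sigmaKE p t1 (oner_neq0 S).
by rewrite (rmorph1 (sigma t)) tofrac1 !divr1.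
Qed.

Lemma sigmaKM t f g : torus t -> sigmaK t (f * g) = sigmaK t f * sigmaK t g.
Proof.
move=> t1; rewrite [f]fracE [g]fracE mulf_div -!tofracM.
rewrite !sigmaKE ?mulf_neq0 ?denom_ratioP // !(rmorphM (sigma t)) /=.
by rewrite mulf_div !tofracM.
Qed.

Lemma sigmaKD t f g : torus t -> sigmaK t (f + g) = sigmaK t f + sigmaK t g.
Proof.
move=> t1; rewrite [f]fracE [g]fracE addf_div ?tofrac_eq0 ?denom_ratioP //.
rewrite -!tofracM -tofracD !sigmaKE ?mulf_neq0 ?denom_ratioP //.
rewrite addf_div ?tofrac_eq0 ?sigma_eq0 ?denom_ratioP //.
by rewrite -!tofracM -tofracD (rmorphD (sigma t)) !(rmorphM (sigma t)).
Qed.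

Lemma sigmaKVK t : torus t -> cancel (sigmaK t) (sigmaK (tinv t)).
Proof.
move=> t1 f; rewrite [f]fracE sigmaKE ?denom_ratioP //.
have t1' := torus_tinv t1.
by rewrite sigmaKE ?sigma_eq0 ?denom_ratioP // !sigmaVK.
Qed.

Lemma taut_actV t u : torus t -> taut (actV t u) = sigmaK t (taut u).
Proof.
move=> t1; rewrite /taut !big_ord_recl !big_ord0 !addr0 !sigmaKD //.
rewrite !sigmaKM // !sigmaK_tofrac // !sigmaX !mxE -!mul_mpolyC.
by rewrite ![(_ * _)%:F]tofracM !mulrA ![_%:MP%:F * _]mulrC.
Qed.

Lemma vsval_actR t u : torus t -> vsval (actR t u) = actV t (vsval u).
Proof.
move=> t1; rewrite vsprojK // memRgen taut_actV //.
have := subvsP u; rewrite memRgen => /eqP ->.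
by rewrite -(tofrac0 S) sigmaK_tofrac // (rmorph0 (sigma t)).
Qed.

Lemma actRdualE t lam u : torus t ->
  actRdual t lam u = sigmaK t (lam (actR (tinv t) u)).
Proof.
move=> t1; have t1' := torus_tinv t1.
pose f u := sigmaK t (lam (actR (tinv t) u)) : K^o.
have actRlin c (v w : RK) :
  actR (tinv t) (c *: v + w) = sigmaK (tinv t) c *: actR (tinv t) v
                               + actR (tinv t) w.
  apply: val_inj; rewrite /= (vsval_actR _ t1') (linearP (vsval : RK -> _)) /= !vsval_actR //.
  apply/rowP => i; rewrite !mxE !sigmaKD // !sigmaKM // mulrDr.
  by rewrite mulrCA.
have flin : linear f.
  move=> c v w; rewrite /f actRlin linearP /= sigmaKD //; congr (_ + _).
  by rewrite /GRing.scale /= sigmaKM // -{1}[t]tinvK sigmaKVK.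
pose L := GRing.isLinear.Build K RK K^o *:%R f flin.
pose g : {linear RK -> K^o} := HB.pack f L.
exact: (lfunE g).
Qed.

Definition act_form d (t : 'I_3 -> F) (phi : form d) : form d :=
  fun l => sigmaK t (phi [ffun j => actRdual (tinv t) (l j)]).

Definition has_weight d (G : {set 'I_3} -> form d -> Prop) (a : 'X_{1..3})
    (z : cochain1 d) : Prop :=
  forall t, torus t ->
    coboundary1 G (fun i j l =>
      act_form t (z i j) l - (\prod_(h < 3) t h ^+ a h)%:MP%:F * z i j l).

(* c = \sum_chi dim(H^1(G)_chi) chi, where H^1(G) is finite-dimensional and the
   sum of its weight spaces: the classes of the w j form a basis of H^1(G) over
   F, the class of w j has weight a j, and c is the sum of the corresponding
   monomials.  Exponents a_h >= 0 suffice since t_1 t_2 t_3 = 1.  Over an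
   infinite field c is unique. *)
Definition H1_has_character d (G : {set 'I_3} -> form d -> Prop) (c : A) :=
  exists (n : nat) (w : 'I_n -> cochain1 d) (a : 'I_n -> 'X_{1..3}),
    [/\ forall j, cocycle1 G (w j) /\ has_weight G (a j) (w j),
        forall z, cocycle1 G z -> exists y : 'I_n -> F,
          coboundary1 G (fun i h l =>
            z i h l - \sum_j (y j)%:MP%:F * w j i h l),
        forall y : 'I_n -> F,
          coboundary1 G (fun i h l => \sum_j (y j)%:MP%:F * w j i h l) ->
          forall j, y j = 0
      & c = \sum_j toA 'X_[a j]].

End Cohomology.

(* Main.v *)
(* The sequence 0 -> D^d R -> D^d V (x) O -> D^(d-1) V (x) O(1) -> 0 presents
   H^1(D^d R(e-1)) as the cokernel of D^d V (x) S_(e-1) -> D^(d-1) V (x) S_e.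
   In weight a, where |a| = d + e - 1, this cokernel is the degree e part of
   F[x,y]/(x^(a_1+1), y^(a_2+1), (x+y)^(a_3+1)), whose dimension is determined by the
   least degree of a syzygy of the three powers.  In characteristic 2 Frobenius
   (splitting a syzygy into even and odd parts) and differentiation show that the graph
   of the syzygy gap, as a function of three exponents that satisfy the triangle
   inequality, is made of pyramids of height 2^i over the points 2^i (2 alpha + 1), for
   i >= 0 and alpha of Nim-sum zero (Han's theorem).  These pyramids do not overlap, so at most one
   i contributes to each weight.  On writing a = 2^(i+1) alpha + rho with
   rho_h < 2^(i+1), the contribution of i becomes the product of a Frobenius twist of
   a Nim character and of the generating function in rho, in which one recognizes the
   truncated Schur function. *)

Require Import Defs.
From mathcomp Require Import all_boot all_order all_algebra.
From HB Require Import structures.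
From mathcomp Require Import all_fingroup zify ring.
From Stdlib Require PeanoNat.
Import GRing.Theory.
Set Implicit Arguments.
Unset Strict Implicit.
Unset Printing Implicit Defensive.

(** * Nim-sums and pyramids *)

(** In weight a, the divided powers of exponent a - u times x^u, for u <= a, form a basis of the
    weight space of D^(d-1) V (x) S_e, and the map from D^d V (x) S_(e-1) becomes multiplication by
    x_1 + x_2 + x_3. This explains the powers of x, y, x + y with exponents a_h + 1, of sum d + e +
    2. If the least degree m of a syzygy is at most d, the syzygies of degree e are the multiples of
    one of degree m, and the cokernel has dimension d + 1 - m. Dimension at least j > 0 thus means a
    gap of at least e - d + 2j >= 2, which rules out the pyramids with i = 0. Both bounds on the gap
    use that it is 1-Lipschitz in each exponent and grows at least twofold under Frobenius. From
    below, counting dimensions gives gap at least 1 at an all-odd point, hence 2^i at its multiple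
    by 2^i. From above, a gap of 2 or more is passed on to halved exponents; halving needs an even
    exponent, and differentiation moves an odd one by 1 while the gap grows by 1. What remains, gap
    1, is combinatorics: every triple of odd sum lies in a pyramid or violates the triangle
    inequality. *)

Definition xor0 (a b c : nat) : bool := nimsum (nimsum a b) c == 0%N.

Lemma testbit0E n : PeanoNat.Nat.testbit n 0 = odd n.
Proof.
rewrite PeanoNat.Nat.bit0_odd; elim/ltn_ind: n => -[|[|n]] // IH.
by rewrite /= negbK -IH.
Qed.

Lemma div2E n : PeanoNat.Nat.div2 n = n./2.
Proof. by elim/ltn_ind: n => -[|[|n]] //= IH; rewrite IH. Qed.

Lemma nimsumE a b :
  nimsum a b = ((odd a (+) odd b) + (nimsum a./2 b./2).*2)%N.
Proof.
rewrite /nimsum -[LHS]odd_double_half -!testbit0E -!div2E; congr (_ + _.*2)%N.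
  by rewrite PeanoNat.Nat.lxor_spec; case: PeanoNat.Nat.testbit; case: PeanoNat.Nat.testbit.
by rewrite !PeanoNat.Nat.div2_spec PeanoNat.Nat.shiftr_lxor.
Qed.

(** Nim-sum zero is a condition on each binary place separately; the inductions below strip off the
    last one. *)
Lemma xor0_half a b c :
  xor0 a b c = ~~ odd (a + b + c) && xor0 a./2 b./2 c./2.
Proof.
rewrite /xor0 (nimsumE (nimsum a b) c) !oddD.
rewrite (nimsumE a b) oddD odd_double addbF halfD odd_double andbF add0n.
rewrite oddb doubleK.
have -> : forall x : bool, x./2 = 0%N by case.
by rewrite add0n; case: (odd a (+) odd b (+) odd c) => //=; rewrite double_eq0.
Qed.

Lemma xor0C a b c : xor0 a b c = xor0 b a c.
Proof. by rewrite /xor0 /nimsum (PeanoNat.Nat.lxor_comm a b). Qed.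

Lemma xor0AC a b c : xor0 a b c = xor0 a c b.
Proof.
rewrite /xor0 /nimsum !PeanoNat.Nat.lxor_assoc.
by rewrite (PeanoNat.Nat.lxor_comm b c).
Qed.

(** The Nim-sum is addition without carries, so it never exceeds the sum. *)
Lemma xor0_le a b c : xor0 a b c -> (a <= b + c)%N.
Proof.
elim/ltn_ind: a b c => a IH b c; have [->//|a0] := posnP a.
rewrite xor0_half => /andP[od /IH le]; have := le ltac:(lia); lia.
Qed.

(** Otherwise digit [s] would be 1 in all three numbers. *)
Lemma xor0_not_all_ge s a b c : xor0 a b c ->
    (2 ^ s <= a < 2 ^ s.+1)%N -> (2 ^ s <= b < 2 ^ s.+1)%N ->
  ~~ (2 ^ s <= c < 2 ^ s.+1)%N.
Proof.
elim: s a b c => [|s IH] a b c.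
  rewrite xor0_half => /andP[od _] /= ha hb; lia.
rewrite xor0_half => /andP[_ /IH H] ha hb; rewrite !expnS in H ha hb *.
have := H ltac:(lia) ltac:(lia); lia.
Qed.

(** From place [s] on, [b] has the digits of [a], so both are at least [2 ^ s]; the places below add
    at least [c], the Nim-sum of the lower parts. *)
Lemma xor0_two_ge s a b c : xor0 a b c ->
  (2 ^ s <= a)%N -> (c < 2 ^ s)%N -> (2 ^ s.+1 + c <= a + b)%N.
Proof.
elim: s a b c => [|s IH] a b c.
  move=> x; have := xor0_le x; have : (c <= a + b)%N.
    by apply: xor0_le; rewrite xor0C xor0AC.
  rewrite expn1 expn0; lia.
rewrite xor0_half => /andP[od /IH H] ha hc; rewrite !expnS in H ha hc *.
have := H ltac:(lia) ltac:(lia); lia.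
Qed.

(** In each of the [s] places at most two of the three digits are 1. *)
Lemma xor0_sum_lt s a b c : xor0 a b c ->
  (a < 2 ^ s)%N -> (b < 2 ^ s)%N -> (c < 2 ^ s)%N ->
  (a + b + c + 2 <= 2 ^ s.+1)%N.
Proof.
elim: s a b c => [|s IH] a b c; first by rewrite expn0 expn1; lia.
rewrite xor0_half => /andP[od /IH H] ha hb hc; rewrite !expnS in H ha hb hc *.
have := H ltac:(lia) ltac:(lia) ltac:(lia); lia.
Qed.

Definition dist (a b : nat) : nat := (a - b) + (b - a).

Lemma dist_triangle u v w : (dist v w <= dist u v + dist u w)%N.
Proof. by rewrite /dist; lia. Qed.

(** The leading digit of [a] has to be cancelled by that of [c]. *)
Lemma xor0_one_ge s a b c : xor0 a b c ->
  (2 ^ s <= a < 2 ^ s.+1)%N -> (b < 2 ^ s)%N -> ~~ (c < 2 ^ s)%N.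
Proof.
move=> x /andP[ha]; rewrite expnS => ha' hb; apply/negP => hc.
have := xor0_two_ge x ha hc; rewrite xor0AC in x; have := xor0_two_ge x ha hb.
by rewrite expnS; lia.
Qed.

(* The peaks of all smaller pyramids keep away from the interior of the pyramid
   with apex [2 ^ r]. *)
Lemma xor0_spread r a b c : (0 < r)%N -> xor0 a b c ->
    (a < 2 ^ r)%N -> (b < 2 ^ r)%N -> (c < 2 ^ r)%N ->
  (2 ^ r < dist (2 * a + 1) (2 ^ r) + dist (2 * b + 1) (2 ^ r)
           + dist (2 * c + 1) (2 ^ r))%N.
Proof.
case: r => // s _ x ha hb hc.
(* Two coordinates lie past the apex and one before it. *)
have two u v w : xor0 u v w -> (2 ^ s <= u)%N -> (2 ^ s <= v)%N -> (w < 2 ^ s)%N ->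
    (2 ^ s.+1 < dist (2 * u + 1) (2 ^ s.+1) + dist (2 * v + 1) (2 ^ s.+1)
                + dist (2 * w + 1) (2 ^ s.+1))%N.
  move=> y hu hv hw; have := xor0_two_ge y hu hw; rewrite expnS.
  by rewrite /dist; lia.
have xBA : xor0 b a c by rewrite xor0C.
have xCA : xor0 c a b by rewrite xor0C xor0AC.
have rg u : (2 ^ s <= u)%N -> (u < 2 ^ s.+1)%N -> (2 ^ s <= u < 2 ^ s.+1)%N by move=> -> ->.
(* Digit [s] is 1 in exactly two of the numbers or in none. *)
have [a1|a1] := leqP (2 ^ s) a; have [b1|b1] := leqP (2 ^ s) b;
  have [c1|c1] := leqP (2 ^ s) c.
- by have := xor0_not_all_ge x (rg _ a1 ha) (rg _ b1 hb); rewrite rg.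
- exact: two.
- by rewrite addnAC; apply: two; rewrite // xor0AC.
- by have := xor0_one_ge x (rg _ a1 ha) b1; rewrite c1.
- by rewrite -addnA addnC; apply: two; rewrite // xor0AC.
- by have := xor0_one_ge xBA (rg _ b1 hb) a1; rewrite c1.
- by have := xor0_one_ge xCA (rg _ c1 hc) a1; rewrite b1.
(* All three coordinates lie before the apex, and the bound on their sum keeps them far enough from
   it. *)
have := xor0_sum_lt x a1 b1 c1; rewrite expnS.
by rewrite /dist; lia.
Qed.

(* [cov a b c m]: a pyramid (or the region where the triangle inequality fails)
   gives the syzygy gap of exponents (a,b,c) a value at least m. *)
Definition cov (a b c m : nat) : Prop :=
  [\/ exists i u v w, xor0 u v w /\
        (dist a (2 ^ i * (2 * u + 1)) + dist b (2 ^ i * (2 * v + 1))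
         + dist c (2 ^ i * (2 * w + 1)) + m <= 2 ^ i)%N,
      (b + c + m <= a)%N, (a + c + m <= b)%N | (a + b + m <= c)%N].

(** The value certified by [cov] is 1-Lipschitz: its clauses are built from distances and from
    linear forms with coefficients 1 and -1. *)
Lemma cov_move a b c m a' b' c' m' : cov a b c m ->
  (dist a a' + dist b b' + dist c c' + m' <= m)%N -> cov a' b' c' m'.
Proof.
move=> -[[i [u [v [w [x h]]]]]|h|h|h] h'; [|move: h'; rewrite /dist => h'..].
- constructor 1; exists i, u, v, w; split => //.
  have := dist_triangle a a' (2 ^ i * (2 * u + 1)).
  have := dist_triangle b b' (2 ^ i * (2 * v + 1)).
  have := dist_triangle c c' (2 ^ i * (2 * w + 1)).
  by lia.
- constructor 2; lia.
- constructor 3; lia.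
- constructor 4; lia.
Qed.

(** The combinatorial counterpart of Frobenius: the index [i] of the pyramid becomes [i.+1], with
    the same [u], [v], [w]. *)
Lemma cov_double a b c m : cov a b c m -> cov (2 * a) (2 * b) (2 * c) (2 * m).
Proof.
move=> -[[i [u [v [w [x h]]]]]|h|h|h].
- constructor 1; exists i.+1, u, v, w; split => //.
  by move: h; rewrite /dist expnS -!mulnA; lia.
- constructor 2; lia.
- constructor 3; lia.
- constructor 4; lia.
Qed.

(** The form used in halving arguments: [a], [b], [c] are rounded halves, and the rounding errors
    are paid from the doubled value. *)
Lemma cov_near a b c m a' b' c' m' : cov a b c m ->
  (dist (2 * a) a' + dist (2 * b) b' + dist (2 * c) c' + m' <= 2 * m)%N ->
  cov a' b' c' m'.
Proof. by move=> /cov_double/cov_move; exact. Qed.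

(** All coordinates of a peak have the parity of [2 ^ i], so the two sides of the inequality for [m]
    differ in parity and it is strict; likewise for the triangle clauses. *)
Lemma cov_parity a b c m : cov a b c m -> odd (a + b + c + m) -> cov a b c m.+1.
Proof.
move=> -[[i [u [v [w [x h]]]]]|h|h|h] od.
- constructor 1; exists i, u, v, w; split => //; move: h; rewrite /dist.
  have E : forall z, (2 ^ i * (2 * z + 1) = 2 * (2 ^ i * z) + 2 ^ i)%N by lia.
  rewrite !{}E; lia.
- constructor 2; lia.
- constructor 3; lia.
- constructor 4; lia.
Qed.

(** The first statement is the goal; the second makes the induction work, since an all-odd triple is
    the centre of the doubled unit box over its halves. *)
Lemma cov_odd_and_box n a b c : (a + b + c <= n)%N ->
  (odd (a + b + c) -> cov a b c 1) /\
  ((forall x y z : bool, ~ cov (a + x) (b + y) (c + z) 2) -> xor0 a b c).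
Proof.
elim/ltn_ind: n a b c => n IH.
have covodd a b c : (a + b + c <= n)%N -> odd (a + b + c) -> cov a b c 1.
  move=> le od; have [allodd|notall] := boolP [&& odd a, odd b & odd c].
    (* The doubled corners are at distance 3 from the all-odd point, so a corner of value 2 leaves 4
       - 3 = 1. *)
    have [[x [y [z h]]]|none] := boolp.EM (exists x y z : bool,
        cov (a./2 + x) (b./2 + y) (c./2 + z) 2).
      by apply: (cov_near h); rewrite /dist; case: x y z {h} => -[] []; lia.
    have [||_ h] := IH (a./2 + b./2 + c./2)%N _ a./2 b./2 c./2; rewrite ?leqnn //.
      lia.
    (* Without such a corner the point is itself the peak of a pyramid of height 1. *)
    constructor 1; exists 0%N, a./2, b./2, c./2; split.
      by apply: h => x y z h; apply: none; exists x, y, z.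
    rewrite /dist; lia.
  (* The sum 1 is set apart because rounding the halves up would not decrease it. *)
  have [le1|gt1] := leqP (a + b + c) 1.
    have [a1|] := leqP 1 a; first by constructor 2; lia.
    have [b1|] := leqP 1 b; first by constructor 3; lia.
    by constructor 4; lia.
  (* Exactly one exponent is odd. Rounding its half down or up changes the parity of the sum of the
     halves, so one of the two roundings has an odd sum, with error 1. *)
  have [odh|odh] := boolP (odd (a./2 + b./2 + c./2)).
    have [||/(_ odh) h _] := IH (a./2 + b./2 + c./2)%N _ a./2 b./2 c./2; rewrite ?leqnn //.
      lia.
    by apply: (cov_near h); rewrite /dist; lia.
  have [||h _] := IH (uphalf a + uphalf b + uphalf c)%N _ (uphalf a) (uphalf b) (uphalf c);
    rewrite ?leqnn //.
    lia.
  have /h {}h : odd (uphalf a + uphalf b + uphalf c) by lia.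
  by apply: (cov_near h); rewrite /dist; lia.
move=> a b c le; split=> [|none]; first exact: covodd.
have [z|gt0] := posnP (a + b + c).
  by have [-> [-> ->]] : a = 0%N /\ b = 0%N /\ c = 0%N by lia.
(* Doubling the halves rounded up gives a corner of the box, which would acquire the value 2. *)
have upeven : ~~ odd (uphalf a + uphalf b + uphalf c).
  have le' : (uphalf a + uphalf b + uphalf c <= n)%N by lia.
  apply/negP => /(covodd _ _ _ le') h.
  by apply: (none (odd a) (odd b) (odd c)); apply: (cov_near h); rewrite /dist; lia.
rewrite xor0_half; apply/andP.
have xh : xor0 a./2 b./2 c./2.
  have [||_ h] := IH (a./2 + b./2 + c./2)%N _ a./2 b./2 c./2; rewrite ?leqnn //.
    lia.
  apply: h => x y z h.
  (* A doubled corner over the halves misses the corner [(x, y, z)] of the box by 1 wherever the bit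
     differs from the parity of the exponent. The value 4 absorbs two misses; for three, parity
     first raises 2 to 3. *)
  have [opp|nopp] := boolP [&& x != odd a, y != odd b & z != odd c].
    have {}h : cov (a./2 + x) (b./2 + y) (c./2 + z) 3 by apply: cov_parity => //; lia.
    apply: (none x y z).
    by apply: (cov_near h); rewrite /dist; lia.
  apply: (none x y z); apply: (cov_near h); rewrite /dist; lia.
split=> //; move: xh; rewrite xor0_half => /andP[even _]; lia.
Qed.

Lemma cov_odd a b c : odd (a + b + c) -> cov a b c 1.
Proof. by case: (@cov_odd_and_box _ a b c (leqnn _)). Qed.

(** * Pyramids in terms of the binary digits of a weight *)

Lemma xor0_mod2X i a b c :
  xor0 a b c -> xor0 (a %% 2 ^ i) (b %% 2 ^ i) (c %% 2 ^ i).
Proof.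
elim: i a b c => [|i IH] a b c; first by rewrite !modn1.
rewrite xor0_half => /andP[od /IH x].
have E n : (n %% 2 ^ i.+1 = odd n + (n./2 %% 2 ^ i).*2)%N.
  rewrite expnS -[in LHS](odd_double_half n) -muln2 [(_ * 2)%N]mulnC.
  have [q0 p0] : (0 < 2 ^ i /\ 0 < 2 * 2 ^ i)%N by rewrite muln_gt0 expn_gt0.
  have := ltn_pmod n./2 q0; have := divn_eq n./2 (2 ^ i).
  move: (n./2 %/ 2 ^ i)%N (n./2 %% 2 ^ i)%N => u r -> lt.
  rewrite mulnDr mulnCA addnCA modnMDl modn_small; lia.
rewrite xor0_half !E !half_bit_double x andbT; lia.
Qed.

(* By [dist_peak], [2 * peak_part i x + 2 ^ i] is [x.+1] plus the distance from [x.+1]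
   to the nearest number of the form [2 ^ i * (2 * u + 1)]. *)
Definition peak_part (i x : nat) : nat :=
  2 ^ i * (x %/ 2 ^ i.+1) + (x %% 2 ^ i.+1 - (2 ^ i - 1)).

(** For [a + b + c + 1 = d + e], this is half of what is left of the height [2 ^ i] after
    subtracting [e - d] and the distance of [(a.+1, b.+1, c.+1)] to the peak. The quotients single
    out the only peak of level [i] that can matter. *)
Definition level_dim (i a b c d : nat) : nat :=
  if xor0 (a %/ 2 ^ i.+1) (b %/ 2 ^ i.+1) (c %/ 2 ^ i.+1)
  then d.+1 - (2 ^ i + (peak_part i a + peak_part i b + peak_part i c)) else 0.

(** Before the peak, where the remainder is below [2 ^ i], both sides are constant; past it, each
    step of [x] adds 2 to both. *)
Lemma dist_peak i x :
  (dist x.+1 (2 ^ i * (2 * (x %/ 2 ^ i.+1) + 1)) + x.+1 = 2 * peak_part i x + 2 ^ i)%N.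
Proof.
rewrite /dist /peak_part; have q0 : (0 < 2 ^ i.+1)%N by rewrite expn_gt0.
have := ltn_pmod x q0; have := divn_eq x (2 ^ i.+1).
move: (x %/ _)%N (x %% _)%N => u r; rewrite expnS => -> lt.
have -> : (u * (2 * 2 ^ i) = 2 * (2 ^ i * u))%N by lia.
rewrite !mulnDr; move: (2 ^ i)%N (2 ^ i * u)%N lt => q v lt; lia.
Qed.

Lemma level_dim_dist i a b c d e j : (a + b + c + 1 = d + e)%N -> (0 < j)%N ->
  (j <= level_dim i a b c d)%N ->
  (dist a.+1 (2 ^ i * (2 * (a %/ 2 ^ i.+1) + 1)) + dist b.+1 (2 ^ i * (2 * (b %/ 2 ^ i.+1) + 1))
   + dist c.+1 (2 ^ i * (2 * (c %/ 2 ^ i.+1) + 1)) + e + 2 * j <= 2 ^ i + d)%N.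
Proof.
rewrite /level_dim; case: ifP => // _; last by lia.
have := dist_peak i a; have := dist_peak i b; have := dist_peak i c; lia.
Qed.

(** As [d <= e] and [0 < j], each distance is at most [2 ^ i - 2], which forces [u], [v], [w] to be
    the quotients used in [level_dim]. *)
Lemma dist_level_dim i a b c d e j u v w : (a + b + c + 1 = d + e)%N -> (d <= e)%N -> (0 < j)%N ->
  xor0 u v w ->
  (dist a.+1 (2 ^ i * (2 * u + 1)) + dist b.+1 (2 ^ i * (2 * v + 1))
   + dist c.+1 (2 ^ i * (2 * w + 1)) + e + 2 * j <= 2 ^ i + d)%N ->
  (j <= level_dim i a b c d)%N.
Proof.
move=> sum de j0 x le; have q0 : (0 < 2 ^ i)%N by rewrite expn_gt0.
have divE y s : (dist y.+1 (2 ^ i * (2 * s + 1)) + 2 <= 2 ^ i)%N -> (y %/ 2 ^ i.+1 = s)%N.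
  rewrite /dist => h; rewrite expnS.
  have hy : (2 ^ i * s * 2 <= y < 2 ^ i * s * 2 + 2 ^ i * 2)%N by lia.
  have -> : (y = s * (2 * 2 ^ i) + (y - s * (2 * 2 ^ i)))%N by lia.
  by rewrite divnMDl ?divn_small ?addn0 //; lia.
have ea := divE a u ltac:(lia); have eb := divE b v ltac:(lia).
have ec := divE c w ltac:(lia).
move: x le; rewrite -ea -eb -ec /level_dim => -> {ea eb ec divE}.
have := dist_peak i a; have := dist_peak i b; have := dist_peak i c; lia.
Qed.

(** By [xor0_spread], scaled by the smaller power of 2, the two peaks are at distance at least
    [2 ^ i + 2 ^ i'], whereas a common weight would be closer than [2 ^ i] to one and than [2 ^ i']
    to the other. *)
Lemma level_dim_inj i i' a b c d e : (a + b + c + 1 = d + e)%N -> (d <= e)%N ->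
  (0 < level_dim i a b c d)%N -> (0 < level_dim i' a b c d)%N -> i = i'.
Proof.
move=> sum de; wlog lt : i i' / (i < i')%N.
  move=> H h h'; have [lt|lt|//] := ltngtP i i'; first exact: H lt h h'.
  by apply/esym; exact: H lt h' h.
move=> h h'; have x : xor0 (a %/ 2 ^ i.+1) (b %/ 2 ^ i.+1) (c %/ 2 ^ i.+1).
  by move: h; rewrite /level_dim; case: ifP.
have := level_dim_dist sum (leqnn 1) h; have := level_dim_dist sum (leqnn 1) h'.
pose r := (i' - i)%N; have r0 : (0 < r)%N by rewrite subn_gt0.
have Q0 : (0 < 2 ^ r)%N by rewrite expn_gt0.
have sp := xor0_spread r0 (xor0_mod2X r x) (ltn_pmod _ Q0) (ltn_pmod _ Q0) (ltn_pmod _ Q0).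
have -> : i' = (i + r)%N by rewrite subnKC // ltnW.
have dv y : (y %/ 2 ^ (i + r).+1 = y %/ 2 ^ i.+1 %/ 2 ^ r)%N.
  by rewrite -addSn expnD divnMA.
rewrite !dv expnD.
(* The distance between the peaks depends only on the last [r] digits of the quotient [y]. *)
have dd y : (2 ^ i * dist (2 * (y %% 2 ^ r) + 1) (2 ^ r) =
    dist (2 ^ i * (2 * y + 1)) (2 ^ i * 2 ^ r * (2 * (y %/ 2 ^ r) + 1)))%N.
  rewrite {2}(divn_eq y (2 ^ r)) /dist mulnDr !mulnBr.
  by move: (y %/ _)%N (y %% _)%N => s t; lia.
move: sp; move: (a %/ 2 ^ i.+1)%N (b %/ 2 ^ i.+1)%N (c %/ 2 ^ i.+1)%N => a' b' c'.
have q0 : (0 < 2 ^ i)%N by rewrite expn_gt0.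
rewrite -(leq_pmul2l q0) mulnS [(2 ^ i * (_ + _ + dist _ _))%N]mulnDr.
rewrite [(2 ^ i * (dist _ _ + dist _ _))%N]mulnDr !dd.
have := dist_triangle a.+1 (2 ^ i * (2 * a' + 1))%N (2 ^ i * 2 ^ r * (2 * (a' %/ 2 ^ r) + 1))%N.
have := dist_triangle b.+1 (2 ^ i * (2 * b' + 1))%N (2 ^ i * 2 ^ r * (2 * (b' %/ 2 ^ r) + 1))%N.
have := dist_triangle c.+1 (2 ^ i * (2 * c' + 1))%N (2 ^ i * 2 ^ r * (2 * (c' %/ 2 ^ r) + 1))%N.
lia.
Qed.

(* A pyramid does not leave the region where the triangle inequality holds. *)
Lemma level_dim_le i a b c d e : (a + b + c + 1 = d + e)%N -> (d <= e)%N ->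
  (0 < level_dim i a b c d)%N -> [/\ (a <= e)%N, (b <= e)%N & (c <= e)%N].
Proof.
move=> sum de h; have x : xor0 (a %/ 2 ^ i.+1) (b %/ 2 ^ i.+1) (c %/ 2 ^ i.+1).
  by move: h; rewrite /level_dim; case: ifP.
have := level_dim_dist sum (leqnn 1) h.
have x1 := x; have x2 := x; rewrite xor0C in x1; rewrite xor0AC xor0C in x2.
have := leq_mul (leqnn (2 ^ i)) (xor0_le x).
have := leq_mul (leqnn (2 ^ i)) (xor0_le x1).
have := leq_mul (leqnn (2 ^ i)) (xor0_le x2).
have E u : (2 ^ i * (2 * u + 1) = 2 * (2 ^ i * u) + 2 ^ i)%N by lia.
rewrite !E !mulnDr /dist.
move: (2 ^ i)%N (2 ^ i * (a %/ _))%N (2 ^ i * (b %/ _))%N (2 ^ i * (c %/ _))%N => q u v w.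
by split; lia.
Qed.

Lemma level_dim_gt i a b c d e : (a + b + c + 1 = d + e)%N -> (d <= e)%N ->
  (0 < level_dim i a b c d)%N -> (2 ^ i <= d)%N.
Proof. by move=> sum de; rewrite /level_dim; case: ifP => // _; lia. Qed.

(** This is the origin of the index set. If level [i] contributes and the quotients add up to 2k,
    then d and e both lie between 2qk + q and 2qk + 2q - 2; so they have the same digits k above
    place [i], digit 1 there, and the low part of e is at most q - 2. *)
Lemma level_dim_digits i a b c d e : (0 < i)%N -> (a + b + c + 1 = d + e)%N -> (d <= e)%N ->
  let q := (2 ^ i)%N in let l := (d %/ 2 ^ i.+1)%N in
  let s x := (x %/ 2 ^ i.+1)%N in let rho x := (x %% 2 ^ i.+1)%N in
  level_dim i a b c d =
  if [&& (d %/ q) %% 2 == 1, (e %/ q) %% 2 == 1, l == e %/ 2 ^ i.+1, e %% q <= q - 2,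
       xor0 (s a) (s b) (s c) & s a + s b + s c == 2 * l]
  then (d %% q + 1 - ((rho a - (q - 1)) + (rho b - (q - 1)) + (rho c - (q - 1))))%N else 0%N.
Proof.
move=> i0 sum de q l s rho; have q0 : (0 < q)%N by rewrite expn_gt0.
have q1 : (1 < q)%N by rewrite /q (ltn_exp2l 0).
have Eq : (2 ^ i.+1 = 2 * q)%N by rewrite expnS.
have dm x : (x = 2 * (q * (x %/ 2 ^ i.+1)) + q * ((x %/ q) %% 2) + x %% q)%N.
  rewrite Eq [(2 * q)%N]mulnC divnMA {1}(divn_eq x q) {1}(divn_eq (x %/ q) 2); lia.
have dr x : (x = 2 * (q * (s x)) + rho x)%N.
  by rewrite {1}(divn_eq x (2 ^ i.+1)) Eq /s /rho Eq; lia.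
have rq x : (x %% q < q)%N by rewrite ltn_mod.
have rr x : (rho x < 2 * q)%N by rewrite /rho Eq ltn_mod muln_gt0.
have two x : (x %% 2 < 2)%N by rewrite ltn_mod.
rewrite /level_dim /peak_part -/q -/(s a) -/(s b) -/(s c) -/(rho a) -/(rho b) -/(rho c).
case: ifPn => x; last by rewrite !andbF.
have ev : ~~ odd (s a + s b + s c).
  by move: x; rewrite xor0_half => /andP[].
have [k Ek] : exists k, (s a + s b + s c = 2 * k)%N.
  by exists ((s a + s b + s c)./2); lia.
have Eqk : (q * s a + q * s b + q * s c = 2 * (q * k))%N by rewrite -!mulnDr Ek; lia.
have sum' := sum; rewrite (dr a) (dr b) (dr c) in sum'.
have := rr a; have := rr b; have := rr c; move: sum' Eqk.
move: (rho a) (rho b) (rho c) => ra rb rc sum' Eqk ha hb hc.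
case: ifPn => [/and5P[/eqP d1 e1 le re /andP[_ /eqP sl]]|no].
  have := dm d; rewrite d1 -/l.
  have : (k = l)%N by lia.
  move=> kl; rewrite kl in Eqk; rewrite muln1; move: Eqk => /=; clear.
  move: (ra - _)%N (rb - _)%N (rc - _)%N (q * s a)%N (q * s b)%N (q * s c)%N (q * l)%N.
  by move: (d %% q)%N => r u v w u' v' w' ql E1 ->; lia.
apply/eqP; rewrite subn_eq0 leqNgt; apply: contra no => gt.
(* The first bound drops the truncated differences, which are nonnegative; the second bounds them
   below by the untruncated ones. *)
have lo : (2 * (q * k) + q <= d)%N by lia.
have hi : (e <= 2 * (q * k) + q + (q - 2))%N by lia.
have dE y : (2 * (q * k) + q <= y)%N -> (y <= 2 * (q * k) + q + (q - 2))%N ->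
   [/\ y %/ 2 ^ i.+1 = k, (y %/ q) %% 2 = 1 & y %% q = y - (2 * (q * k) + q)]%N.
  move=> ly hy; have -> : y = ((2 * k + 1) * q + (y - (2 * (q * k) + q)))%N by lia.
  have sm : (y - (2 * (q * k) + q) < q)%N by lia.
  have E1 : (((2 * k + 1) * q + (y - (2 * (q * k) + q))) %/ q = 2 * k + 1)%N.
    by rewrite divnMDl // divn_small // addn0.
  split.
  - by rewrite Eq [(2 * q)%N]mulnC divnMA E1; lia.
  - by rewrite E1; lia.
  - by rewrite modnMDl modn_small //; lia.
have [d1 d2 d3] := dE d lo ltac:(lia); have [e1 e2 e3] := dE e ltac:(lia) hi.
by apply/and5P; split; [rewrite d2|rewrite e2|rewrite /l d1 e1|rewrite e3 leq_subLR|
  apply/andP; split => //; rewrite Ek /l d1].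
Qed.

Local Open Scope ring_scope.

Local Notation i0 := (ord0 : 'I_3).
Local Notation i1 := (lift ord0 ord0 : 'I_3).
Local Notation i2 := (lift ord0 (lift ord0 ord0) : 'I_3).

(** * Syzygies of powers of three linear forms *)

Section Syzygies.
Variable F : fieldType.
Hypothesis char2 : 2%N \in [pchar F].
Implicit Types (p f g h : {poly F}) (t A B C : nat).

Local Notation z := ('X + 1 : {poly F}).

(* Homogeneous syzygies of degree t of x^A, y^B, (x+y)^C, dehomogenized at y = 1. *)
Definition syz t A B C f g h : bool :=
  [&& f * 'X^A + g + h * z ^+ C == 0, (size f <= t.+1 - A)%N,
      (size g <= t.+1 - B)%N & (size h <= t.+1 - C)%N].

(** Only [f] and [h] are tested, since [f = h = 0] forces [g = 0]. *)
Definition has_syz t A B C : Prop :=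
  exists f g h, syz t A B C f g h /\ (f != 0) || (h != 0).

Lemma char2_poly : 2%N \in [pchar {poly F}].
Proof. by rewrite pchar_poly. Qed.

Lemma zE : z = 'X - 1%:P.
Proof. by rewrite polyC1 (oppr_pchar2 char2_poly). Qed.

Lemma z_neq0 : z != 0.
Proof. by rewrite zE polyXsubC_eq0. Qed.

Lemma size_z : size z = 2%N.
Proof. by rewrite zE size_XsubC. Qed.

Lemma size_mulz p : p != 0 -> size (p * z) = (size p).+1.
Proof. by move=> p0; rewrite size_mul ?z_neq0 // size_z addn2. Qed.

Lemma size_mulzX p n : p != 0 -> size (p * z ^+ n) = (size p + n)%N.
Proof.
move=> p0; rewrite size_mul ?expf_neq0 ?z_neq0 // zE size_exp_XsubC addnS.
by [].
Qed.

Lemma z1 : z.[1] = 0.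
Proof. by rewrite zE hornerXsubC subrr. Qed.

Lemma root1P p : p.[1] = 0 -> exists q, p = q * z.
Proof. by move/eqP/factor_theorem; rewrite zE. Qed.

Lemma syz_le t t' A B C f g h :
  (t <= t')%N -> syz t A B C f g h -> syz t' A B C f g h.
Proof. move=> le /and4P[E sf sg sh]; rewrite /syz E /=.
apply/and3P; split; [move: sf | move: sg | move: sh]; move/leq_trans; apply; lia. Qed.

Lemma has_syz_le t t' A B C : (t <= t')%N -> has_syz t A B C -> has_syz t' A B C.
Proof.
by move=> le [f [g [h [s nz]]]]; exists f, g, h; split=> //; exact: syz_le s.
Qed.

Lemma even_polyM2 p q : even_poly (p * (q \Po 'X^2)) = even_poly p * q.
Proof.
elim/poly_ind: q => [|q c IH]; first by rewrite comp_poly0 !mulr0 even_polyC.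
rewrite comp_polyD comp_polyM comp_polyX comp_polyC !mulrDr even_polyD.
rewrite ![_ * c%:P]mulrC !mul_polyC even_polyZ; congr (_ + _).
by rewrite expr2 !mulrA even_polyMX odd_polyMX IH.
Qed.

Lemma odd_polyM2 p q : odd_poly (p * (q \Po 'X^2)) = odd_poly p * q.
Proof.
have := even_polyM2 (p * 'X) q; rewrite even_polyMX mulrAC even_polyMX.
by rewrite mulrAC => /(mulIf (negbT (polyX_eq0 _))).
Qed.

(** In characteristic 2 the square of X + 1 is X^2 + 1. Only even powers of [z] are polynomials in
    X^2, which is why splitting a syzygy needs an even third exponent. *)
Lemma zX2 n : z ^+ n.*2 = (z ^+ n) \Po 'X^2.
Proof.
rewrite rmorphXn /= comp_polyD comp_polyX comp_polyC -mul2n exprM; congr (_ ^+ n).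
by rewrite -[z ^+ 2]/(pFrobenius_aut char2_poly z) rmorphD rmorph1 /= .
Qed.

Lemma X2 n : 'X^(n.*2) = 'X^n \Po 'X^2 :> {poly F}.
Proof. by rewrite comp_Xn_poly -mul2n exprM. Qed.

Lemma poly_even_odd0 p : p != 0 -> (even_poly p != 0) || (odd_poly p != 0).
Proof.
apply: contra_neqT; rewrite negb_or !negbK => /andP[/eqP e0 /eqP o0].
by rewrite -[p]poly_even_odd e0 o0 !comp_poly0 mul0r addr0.
Qed.

(* Splitting a syzygy along F[x] = F[x^2] (+) x F[x^2]. *)
Lemma has_syz_half t A B C : has_syz t A B C.*2 -> exists t' A' B',
  [/\ has_syz t' A' B' C, (dist (2 * A') A <= 1)%N, (dist (2 * B') B <= 1)%N &
    (4 * t' + A + B + 2 * C + dist (2 * A') A + dist (2 * B') B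
       <= 2 * (A' + B' + C) + 2 * t)%N].
Proof.
move=> [f [g [h [/and4P[/eqP E sf sg sh] nz]]]].
have se := size_even_poly; have so := size_odd_poly.
have e0 : even_poly (0 : {poly F}) = 0 by rewrite -polyC0 even_polyC.
have o0 : odd_poly (0 : {poly F}) = 0 by rewrite -polyC0 odd_polyC.
have EA : A = (odd A + A./2.*2)%N by rewrite odd_double_half.
(* For odd [A] the factor ['X^A] interchanges the even and the odd part. *)
pose fe := if odd A then odd_poly f else even_poly f.
pose fo := if odd A then even_poly f else odd_poly f.
have Ee : fe * 'X^(uphalf A) + even_poly g + even_poly h * z ^+ C = 0.
  rewrite -even_polyM2 -zX2 -e0 -[in RHS]E !even_polyD.
  congr (_ + _ + _); rewrite /fe uphalf_half [in RHS]EA; case: (odd A) => /=.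
    by rewrite !add1n !exprSr !mulrA even_polyMX X2 odd_polyM2.
  by rewrite add0n X2 even_polyM2.
have Eo : fo * 'X^(A./2) + odd_poly g + odd_poly h * z ^+ C = 0.
  rewrite -odd_polyM2 -zX2 -o0 -[in RHS]E !odd_polyD.
  congr (_ + _ + _); rewrite /fo [in RHS]EA; case: (odd A) => /=.
    by rewrite !add1n !exprSr !mulrA odd_polyMX X2 even_polyM2.
  by rewrite add0n X2 odd_polyM2.
have seE p n : (size p <= n)%N -> (size (even_poly p) <= uphalf n)%N.
  by move=> /uphalf_leq; apply: leq_trans; exact: se.
have soE p n : (size p <= n)%N -> (size (odd_poly p) <= n./2)%N.
  by move=> /half_leq; apply: leq_trans; exact: so.
have {}nz : (fe != 0) || (even_poly h != 0) \/ (fo != 0) || (odd_poly h != 0).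
  case/orP: nz => /poly_even_odd0/orP[] nz.
  - by rewrite /fe /fo; case: (odd A); rewrite nz; [right|left].
  - by rewrite /fe /fo; case: (odd A); rewrite nz; [left|right].
  - by left; rewrite nz orbT.
  - by right; rewrite nz orbT.
have sfe : (size fe <= t./2.+1 - uphalf A)%N.
  rewrite /fe; case: ifP => oA;
    [apply: leq_trans (soE _ _ sf) _ | apply: leq_trans (seE _ _ sf) _]; lia.
have sfo : (size fo <= (t.-1)./2.+1 - A./2)%N.
  rewrite /fo; case: ifP => oA;
    [apply: leq_trans (seE _ _ sf) _ | apply: leq_trans (soE _ _ sf) _]; lia.
case: nz => nz.
  (* After homogenization, the part even in x has powers of y of the parity of [t], all at least
     [B]; hence half of [B] is rounded up for even [t] and down for odd [t]. *)
  exists t./2, (uphalf A), (if odd t then B./2 else uphalf B); split.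
  - exists fe, (even_poly g), (even_poly h); split=> //.
    rewrite /syz Ee eqxx sfe /=; apply/andP; split.
      by apply: leq_trans (seE _ _ sg) _; case: ifP; lia.
    by apply: leq_trans (seE _ _ sh) _; lia.
  - rewrite /dist; lia.
  - rewrite /dist; case: ifP; lia.
  - rewrite /dist; case: ifP; lia.
(* A nonzero odd part exists only in positive degree. *)
have t0 : (0 < t)%N.
  case: t {sfe sfo} sf sg sh => // sf sg sh.
  case/orP: nz; rewrite -size_poly_gt0 => /leq_trans lt; last first.
    by have := lt _ (soE _ _ sh); lia.
  move: lt; rewrite /fo; case: ifP => oA lt.
    by have := lt _ (seE _ _ sf); lia.
  by have := lt _ (soE _ _ sf); lia.
exists (t.-1)./2, A./2, (if odd t then uphalf B else B./2); split.
- exists fo, (odd_poly g), (odd_poly h); split=> //.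
  rewrite /syz Eo eqxx sfo /=; apply/andP; split.
    by apply: leq_trans (soE _ _ sg) _; case: ifP; lia.
  by apply: leq_trans (soE _ _ sh) _; lia.
- rewrite /dist; lia.
- rewrite /dist; case: ifP; lia.
- rewrite /dist; case: ifP; lia.
Qed.

Lemma coprimep_Xz A C : coprimep 'X^A (z ^+ C).
Proof.
apply/coprimep_expl/coprimep_expr; rewrite zE coprimep_sym coprimepX rootE hornerXsubC.
by rewrite sub0r oppr_eq0 oner_eq0.
Qed.

(** The bounds to which this applies are truncated differences; a bound 0 makes the product vanish,
    hence the guards. *)
Lemma size_mul_bound p (q : {poly F}) n m k : (size p <= n)%N -> (size q <= m)%N ->
  ((0 < n)%N -> (0 < m)%N -> (n + m <= k.+1)%N) -> (size (p * q)%R <= k)%N.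
Proof.
move=> sp sq le; have [->|p0] := eqVneq p 0; first by rewrite mul0r size_poly0.
have [->|q0] := eqVneq q 0; first by rewrite mulr0 size_poly0.
have n0 : (0 < n)%N by rewrite (leq_trans _ sp) // size_poly_gt0.
have m0 : (0 < m)%N by rewrite (leq_trans _ sq) // size_poly_gt0.
apply: leq_trans (size_polyMleq _ _) _; rewrite -ltnS (leq_trans _ (le n0 m0)) //.
rewrite prednK ?addn_gt0 ?size_poly_gt0 ?p0 //; exact: leq_add.
Qed.

(** The cross product of two syzygies is a multiple of (x^A, y^B, z^C). Its entry [g * h' - g' * h]
    is divisible by x^A, but has degree at most t + t' - B - C < A, so it vanishes. *)
Lemma syz_cross t t' A B C f g h f' g' h' :
  syz t A B C f g h -> syz t' A B C f' g' h' -> (t + t' < A + B + C)%N ->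
  g * h' = g' * h /\ f * h' = f' * h.
Proof.
move=> /and4P[/eqP E sf sg sh] /and4P[/eqP E' sf' sg' sh'] lt.
have Ef : f * 'X^A = - (g + h * z ^+ C).
  by apply/eqP; rewrite -addr_eq0 addrA E.
have Ef' : f' * 'X^A = - (g' + h' * z ^+ C).
  by apply/eqP; rewrite -addr_eq0 addrA E'.
suff Egh : g * h' = g' * h.
  split=> //; apply: (mulIf (expf_neq0 A (negbT (polyX_eq0 F)))).
  rewrite mulrAC Ef [RHS]mulrAC Ef' !mulNr !mulrDl Egh.
  by rewrite [h' * _ * h]mulrAC [h' * h]mulrC [h * _ * h']mulrAC.
apply/eqP; rewrite -subr_eq0; apply/negPn/negP => w0.
have dvd : 'X^A %| (g * h' - g' * h).
  rewrite -(Gauss_dvdpl _ (coprimep_Xz A C)); apply/dvdpP; exists (f * g' - f' * g).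
  have -> : (f * g' - f' * g) * 'X^A = g' * (f * 'X^A) - g * (f' * 'X^A) by ring.
  rewrite Ef Ef'; ring.
have := dvdp_leq w0 dvd; rewrite size_polyXn ltnNge => /negP; apply.
rewrite (leq_trans (size_polyD _ _)) // geq_max size_polyN.
by rewrite (size_mul_bound sg sh') ?(size_mul_bound sg' sh) //; lia.
Qed.

(* Differentiating a syzygy gives one of the next degree; when it is proportional
   to the original one, z divides h, or f and g. *)
Lemma has_syz_odd t A B C : odd C -> (2 * t + 2 <= A + B + C)%N ->
  has_syz t A B C -> has_syz t A B C.+1 \/ has_syz t.-1 A B C.-1.
Proof.
move=> oC le [f [g [h [s nz]]]]; have /and4P[/eqP E sf sg sh] := s.
have oneC : C%:R = 1 :> {poly F}.
  rewrite -[C]odd_double_half oC natrD -mul2n natrM (pcharf0 char2_poly).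
  by rewrite mul0r addr0.
(* The derivation ['X * z] times d/dX multiplies ['X^A] by [A%:R * z] and, [C] being odd, [z ^+ C]
   by ['X]; so it maps the syzygy to another one for the same powers. *)
pose f1 := 'X * z * f^`() + A%:R * z * f; pose g1 := 'X * z * g^`().
pose h1 := 'X * (z * h^`() + h).
have E1 : f1 * 'X^A + g1 + h1 * z ^+ C = 0.
  have XA : 'X * ('X^A)^`() = A%:R * 'X^A :> {poly F}.
    by rewrite derivXn -mulr_natl; case: (A) => [|n]; rewrite ?mul0r ?mulr0 //= mulrCA -exprS.
  have zC : z * (z ^+ C)^`() = z ^+ C.
    rewrite deriv_exp derivD derivX -polyC1 derivC addr0 mul1r polyC1 -mulr_natl oneC mul1r.
    by case: (C) oC => // n _; rewrite -exprS.
  have <- : 'X * z * (f * 'X^A + g + h * z ^+ C)^`() = 0 by rewrite E derivC mulr0.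
  rewrite !derivD !derivM /f1 /g1 /h1; move: (deriv 'X^A) XA => u XA.
  move: z (z ^+ C) (deriv (z ^+ C)) zC => y Q v zC.
  have -> : 'X * y * (f^`() * 'X^A + f * u + g^`() + (h^`() * Q + h * v)) =
    'X * y * f^`() * 'X^A + y * f * ('X * u) + 'X * y * g^`() + 'X * y * h^`() * Q
    + 'X * h * (y * v) by ring.
  rewrite XA zC; ring.
have sz1 p n : (size p <= n)%N -> (size ('X * z * p^`())%R <= n.+1)%N.
  move=> sp; have [->|p0] := eqVneq p^`() 0; first by rewrite mulr0 size_poly0.
  have p0' : p != 0 by apply: contraNneq p0 => ->; rewrite derivC.
  rewrite mulrC mulrA size_mulz ?mulf_neq0 ?polyX_eq0 // size_mulX //.
  by rewrite ltnS (leq_trans _ sp) // lt_size_deriv.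
have sz2 p n : (size p <= n)%N -> (size (z * p)%R <= n.+1)%N.
  move=> sp; have [->|p0] := eqVneq p 0; first by rewrite mulr0 size_poly0.
  by rewrite mulrC size_mulz.
have sz3 p n : (size p <= n)%N -> (size ('X * p)%R <= n.+1)%N.
  move=> sp; have [->|p0] := eqVneq p 0; first by rewrite mulr0 size_poly0.
  by rewrite mulrC size_mulX.
have z0 n p : (size p <= n)%N -> n = 0%N -> p = 0.
  by move=> sp n0; apply/eqP; rewrite -size_poly_leq0 -n0.
have s1 : syz t.+1 A B C f1 g1 h1.
  have up' p (q : {poly F}) m : (size p <= t.+1 - m)%N ->
      (forall n, (size p <= n)%N -> (size q <= n.+1)%N) -> (p = 0 -> q = 0) ->
      (size q <= t.+2 - m)%N.
    move=> sp spq pq; have [lt|lt] := ltnP t m.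
      by rewrite pq ?size_poly0 //; apply: z0 sp _; lia.
    by apply: leq_trans (spq _ sp) _; lia.
  rewrite /syz E1 eqxx /=; apply/and3P; split.
  - apply: up' sf _ _ => [n sn|e0]; last by rewrite /f1 e0 derivC !mulr0 addr0.
    apply: leq_trans (size_polyD _ _) _; rewrite geq_max sz1 //=.
    by rewrite -mulrA -polyC_natr mul_polyC; apply: leq_trans (size_scale_leq _ _) _; exact: sz2.
  - by apply: up' sg _ _ => [n sn|e0]; [exact: sz1|rewrite /g1 e0 derivC mulr0].
  - apply: up' sh _ _ => [n sn|e0]; last by rewrite /h1 e0 derivC mulr0 addr0 mulr0.
    rewrite /h1 mulrDr mulrA; apply: leq_trans (size_polyD _ _) _.
    by rewrite geq_max sz1 //= sz3.
(* The degrees [t] and [t.+1] are small enough for proportionality. At the root 1 of [z], [g1]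
   vanishes and [h1] takes the value of [h], so [g] or [h] vanishes there. *)
have [|Egh _] := syz_cross s s1; first by lia.
have {Egh} : g.[1] * h.[1] = 0.
  have := congr1 (horner^~ 1) Egh; rewrite /g1 /h1 !hornerM hornerD !hornerM hornerX z1.
  by rewrite !(mul0r, mul1r, mulr0, add0r).
move=> /eqP; rewrite mulf_eq0 => /orP[] /eqP r1; last first.
  left; have [h2 Eh] := root1P r1; exists f, g, h2.
  have h20 : (h2 != 0) = (h != 0) by rewrite Eh mulf_eq0 (negPf z_neq0) orbF.
  split; last by rewrite h20.
  rewrite /syz sf sg exprS mulrA -Eh E eqxx /=.
  have [->|h2n] := eqVneq h2 0; first by rewrite size_poly0.
  by move: sh; rewrite Eh size_mulz // subnS; case: (t.+1 - C)%N.
(* Here [g], hence also [f], vanishes at 1; dividing the relation by [z] lowers both the degree and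
   [C]. *)
right.
have f1r : f.[1] = 0.
  have := congr1 (horner^~ 1) E; rewrite !hornerD !hornerM hornerXn expr1n mulr1 r1.
  by rewrite horner_exp z1 expr0n horner0; case: (C) oC => // n _; rewrite mulr0 !addr0.
have [f2 Ef] := root1P f1r; have [g2 Eg] := root1P r1.
have sz (p q : {poly F}) m : p = q * z -> (size p <= t.+1 - m)%N -> (size q <= t - m)%N.
  move=> ->; have [->|q0] := eqVneq q 0; first by rewrite size_poly0.
  by rewrite size_mulz //; lia.
have sf2 := sz _ _ _ Ef sf; have sg2 := sz _ _ _ Eg sg.
have E2 : f2 * 'X^A + g2 + h * z ^+ C.-1 = 0.
  apply: (mulIf z_neq0); rewrite mul0r -[RHS]E Ef Eg.
  by rewrite -[in RHS](prednK (odd_gt0 oC)) exprS; ring.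
have t0 : (0 < t)%N.
  case: (t) sf2 sg2 => // sf2 sg2.
  have f20 : f2 = 0 by apply: z0 sf2 _; lia.
  have g20 : g2 = 0 by apply: z0 sg2 _; lia.
  move: E2; rewrite f20 g20 mul0r !add0r => /eqP.
  rewrite mulf_eq0 expf_eq0 (negPf z_neq0) andbF orbF => /eqP h0.
  by move: nz; rewrite Ef f20 mul0r h0 eqxx.
exists f2, g2, h; split.
  rewrite /syz E2 eqxx /= prednK // sf2 sg2 /=.
  by case: (C) oC sh => //= n _; rewrite subSS.
by case/orP: nz => [|->]; rewrite ?orbT // Ef mulf_eq0 negb_or => /andP[-> _].
Qed.

(** Constants relate the three powers only if two of the exponents are 0, and then the triangle
    inequality fails by the third. *)
Lemma has_syz0_cov A B C : has_syz 0 A B C -> cov A B C (A + B + C).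
Proof.
move=> [f [g [h [/and4P[/eqP E sf sg sh] nz]]]].
have z0 (p : {poly F}) m : (size p <= 1 - m)%N -> (0 < m)%N -> p = 0.
  by move=> sp m0; apply/eqP; rewrite -size_poly_leq0 (leq_trans sp) //; lia.
have [A0|A0] := posnP A; have [B0|B0] := posnP B; have [C0|C0] := posnP C;
  try by (constructor 2; lia) || (constructor 3; lia) || (constructor 4; lia).
all: exfalso; move: nz E.
- rewrite (z0 _ _ sg B0) (z0 _ _ sh C0) mul0r !addr0 eqxx orbF => /negPf f0 /eqP.
  by rewrite mulf_eq0 f0 expf_eq0 polyX_eq0 andbF.
- by rewrite (z0 _ _ sf A0) (z0 _ _ sh C0) eqxx.
- rewrite (z0 _ _ sg B0) (z0 _ _ sf A0) mul0r !add0r eqxx => /negPf h0 /eqP.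
  by rewrite mulf_eq0 h0 expf_eq0 (negPf z_neq0) andbF.
- by rewrite (z0 _ _ sf A0) (z0 _ _ sh C0) eqxx.
Qed.

(* The upper bound in Han's theorem on syzygy gaps, in characteristic 2. *)
Lemma has_syz_cov t A B C : has_syz t A B C -> (2 * t < A + B + C)%N ->
  cov A B C (A + B + C - 2 * t).
Proof.
have [n] := ubnP (A + B + C); elim: n t A B C => // n IH t A B C lt s gap.
(* The case of an even third exponent: the induction hypothesis covers the halves, and [cov_near]
   pays for the rounding. *)
have even C' t' m : has_syz t' A B C'.*2 -> (A + B + C'.*2 = m + 2 * t')%N -> (1 < m)%N ->
    (A + B + 2 * C' + 2 < n + n)%N -> cov A B C'.*2 m.
  move=> /has_syz_half[t1 [A1 [B1 [s1 dA dB le]]]] Em m1 ln.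
  have dE x y : dist x y = ((x - y) + (y - x))%N by [].
  have gap1 : (2 * t1 < A1 + B1 + C')%N by lia.
  have small : (A1 + B1 + C' < n)%N.
    move: dA dB; rewrite /dist; lia.
  have cv := IH _ _ _ _ small s1 gap1.
  rewrite -mul2n; apply: (cov_near cv); rewrite [dist (2 * C') _]/dist subnn; lia.
(* For gap 1 the sum of the exponents is odd, and combinatorics alone decides. *)
have [c1|c1] := leqP (A + B + C) (2 * t + 1).
  have -> : (A + B + C - 2 * t = 1)%N by lia.
  by apply: cov_odd; lia.
have [t0|t0] := posnP t.
  by rewrite t0 muln0 subn0; apply: has_syz0_cov; rewrite -t0.
have [oC|eC] := boolP (odd C); last first.
  have EC : C = C./2.*2 by lia.
  have := even C./2 t (A + B + C - 2 * t)%N; rewrite -EC; apply=> //; lia.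
have le2 : (2 * t + 2 <= A + B + C)%N by lia.
(* One of the even neighbours of [C] has a gap larger by 1, and moving back to [C] costs exactly
   this unit. *)
have [s1|s1] := has_syz_odd oC le2 s.
  have EC : C.+1 = (C.+1)./2.*2 by lia.
  have cv : cov A B C.+1 (A + B + C - 2 * t).+1.
    by have := even (C.+1)./2 t (A + B + C - 2 * t).+1; rewrite -EC; apply=> //; lia.
  by apply: (cov_move cv); rewrite /dist; lia.
have EC : C.-1 = (C.-1)./2.*2 by lia.
have cv : cov A B C.-1 (A + B + C - 2 * t).+1.
  by have := even (C.-1)./2 t.-1 (A + B + C - 2 * t).+1; rewrite -EC; apply=> //; lia.
by apply: (cov_move cv); rewrite /dist; lia.
Qed.

(** * The ideal of the three powers in a fixed degree, and its minimal syzygy *)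

Definition band_mul (n m : nat) p : 'M[F]_(n, m) :=
  lin1_mx (poly_rV \o p \o* rVpoly).

Lemma mul_band n m p (u : 'rV_n) :
  u *m band_mul n m p = poly_rV (rVpoly u * p).
Proof. by rewrite mul_rV_lin1. Qed.

(* The rows span the degree t part of the ideal (x^A, y^B, z^C). *)
Definition ideal_mx t A B C : 'M[F]_(t.+1 - A + (t.+1 - B + (t.+1 - C)), t.+1) :=
  col_mx (band_mul _ _ 'X^A) (col_mx (band_mul _ _ 1) (band_mul _ _ (z ^+ C))).

Lemma mul_ideal_mx t A B C (u : 'rV_(t.+1 - A)) (v : 'rV_(t.+1 - B)) (w : 'rV_(t.+1 - C)) :
  row_mx u (row_mx v w) *m ideal_mx t A B C =
  poly_rV (rVpoly u * 'X^A + rVpoly v + rVpoly w * z ^+ C).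
Proof.
rewrite !mul_row_col !mul_band mulr1 !linearD /= addrA.
by [].
Qed.

Lemma size_rVpoly n (u : 'rV[F]_n) : (size (rVpoly u) <= n)%N.
Proof. exact: size_poly. Qed.

Lemma size_comb t A B C f g h : (size f <= t.+1 - A)%N -> (size g <= t.+1 - B)%N ->
  (size h <= t.+1 - C)%N -> (size (f * 'X^A + g + h * z ^+ C)%R <= t.+1)%N.
Proof.
move=> sf sg sh.
have sM p (q : {poly F}) n : (size p <= t.+1 - n)%N -> size q = n.+1 ->
    (size (p * q)%R <= t.+1)%N.
  move=> sp sq; have [->|p0] := eqVneq p 0; first by rewrite mul0r size_poly0.
  apply: leq_trans (size_polyMleq _ _) _; rewrite sq addnS /=.
  have := p0; rewrite -size_poly_gt0; move: (size p) sp => s; lia.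
apply: leq_trans (size_polyD _ _) _; rewrite geq_max; apply/andP; split.
  apply: leq_trans (size_polyD _ _) _; rewrite geq_max.
  by rewrite (sM _ _ _ sf) ?size_polyXn //= (leq_trans sg) ?leq_subr.
by rewrite (sM _ _ _ sh) // zE size_exp_XsubC.
Qed.

Lemma kermx_idealP t A B C (u : 'rV_(t.+1 - A)) (v : 'rV_(t.+1 - B)) (w : 'rV_(t.+1 - C)) :
  (row_mx u (row_mx v w) <= kermx (ideal_mx t A B C))%MS
  = syz t A B C (rVpoly u) (rVpoly v) (rVpoly w).
Proof.
rewrite sub_kermx mul_ideal_mx /syz !size_rVpoly !andbT.
apply/eqP/eqP => [|->]; last by rewrite linear0.
by move/(congr1 rVpoly); rewrite linear0 poly_rV_K //; apply: size_comb; exact: size_rVpoly.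
Qed.

Lemma ideal_mxP t A B C p : (size p <= t.+1)%N ->
  reflect (exists f g h, [/\ p = f * 'X^A + g + h * z ^+ C, (size f <= t.+1 - A)%N,
             (size g <= t.+1 - B)%N & (size h <= t.+1 - C)%N])
          (poly_rV p <= ideal_mx t A B C)%MS.
Proof.
move=> sp; apply: (iffP submxP) => [[u]|[f [g [h [Ep sf sg sh]]]]].
  rewrite -[u]hsubmxK -[rsubmx u]hsubmxK mul_ideal_mx => /(congr1 rVpoly).
  rewrite (poly_rV_K sp) poly_rV_K => [->|]; last by apply: size_comb; exact: size_rVpoly.
  by do 3 eexists; split; first reflexivity; exact: size_rVpoly.
exists (row_mx (poly_rV f) (row_mx (poly_rV g) (poly_rV h))).
by rewrite mul_ideal_mx !poly_rV_K // Ep.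
Qed.

(** The triples of cofactors form a space of dimension at least 3t + 3 - (A + B + C), more than the
    t + 1 of its target. *)
Lemma has_syz_exists t A B C : (A + B + C <= 2 * t + 1)%N -> has_syz t A B C.
Proof.
move=> le; pose M := ideal_mx t A B C.
have : kermx M != 0.
  rewrite -mxrank_eq0 mxrank_ker -lt0n subn_gt0.
  by apply: leq_ltn_trans (rank_leq_col _) _; lia.
move/rowV0Pn => [u]; rewrite -[u]hsubmxK -[rsubmx u]hsubmxK kermx_idealP => s u0.
exists (rVpoly (lsubmx u)), (rVpoly (lsubmx (rsubmx u))), (rVpoly (rsubmx (rsubmx u))).
split=> //; apply: contraNT u0; rewrite negb_or !negbK => /andP[/eqP f0 /eqP h0].
have /and4P[/eqP + _ _ _] := s; rewrite f0 h0 !mul0r add0r addr0 => g0.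
rewrite -[lsubmx u]rVpolyK -[lsubmx (rsubmx u)]rVpolyK -[rsubmx (rsubmx u)]rVpolyK.
by rewrite f0 g0 h0 !linear0 !row_mx0.
Qed.

(** In characteristic 2 a syzygy can be squared entry by entry. *)
Lemma has_syz_expX t A B C i :
  has_syz t A B C -> has_syz (2 ^ i * t) (2 ^ i * A) (2 ^ i * B) (2 ^ i * C).
Proof.
elim: i => [|i IH] s; first by rewrite !mul1n.
have [f [g [h [/and4P[/eqP E sf sg sh] nz]]]] := IH s.
rewrite !expnS -!mulnA; move: (2 ^ i * t)%N (2 ^ i * A)%N (2 ^ i * B)%N (2 ^ i * C)%N
  E sf sg sh => t' A' B' C' E sf sg sh.
exists (f ^+ 2), (g ^+ 2), (h ^+ 2); split; last by rewrite !expf_eq0.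
have sz p m : (size p <= t'.+1 - m)%N -> (size (p ^+ 2)%R <= (2 * t').+1 - 2 * m)%N.
  have [->|p0] := eqVneq p 0; first by rewrite expr0n size_poly0.
  rewrite expr2 size_mul //; have := p0; rewrite -size_poly_gt0.
  move: (size p) => s0; lia.
rewrite /syz !sz // !andbT; apply/eqP.
have -> : f ^+ 2 * 'X^(2 * A') + g ^+ 2 + h ^+ 2 * z ^+ (2 * C')
    = (f * 'X^A' + g + h * z ^+ C') ^+ 2.
  have sqD (p q : {poly F}) : (p + q) ^+ 2 = p ^+ 2 + q ^+ 2.
    exact: (rmorphD (pFrobenius_aut char2_poly)).
  by rewrite !sqD !exprMn -!exprM ![(2 * _)%N]mulnC.
by rewrite E expr0n.
Qed.

Lemma size_shift p (q : {poly F}) t n m k : (size p <= t.+1 - m)%N -> size q = n.+1 ->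
  (t.+1 - m + n <= k)%N || (t < m)%N -> (size (p * q)%R <= k)%N.
Proof.
move=> sp sq; have [->|p0] := eqVneq p 0; first by rewrite mul0r size_poly0.
have := p0; rewrite -size_poly_gt0 => /leq_trans/(_ sp) s0 le.
apply: leq_trans (size_polyMleq _ _) _; rewrite sq addnS /=.
by apply: leq_trans (leq_add sp (leqnn n)) _; lia.
Qed.

Lemma size_zX n : size (z ^+ n) = n.+1.
Proof. by rewrite zE size_exp_XsubC. Qed.

(** When the exponent grows, the whole relation is multiplied by the missing power of x; when it
    falls, the surplus power is absorbed into [f]. *)
Lemma has_syz_moveA t A B C A' :
  has_syz t A B C -> has_syz (t + (A' - A)) A' B C.
Proof.
move=> [f [g [h [/and4P[/eqP E sf sg sh] nz]]]].
exists (f * 'X^(A - A')), (g * 'X^(A' - A)), (h * 'X^(A' - A)); split.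
  rewrite /syz (size_shift sf (size_polyXn _ _)) ?(size_shift sg (size_polyXn _ _))
    ?(size_shift sh (size_polyXn _ _)) //; try lia.
  rewrite !andbT -[X in _ == X](mul0r 'X^(A' - A)) -{}E -mulrA -exprD.
  have -> : (A - A' + A' = A' - A + A)%N by lia.
  by rewrite exprD; apply/eqP; ring.
by rewrite !mulf_eq0 !expf_eq0 polyX_eq0 !andbF !orbF.
Qed.

(** As y is set to 1, the polynomials stay the same and only the degree bounds change. *)
Lemma has_syz_moveB t A B C B' :
  has_syz t A B C -> has_syz (t + (B' - B)) A B' C.
Proof.
move=> [f [g [h [/and4P[/eqP E sf sg sh] nz]]]]; exists f, g, h; split=> //.
rewrite /syz E eqxx /= (leq_trans sf) ?(leq_trans sg) ?(leq_trans sh) //; lia.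
Qed.

Lemma has_syz_moveC t A B C C' :
  has_syz t A B C -> has_syz (t + (C' - C)) A B C'.
Proof.
move=> [f [g [h [/and4P[/eqP E sf sg sh] nz]]]].
exists (f * z ^+ (C' - C)), (g * z ^+ (C' - C)), (h * z ^+ (C - C')); split.
  rewrite /syz (size_shift sf (size_zX _)) ?(size_shift sg (size_zX _))
    ?(size_shift sh (size_zX _)) //; try lia.
  rewrite !andbT -[X in _ == X](mul0r (z ^+ (C' - C))) -{}E -[h * _ * _]mulrA -exprD.
  have -> : (C - C' + C' = C' - C + C)%N by lia.
  by rewrite [z ^+ (_ + _)]exprD; apply/eqP; ring.
by rewrite !mulf_eq0 !expf_eq0 (negPf z_neq0) !andbF !orbF.
Qed.

(** The lower bound for the gap: counting gives a syzygy of gap 1 at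
    [(2 * u + 1, 2 * v + 1, 2 * w + 1)], Frobenius raises this to [2 ^ i] at the peak, and each step
    away from the peak costs at most 1. *)
Lemma has_syz_peak t A B C i u v w :
  (dist A (2 ^ i * (2 * u + 1)) + dist B (2 ^ i * (2 * v + 1))
     + dist C (2 ^ i * (2 * w + 1)) + (A + B + C) <= 2 ^ i + 2 * t)%N ->
  has_syz t A B C.
Proof.
move=> le; have s : has_syz (u + v + w + 1) (2 * u + 1) (2 * v + 1) (2 * w + 1).
  by apply: has_syz_exists; lia.
have := has_syz_moveC C (has_syz_moveB B (has_syz_moveA A (has_syz_expX i s))).
apply: has_syz_le => //; move: le; rewrite /dist; move: (2 ^ i)%N => q.
have dE x : (q * (2 * x + 1) = 2 * (q * x) + q)%N by lia.
by rewrite !dE !mulnDr muln1; lia.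
Qed.

(** Otherwise the homogeneous syzygy would be divisible by y. *)
Lemma syz_min_top t A B C f g h : syz t A B C f g h -> (f != 0) || (h != 0) ->
  (forall t', has_syz t' A B C -> (t <= t')%N) ->
  [\/ size f = (t.+1 - A)%N /\ f != 0, size g = (t.+1 - B)%N /\ g != 0
    | size h = (t.+1 - C)%N /\ h != 0].
Proof.
move=> /and4P[E sf sg sh] nz tmin.
have [f1|f1] := boolP ((size f == (t.+1 - A)%N) && (f != 0)).
  by case/andP: f1 => /eqP; constructor 1.
have [g1|g1] := boolP ((size g == (t.+1 - B)%N) && (g != 0)).
  by case/andP: g1 => /eqP; constructor 2.
have [h1|h1] := boolP ((size h == (t.+1 - C)%N) && (h != 0)).
  by case/andP: h1 => /eqP; constructor 3.
have dec p m : (size p <= t.+1 - m)%N -> ~~ ((size p == (t.+1 - m)%N) && (p != 0)) ->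
    (size p <= t - m)%N.
  rewrite -size_poly_gt0; move: (size p) => s; lia.
have sf' := dec _ _ sf f1; have sg' := dec _ _ sg g1; have sh' := dec _ _ sh h1.
have [t0|t0] := posnP t.
  by move: nz; rewrite -!size_poly_gt0 => /orP[/leq_trans/(_ sf')|/leq_trans/(_ sh')]; lia.
have := tmin t.-1; rewrite leqNgt prednK // leqnn /= => tm.
exfalso; suff : false by []; apply: tm; exists f, g, h; split=> //.
by rewrite /syz E prednK // sf' sg' sh'.
Qed.

(** A common factor of [f] and [h] also divides [g], and removing it lowers the degree. *)
Lemma syz_min_coprime t A B C f g h : syz t A B C f g h -> (f != 0) || (h != 0) ->
  (forall t', has_syz t' A B C -> (t <= t')%N) -> coprimep f h.
Proof.
move=> s nz tmin; have /and4P[/eqP E sf sg sh] := s.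
have [//|ncop] := boolP (coprimep f h).
pose p := gcdp f h.
have p0 : p != 0 by rewrite gcdp_eq0 negb_and.
have [f1 Ef] : exists f1, f = f1 * p by apply/dvdpP; exact: dvdp_gcdl.
have [h1 Eh] : exists h1, h = h1 * p by apply/dvdpP; exact: dvdp_gcdr.
pose g1 := - (f1 * 'X^A + h1 * z ^+ C).
have Eg : g = g1 * p.
  apply: (addrI (f * 'X^A + h * z ^+ C)); rewrite addrAC E Ef Eh /g1; ring.
have sp : (1 < size p)%N.
  by rewrite ltn_neqAle size_poly_gt0 p0 andbT eq_sym.
have dec (q q1 : {poly F}) m : q = q1 * p -> (size q <= t.+1 - m)%N -> (size q1 <= t - m)%N.
  move=> ->; have [->|q0] := eqVneq q1 0; first by rewrite size_poly0.
  rewrite size_mul // => le; have := size_poly_gt0 q1; rewrite q0.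
  by move: (size p) (size q1) sp le => x y; lia.
have sf1 := dec _ _ _ Ef sf; have sg1 := dec _ _ _ Eg sg; have sh1 := dec _ _ _ Eh sh.
have nz1 : (f1 != 0) || (h1 != 0).
  by move: nz; rewrite Ef Eh !mulf_eq0 (negPf p0) !orbF.
have t0 : (0 < t)%N.
  by move: nz1; rewrite -!size_poly_gt0 => /orP[/leq_trans/(_ sf1)|/leq_trans/(_ sh1)]; lia.
have := tmin t.-1; rewrite leqNgt prednK // leqnn /= => tm.
exfalso; suff : false by []; apply: tm; exists f1, g1, h1; split=> //.
by rewrite /syz prednK // sf1 sg1 sh1 andbT /g1 addrAC subrr eqxx.
Qed.

(** Proportionality and a Bezout relation between [f0] and [h0] give the multiplier [r]; its degree
    is read off from an entry of the minimal syzygy that attains its full degree. *)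
Lemma syz_multiple m t A B C f0 g0 h0 f g h :
    syz m A B C f0 g0 h0 -> (f0 != 0) || (h0 != 0) ->
    (forall t', has_syz t' A B C -> (m <= t')%N) ->
    (t + m < A + B + C)%N -> syz t A B C f g h ->
  exists r : {poly F}, [/\ (size r <= t.+1 - m)%N, f = r * f0, g = r * g0 & h = r * h0].
Proof.
move=> s0 nz0 mmin lt s; have cop := syz_min_coprime s0 nz0 mmin.
have [_ Efh] := syz_cross s s0 lt.
have /and4P[/eqP E0 _ _ _] := s0; have /and4P[/eqP E sf sg sh] := s.
have /Bezout_eq1_coprimepP[[u v] /= uv] := cop.
pose r := u * f + v * h.
have Ef : f = r * f0.
  have -> : r * f0 = f * (u * f0 + v * h0) + v * (f0 * h - f * h0) by rewrite /r; ring.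
  by rewrite uv mulr1 -Efh subrr mulr0 addr0.
have Eh : h = r * h0.
  have -> : r * h0 = h * (u * f0 + v * h0) + u * (f * h0 - f0 * h) by rewrite /r; ring.
  by rewrite uv mulr1 Efh subrr mulr0 addr0.
have Eg : g = r * g0.
  apply: (addrI (f * 'X^A + h * z ^+ C)); rewrite addrAC E [in RHS]Ef [in RHS]Eh.
  by rewrite -[LHS](mulr0 r) -E0; ring.
exists r; split=> //; have [->|r0] := eqVneq r 0; first by rewrite size_poly0.
have top (p p0 : {poly F}) n : p = r * p0 -> (size p <= t.+1 - n)%N -> size p0 = (m.+1 - n)%N ->
    p0 != 0 -> (size r <= t.+1 - m)%N.
  move=> -> + sp0 nzp0; rewrite size_mul // sp0 => le.
  have := size_poly_gt0 p0; rewrite nzp0 sp0 => gt0; move: (size r) le => x; lia.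
case: (syz_min_top s0 nz0 mmin) => -[sp p0].
- exact: (top _ _ _ Ef sf sp).
- exact: (top _ _ _ Eg sg sp).
- exact: (top _ _ _ Eh sh sp).
Qed.

(** The kernel of the matrix is the image of the injective map that multiplies the minimal syzygy by
    polynomials of size at most [e.+1 - m]. *)
Lemma rank_ideal_mx m e A B C : has_syz m A B C ->
    (forall t', has_syz t' A B C -> (m <= t')%N) -> (e + m < A + B + C)%N ->
  (\rank (ideal_mx e A B C) + (e.+1 - m) = e.+1 - A + (e.+1 - B + (e.+1 - C)))%N.
Proof.
move=> [f0 [g0 [h0 [s0 nz0]]]] mmin lt; have /and4P[/eqP E0 sf sg sh] := s0.
pose N := row_mx (band_mul (e.+1 - m) (e.+1 - A) f0)
  (row_mx (band_mul (e.+1 - m) (e.+1 - B) g0) (band_mul (e.+1 - m) (e.+1 - C) h0)).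
have NE u : u *m N = row_mx (poly_rV (rVpoly u * f0))
    (row_mx (poly_rV (rVpoly u * g0)) (poly_rV (rVpoly u * h0))).
  by rewrite !mul_mx_row !mul_band.
have sz (u : 'rV_(e.+1 - m)) p n : (size p <= m.+1 - n)%N ->
    (size (rVpoly u * p)%R <= e.+1 - n)%N.
  by move=> sp; apply: size_mul_bound (size_rVpoly u) sp _; lia.
have Nfree : row_free N.
  apply: inj_row_free => u; rewrite NE => u0.
  have uf := congr1 lsubmx u0; rewrite row_mxKl linear0 in uf.
  have uh := congr1 (rsubmx \o rsubmx) u0; rewrite /= !row_mxKr !linear0 in uh.
  apply/eqP; rewrite -[u]rVpolyK; apply/eqP.
  have uf0 : rVpoly u * f0 = 0.
    by move/(congr1 rVpoly): uf; rewrite linear0 poly_rV_K // sz.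
  have uh0 : rVpoly u * h0 = 0.
    by move/(congr1 rVpoly): uh; rewrite linear0 poly_rV_K // sz.
  move/eqP: uf0; move/eqP: uh0; rewrite !mulf_eq0.
  move=> /orP[/eqP->|/eqP h00]; first by rewrite linear0.
  move=> /orP[/eqP->|/eqP f00]; first by rewrite linear0.
  by move: nz0; rewrite h00 f00 eqxx.
have kerN : (kermx (ideal_mx e A B C) :=: N)%MS.
  apply/eqmxP/andP; split; apply/rV_subP => u.
    rewrite -[u]hsubmxK -[rsubmx u]hsubmxK kermx_idealP => s.
    have [r [sr Ef Eg Eh]] := syz_multiple s0 nz0 mmin lt s.
    apply/submxP; exists (poly_rV r).
    by rewrite NE poly_rV_K // -Ef -Eg -Eh !rVpolyK.
  move=> /submxP[r ->]; rewrite NE kermx_idealP /syz !poly_rV_K ?sz // !andbT.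
  have -> : rVpoly r * f0 * 'X^A + rVpoly r * g0 + rVpoly r * h0 * z ^+ C
     = rVpoly r * (f0 * 'X^A + g0 + h0 * z ^+ C) by ring.
  by rewrite E0 mulr0.
have := mxrank_ker (ideal_mx e A B C); rewrite kerN (eqnP Nfree).
have := rank_leq_row (ideal_mx e A B C); lia.
Qed.

(** * The dimension of the cokernel as a sum over levels *)

Definition coker_dim e A B C : nat := e.+1 - \rank (ideal_mx e A B C).

Lemma coker_dim0P e A B C :
  (coker_dim e A B C = 0)%N <->
  forall p, (size p <= e.+1)%N -> exists f g h,
    [/\ p = f * 'X^A + g + h * z ^+ C, (size f <= e.+1 - A)%N,
             (size g <= e.+1 - B)%N & (size h <= e.+1 - C)%N].
Proof.
split=> [r0 p sp|all].
  apply/(ideal_mxP _ _ _ sp); apply: submx_full.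
  by rewrite /row_full eqn_leq rank_leq_col -subn_eq0; apply/eqP.
suff /mxrankS : ((1%:M : 'M[F]_e.+1) <= ideal_mx e A B C)%MS.
  by rewrite mxrank1 => full; apply/eqP; rewrite subn_eq0.
apply/rV_subP => u _.
rewrite -[u]rVpolyK; apply/ideal_mxP; first exact: size_rVpoly.
exact/all/size_rVpoly.
Qed.

Lemma has_syz_min A B C : exists2 m, has_syz m A B C &
  forall t, has_syz t A B C -> (m <= t)%N.
Proof.
have ex : exists m, boolp.asbool (has_syz m A B C).
  by exists (A + B + C)%N; apply/boolp.asboolP; apply: has_syz_exists; lia.
have [m /boolp.asboolP s mmin] := ex_minnP ex.
by exists m => // t st; apply: mmin; apply/boolp.asboolP.
Qed.

Lemma coker_dimE m d e A B C : has_syz m A B C ->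
    (forall t', has_syz t' A B C -> (m <= t')%N) -> (m <= d.+1)%N -> (d <= e)%N ->
    (A + B + C = d + e + 2)%N -> (A <= e.+1)%N -> (B <= e.+1)%N -> (C <= e.+1)%N ->
  (coker_dim e A B C = d.+1 - m)%N.
Proof.
move=> s mmin le de sum hA hB hC.
have lt : (e + m < A + B + C)%N by lia.
have := rank_ideal_mx s mmin lt; rewrite /coker_dim; lia.
Qed.

(** If the least degree m is [d.+1], the dimension formula gives 0; for [e = d] counting forces
    this. If m is larger, raising [A] or [B] by 1 shrinks the ideal, replaces [d] by [d.+1] and
    creates no syzygy of that degree, so by induction on e - d even the smaller ideal is everything
    in degree [e]. *)
Lemma coker_dim_eq0 d e A B C : (d <= e)%N ->
    (A + B + C = d + e + 2)%N -> (A <= e.+1)%N -> (B <= e.+1)%N -> (C <= e.+1)%N ->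
  ~ has_syz d A B C -> (coker_dim e A B C = 0)%N.
Proof.
move=> le; have [n En] : exists n, (e = d + n)%N by exists (e - d)%N; lia.
elim: n d A B C En le => [|n IH] d A B C En le sum hA hB hC no.
all: have [m s mmin] := has_syz_min A B C.
all: have lt : (d < m)%N by (rewrite ltnNge; apply/negP => md; apply: no; exact: has_syz_le s).
all: have [m1|m1] := leqP m d.+1; first by rewrite (coker_dimE s mmin m1 le sum) //; lia.
  have /mmin : has_syz d.+1 A B C by apply: has_syz_exists; lia.
  by lia.
have de : (d < e)%N by lia.
have [hA'|A'] := ltnP A e.+1.
  apply/coker_dim0P => p sp; have /coker_dim0P/(_ _ sp) : (coker_dim e A.+1 B C = 0)%N.
    apply: (IH d.+1) => //; try lia; move=> s'; have := mmin d.+1.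
    have := has_syz_moveA A s'; rewrite (_ : A - A.+1 = 0)%N ?addn0; last by lia.
    by move=> s1 /(_ s1); lia.
  move=> [f [g [h [Ep sf sg sh]]]]; exists (f * 'X), g, h; split=> //.
    by rewrite Ep exprS mulrA.
  by apply: (size_shift (n := 1) sf) => //; rewrite ?size_polyX //; lia.
have hB' : (B < e.+1)%N by lia.
apply/coker_dim0P => p sp; have /coker_dim0P/(_ _ sp) : (coker_dim e A B.+1 C = 0)%N.
  apply: (IH d.+1) => //; try lia; move=> s'; have := mmin d.+1.
  have := has_syz_moveB B s'; rewrite (_ : B - B.+1 = 0)%N ?addn0; last by lia.
  by move=> s1 /(_ s1); lia.
move=> [f [g [h [Ep sf sg sh]]]]; exists f, g, h; split=> //.
by apply: leq_trans sg _; lia.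
Qed.

(** If one exponent is at least e + 2, the other two add up to at most d, and such powers of two
    independent linear forms generate all forms of degree e. *)
Lemma coker_dim_gt d e A B C : (d <= e)%N -> (A + B + C = d + e + 2)%N ->
  (0 < coker_dim e A B C)%N -> [/\ (A <= e.+1)%N, (B <= e.+1)%N & (C <= e.+1)%N].
Proof.
move=> de sum gt0.
have szm (p q : {poly F}) n : size q = n.+1 -> (size (p %% q)%R <= n)%N.
  by move=> sq; rewrite -ltnS -sq ltn_modp -size_poly_gt0 sq.
have szd (p q : {poly F}) n m : size q = n.+1 -> (size p <= m)%N -> (size (p %/ q)%R <= m - n)%N.
  by move=> sq sp; rewrite size_divp -?size_poly_gt0 sq //= leq_sub2r.
have no : ~ (coker_dim e A B C = 0)%N by lia.
split; rewrite leqNgt; apply/negP => big; apply/no/coker_dim0P => p sp.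
- exists 0, (p %% z ^+ C), (p %/ z ^+ C); rewrite mul0r add0r addrC -divp_eq.
  split; rewrite ?size_poly0 //; last exact: szd (size_zX _) sp.
  by apply: leq_trans (szm _ _ _ (size_zX _)) _; lia.
- have /Bezout_eq1_coprimepP[[u v] /= uv] := coprimep_Xz A C.
  (* Reducing the Bezout cofactor of [z ^+ C] modulo ['X^A] keeps both cofactors within their degree
     bounds. *)
  pose h := (p * v) %% 'X^A.
  have sh : (size h <= A)%N by apply: szm; rewrite size_polyXn.
  have dvd : 'X^A %| (p - h * z ^+ C).
    have -> : p - h * z ^+ C = (p * u + (p * v) %/ 'X^A * z ^+ C) * 'X^A.
      rewrite mulrDl mulrAC; have Eh := divp_eq (p * v) 'X^A.
      have -> : p - h * z ^+ C = p * (u * 'X^A + v * z ^+ C) - h * z ^+ C by rewrite uv mulr1.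
      have {Eh} : p * v = (p * v) %/ 'X^A * 'X^A + h by [].
      move: ((p * v) %/ 'X^A) => w Ew.
      have -> : p * (u * 'X^A + v * z ^+ C) = p * u * 'X^A + p * v * z ^+ C by ring.
      rewrite Ew; ring.
    exact: dvdp_mull.
  exists ((p - h * z ^+ C) %/ 'X^A), 0, h; split.
  + by rewrite addr0 divpK // subrK.
  + apply: szd; rewrite ?size_polyXn // (leq_trans (size_polyD _ _)) // geq_max sp size_polyN.
    have [->|h0] := eqVneq h 0; first by rewrite mul0r size_poly0.
    by rewrite size_mulzX //; apply: leq_trans (leq_add sh (leqnn C)) _; lia.
  + by rewrite size_poly0.
  + by apply: leq_trans sh _; lia.
- exists (p %/ 'X^A), (p %% 'X^A), 0; rewrite mul0r addr0 -divp_eq.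
  split; rewrite ?size_poly0 //; first by apply: szd sp; rewrite size_polyXn.
  by apply: leq_trans (szm _ _ _ (size_polyXn _ _)) _; lia.
Qed.

Lemma coker_dim_ge d e A B C j : (d <= e)%N ->
    (A + B + C = d + e + 2)%N -> (A <= e.+1)%N -> (B <= e.+1)%N -> (C <= e.+1)%N -> (0 < j)%N ->
  (j <= coker_dim e A B C)%N <-> (j <= d.+1)%N /\ has_syz (d.+1 - j) A B C.
Proof.
move=> de sum hA hB hC j0; have [m s mmin] := has_syz_min A B C.
have [md|md] := leqP m d; last first.
  rewrite (coker_dim_eq0 de sum) //; last by move/mmin; lia.
  split=> [|[jd /mmin]]; lia.
rewrite (coker_dimE s mmin _ de sum) //; last by lia.
split=> [le|[jd /mmin]]; last by lia.
by split; [lia | apply: has_syz_le s => //; lia].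
Qed.

(** The two bounds on the gap show that the dimension is the largest of the levels; as at most one
    level is nonzero, the maximum is a sum. *)
Lemma coker_dim_levels k d e a b c : (d <= e)%N -> (a + b + c + 1 = d + e)%N ->
    (d < 2 ^ k.+1)%N ->
  (coker_dim e a.+1 b.+1 c.+1 = \sum_(1 <= i < k.+1) level_dim i a b c d)%N.
Proof.
move=> de sum dk; pose n := coker_dim e a.+1 b.+1 c.+1.
have sum' : (a.+1 + b.+1 + c.+1 = d + e + 2)%N by lia.
have up : (0 < n)%N -> exists2 i, (1 <= i < k.+1)%N & (n <= level_dim i a b c d)%N.
  move=> n0; have [hA hB hC] := coker_dim_gt de sum' n0.
  have /(coker_dim_ge de sum' hA hB hC n0)[nd s] := leqnn n.
  have gap : (2 * (d.+1 - n) < a.+1 + b.+1 + c.+1)%N by lia.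
  (* The triangle clauses would push an exponent above [e.+1]. *)
  case: (has_syz_cov s gap) => [[i [u [v [w [x le]]]]]|le|le|le]; try by exfalso; lia.
  have li : (n <= level_dim i a b c d)%N.
    by apply: (dist_level_dim sum de n0 x); lia.
  (* The height must be at least 2, so [i] is positive, and [2 ^ i <= d] bounds it above. *)
  exists i => //; apply/andP; split.
    by case: i {li} le => //; rewrite expn0; lia.
  have := leq_ltn_trans (level_dim_gt sum de (leq_trans n0 li)) dk.
  by rewrite ltn_exp2l.
have low i : (level_dim i a b c d <= n)%N.
  have [->//|j0] := posnP (level_dim i a b c d).
  have [hA hB hC] := level_dim_le sum de j0.
  have le := level_dim_dist sum j0 (leqnn _).
  apply/(coker_dim_ge de sum') => //; split.
    by rewrite /level_dim; case: ifP => // _; lia.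
  have jd : (level_dim i a b c d <= d.+1)%N by rewrite /level_dim; case: ifP => // _; lia.
  apply: (has_syz_peak (i := i) (u := a %/ 2 ^ i.+1) (v := b %/ 2 ^ i.+1) (w := c %/ 2 ^ i.+1)).
  lia.
have [n0|n0] := posnP n.
  rewrite -/n n0 big1 // => i _; have := low i; lia.
have [i ik ni] := up n0; rewrite (bigD1_seq i) ?mem_index_iota ?iota_uniq //=.
rewrite big1 ?addn0; first by apply/eqP; rewrite eqn_leq ni low.
move=> i' /eqP ii; apply/eqP; rewrite -leqn0 leqNgt; apply/negP => gt.
by apply: ii; apply: (level_dim_inj sum de gt); exact: leq_trans ni.
Qed.

End Syzygies.

(** * The line bundles O(m) *)

Section Numerators.
Variable F : fieldType.
Local Notation S := {mpoly F[3]}.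
Local Notation K := {fraction S}.
Local Notation "p %:F" := (@FracField.tofrac S p).
Implicit Types (I J : {set 'I_3}) (u v : 'X_{1..3}) (f g : K) (p q : S).

Lemma mcoeffMX_neq0 p u v : (p * 'X_[u])@_v != 0 -> (u <= v)%MM.
Proof.
rewrite -mcoeff_msupp (perm_mem (msuppMX _ _)) => /mapP[w _ ->].
exact: lem_addr.
Qed.

Lemma mcoeffXM p u v : (u <= v)%MM -> ('X_[u] * p)@_v = p@_(v - u).
Proof. by move=> le; rewrite mulrC -[v in LHS](submK le) addmC mcoeffMX. Qed.

Lemma mcoeffXM0 p u v : ~~ (u <= v)%MM -> ('X_[u] * p)@_v = 0.
Proof. by rewrite mulrC => n; apply/eqP; apply: contraNT n => /mcoeffMX_neq0. Qed.

Definition hpoly D (E : 'X_{1..3} -> F) : S :=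
  \sum_(u : 'X_{1..3 < D.+1}) (if mdeg u == D then E u else 0) *: 'X_[u].

Lemma mcoeff_hpoly D E u : (hpoly D E)@_u = if mdeg u == D then E u else 0.
Proof.
rewrite /hpoly; have [lt|lt] := ltnP (mdeg u) D.+1.
  exact: (mcoeff_mpoly (fun u => if mdeg u == D then E u else 0) lt).
rewrite gtn_eqF // raddf_sum big1 // => -[v /= vD] _.
rewrite mcoeffZ mcoeffX; case: (v =P u) => [e|_]; last by rewrite mulr0.
by move: lt; rewrite -e leqNgt vD.
Qed.

Lemma hpoly_homog D E : hpoly D E \is D.-homog.
Proof.
apply/dhomogP => u; rewrite mcoeff_msupp mcoeff_hpoly.
by case: ifP => [/eqP//|]; rewrite eqxx.
Qed.

Definition mset I : 'X_{1..3} := [multinom (i \in I : nat) | i < 3].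

Lemma msetE I (h : 'I_3) : mset I h = (h \in I).
Proof. exact: mnmE. Qed.

Lemma prodX_mset I : \prod_(i in I) 'X_i = 'X_[mset I] :> S.
Proof.
rewrite mpolyXE_id big_mkcond; apply: eq_bigr => i _; rewrite mnmE.
by case: (i \in I).
Qed.

Lemma mdeg_mset I : mdeg (mset I) = #|I|.
Proof.
rewrite mdegE -sum1_card [RHS]big_mkcond; apply: eq_bigr => i _.
by rewrite mnmE; case: (i \in I).
Qed.

Lemma tofracX_neq0 u : ('X_[u] : S)%:F != 0.
Proof.
rewrite tofrac_eq0; apply/eqP => /(congr1 (mcoeff u))/eqP.
by rewrite mcoeffX eqxx mcoeff0 oner_eq0.
Qed.
Hint Resolve tofracX_neq0 : core.

(* Sections of O(n - 3N) over U_I, as numerators over the common denominator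
   (x_1 x_2 x_3)^N. *)
Definition numer (n N : nat) I p : Prop :=
  p \is n.-homog /\ forall u, p@_u != 0 -> forall h, h \notin I -> (N <= u h)%N.

Local Notation xyz := (('X_[mset [set: 'I_3]] : S)%:F).

Lemma numer_le n N I J p : I \subset J -> numer n N I p -> numer n N J p.
Proof.
move=> IJ [hp sp]; split=> // u pu h hJ; apply: sp pu _ _.
by apply: contraNN hJ; exact: (subsetP IJ).
Qed.

Lemma numerD n N I p q : numer n N I p -> numer n N I q -> numer n N I (p + q).
Proof.
move=> [hp sp] [hq sq]; split; first exact: rpredD.
move=> u; rewrite mcoeffD => pq h hI.
have [p0|p0] := eqVneq p@_u 0; last exact: sp p0 h hI.
by move: pq; rewrite p0 add0r => q0; exact: sq q0 h hI.
Qed.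

Lemma numerI n N I J p : numer n N I p -> numer n N J p -> numer n N (I :&: J) p.
Proof.
move=> [hp sp] [_ sq]; split=> // u pu h; rewrite inE negb_and => /orP[].
  exact: sp.
exact: sq.
Qed.

(** All large [N] are allowed, so that several sections can be brought to the same denominator. *)
Lemma OP_numer m I f : OP m I f -> exists N0, forall N, (N0 <= N)%N ->
  exists n p, [/\ n%:Z = m + (N * 3)%N%:Z, numer n N I p & f = p%:F / xyz ^+ N].
Proof.
move=> [n0 [M [p [En hp ->]]]]; exists M => N MN.
pose k := (mset I *+ (N - M) + mset (~: I) *+ N)%MM.
have Ek : (mset I *+ M + k = mset [set: 'I_3] *+ N)%MM.
  apply/mnmP => i; rewrite !(mnmDE, mulmnE, mnmE) !inE; case: (i \in I) => /=; lia.
exists (n0 + mdeg k)%N, (p * 'X_[k]); split.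
- have := congr1 (fun u => mdeg u) Ek; rewrite mdegD !mdegMn !mdeg_mset cardsT card_ord => e.
  by lia.
- split; first by apply: dhomogM => //; rewrite dhomogX.
  move=> u /mcoeffMX_neq0/mnm_lepP le h hI; apply: leq_trans (le h).
  by rewrite !(mnmDE, mulmnE, mnmE) !inE hI; lia.
- rewrite prodX_mset -!tofracXn !mpolyXn -Ek mpolyXD !tofracM invfM.
  by rewrite mulrACA (divff (tofracX_neq0 k)) mulr1.
Qed.

(** The variables outside [I] cancel from the denominator. The side condition excludes empty [I]
    with [m < 0]: there [OP m I] has no element, not even 0, because degrees are natural numbers. *)
Lemma numer_OP m I N n p f : (I != set0) || (0 <= m) -> n%:Z = m + (N * 3)%N%:Z ->
  numer n N I p -> f = p%:F / xyz ^+ N -> OP m I f.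
Proof.
move=> Im En [hp sp] ->; pose k := (mset (~: I) *+ N)%MM.
have [->|p0] := eqVneq p 0.
  have I0 : (0 < #|I|)%N \/ 0 <= m.
    by case/orP: Im; [rewrite -card_gt0; left | right].
  exists (absz (m + (absz m * #|I|)%N%:Z)), (absz m), 0; split.
  - by case: I0 => I0; rewrite gez0_abs //; nia.
  - exact: dhomog0.
  - by rewrite tofrac0 !mul0r.
have Ek : (mset I *+ N + k = mset [set: 'I_3] *+ N)%MM.
  apply/mnmP => i; rewrite !(mnmDE, mulmnE, mnmE) !inE; case: (i \in I) => /=; lia.
have dk : (mdeg k + N * #|I| = N * 3)%N.
  by have := congr1 (fun u => mdeg u) Ek; rewrite mdegD !mdegMn !mdeg_mset cardsT card_ord; lia.
have le u : p@_u != 0 -> (k <= u)%MM.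
  move=> pu; apply/mnm_lepP => h; rewrite !(mulmnE, mnmE) inE.
  by case: (boolP (h \in I)) => // hI; rewrite mul1n; exact: sp pu h hI.
have kn : (mdeg k <= n)%N.
  have : mlead p \in msupp p by rewrite mlead_supp.
  move=> ml; rewrite -(dhomog_mf hp ml) /= !mdegE; apply: leq_sum => i _.
  by apply/mnm_lepP/le; rewrite -mcoeff_msupp.
pose p0' := hpoly (n - mdeg k) (fun u => p@_(k + u)).
have Ep : p = 'X_[k] * p0'.
  apply/mpolyP => u; have [ku|ku] := boolP (k <= u)%MM; last first.
    by rewrite mcoeffXM0 //; apply/eqP; apply: contraNT ku; exact: le.
  rewrite mcoeffXM // mcoeff_hpoly addmC submK //; case: ifPn => // nd.
  apply: (dhomog_nemf_coeff hp); apply: contraNN nd => /eqP /= <-.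
  by have := mdegD (u - k)%MM k; rewrite submK // => ->; rewrite addnK.
exists (n - mdeg k)%N, N, p0'; split; first by lia.
  exact: hpoly_homog.
rewrite prodX_mset -!tofracXn !mpolyXn -Ek mpolyXD Ep !tofracM.
by rewrite [('X_[k] : S)%:F * _]mulrC -mulf_div (divff (tofracX_neq0 k)) mulr1.
Qed.

End Numerators.

Section LineBundles.
Variable F : fieldType.
Local Notation S := {mpoly F[3]}.
Local Notation K := {fraction S}.
Local Notation "p %:F" := (@FracField.tofrac S p).
Implicit Types (I J : {set 'I_3}) (u v : 'X_{1..3}) (f g : K) (p q : S).

Local Notation xyz := (('X_[mset [set: 'I_3]] : S)%:F).

Lemma OP_homog m I n p : n%:Z = m -> p \is n.-homog -> OP m I p%:F.
Proof.
move=> En hp; exists n, 0%N, p.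
by rewrite expr0 divr1; split=> //; rewrite mul0n addr0.
Qed.

Lemma OP0 m I : (I != set0) || (0 <= m) -> OP m I (0 : K).
Proof.
move=> Im; apply: (@numer_OP F m I (absz m) (absz (m + (absz m * 3)%N%:Z)) 0 0) => //.
- by lia.
- by split=> [|u]; [exact: dhomog0 | rewrite mcoeff0 eqxx].
- by rewrite tofrac0 mul0r.
Qed.

Lemma OPD m I f g : (I != set0) || (0 <= m) -> OP m I f -> OP m I g -> OP m I (f + g).
Proof.
move=> Im /OP_numer[N1 H1] /OP_numer[N2 H2].
have [n [p [En Np ->]]] := H1 _ (leq_maxl N1 N2).
have [n' [q [En' Nq ->]]] := H2 _ (leq_maxr N1 N2).
have nn : n' = n by lia.
rewrite nn in Nq.
by apply: (numer_OP Im En (numerD Np Nq)); rewrite tofracD mulrDl.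
Qed.

Lemma OP_sum m I (T : Type) (r : seq T) (P : pred T) (G : T -> K) :
  (I != set0) || (0 <= m) -> (forall i, P i -> OP m I (G i)) ->
  OP m I (\sum_(i <- r | P i) G i).
Proof. by move=> Im HG; elim/big_rec: _ => [|i x /HG Gi IH]; [exact: OP0|exact: OPD]. Qed.

Lemma OPM a b I f g : OP a I f -> OP b I g -> OP (a + b) I (f * g).
Proof.
move=> [n [N [p [En hp ->]]]] [n' [N' [q [En' hq ->]]]].
exists (n + n')%N, (N + N')%N, (p * q); split; first by lia.
  exact: dhomogM.
by rewrite tofracM exprD invfM mulrACA.
Qed.

Lemma OPC I (c : F) : OP 0 I (c%:MP)%:F.
Proof.
apply: OP_homog => //; rewrite -[c%:MP]mulr1 mul_mpolyC.
by apply: dhomogZ; exact: dhomog1.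
Qed.

Lemma OPZ m I f (c : F) : OP m I f -> OP m I ((c%:MP)%:F * f).
Proof. by move=> Of; rewrite -[m]add0r; apply: OPM Of; exact: OPC. Qed.

Lemma OPN m I f : OP m I f -> OP m I (- f).
Proof. by move=> /(OPZ (-1)); rewrite mpolyCN tofracN mpolyC1 tofrac1 mulN1r. Qed.

Lemma OPB m I f g : (I != set0) || (0 <= m) -> OP m I f -> OP m I g -> OP m I (f - g).
Proof. by move=> Im Of Og; apply: OPD => //; exact: OPN. Qed.

Lemma OP_subset m I J f : (J != set0) || (0 <= m) -> I \subset J -> OP m I f -> OP m J f.
Proof.
move=> Jm IJ /OP_numer[N H]; have [n [p [En Np Ef]]] := H _ (leqnn N).
exact: numer_OP Jm En (numer_le IJ Np) Ef.
Qed.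

Lemma OPX I (h : 'I_3) : OP 1 I ('X_h)%:F.
Proof. by apply: (@OP_homog 1 I 1%N) => //; rewrite dhomogX /= mdeg1. Qed.

Lemma OP_monomial m I u v : (I != set0) || (0 <= m) -> (mdeg u)%:Z = m + (mdeg v)%:Z ->
  (forall h, h \notin I -> (v h <= u h)%N) ->
  OP m I (('X_[u] : S)%:F / ('X_[v] : S)%:F).
Proof.
move=> Im Em le; pose N := mdeg v.
have lN : (v <= mset [set: 'I_3] *+ N)%MM.
  apply/mnm_lepP => h; rewrite mulmnE msetE in_setT mul1n /N mdegE (bigD1 h) //=.
  exact: leq_addr.
pose w := (u + (mset [set: 'I_3] *+ N - v))%MM.
have Ew : (w + v = u + mset [set: 'I_3] *+ N)%MM by rewrite /w -addmA submK.
apply: (@numer_OP F m I N (mdeg w) 'X_[w]) => //.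
- have := congr1 (fun t => mdeg t) Ew.
  by rewrite !mdegD mdegMn mdeg_mset cardsT card_ord; lia.
- split; first by rewrite dhomogX.
  move=> t; rewrite mcoeffX; case: (w =P t) => [<- _|]; last by rewrite eqxx.
  move=> h hI; have := congr1 (fun t : 'X_{1..3} => t h) Ew.
  rewrite /= [in LHS]mnmDE [in RHS]mnmDE mulmnE msetE in_setT; have := le h hI; lia.
- apply/eqP; rewrite eqr_div ?expf_neq0 ?tofracX_neq0 //.
  by rewrite -tofracXn mpolyXn -!tofracM -!mpolyXD Ew.
Qed.

Lemma OP_Xinv I (h : 'I_3) k : h \in I -> OP (- k%:Z) I (('X_h ^+ k)%:F)^-1.
Proof.
move=> hI; have -> : (('X_h ^+ k : S)%:F)^-1 = ('X_[0] : S)%:F / ('X_[U_(h) *+ k] : S)%:F.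
  by rewrite mpolyX0 tofrac1 mul1r mpolyXn.
apply: OP_monomial.
- by apply/orP; left; apply/set0Pn; exists h.
- by rewrite mdeg0 mdegMn mdeg1; lia.
- move=> h' h'I; rewrite mulmnE mnm1E; case: eqP => // e.
  by move: h'I; rewrite -e hI.
Qed.

Lemma OP_set0 m f : OP m set0 f -> exists n p, [/\ n%:Z = m, p \is n.-homog & f = p%:F].
Proof.
move=> [n [N [p [En hp ->]]]]; exists n, p; split=> //.
  by rewrite En cards0 muln0 addr0.
by rewrite big_set0 tofrac1 expr1n divr1.
Qed.

(** Over the common denominator the numerator is unique. The poles of a section over U_i lie along
    x_i only and those of a section over U_j along x_j only, so here there are none. *)
Lemma OP_glue m (i j : 'I_3) f : i != j -> 0 <= m ->
  OP m [set i] f -> OP m [set j] f -> OP m set0 f.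
Proof.
move=> ij m0 /OP_numer[N1 H1] /OP_numer[N2 H2].
have [n [p [En Np Ef]]] := H1 _ (leq_maxl N1 N2).
have [n' [q [En' Nq Ef']]] := H2 _ (leq_maxr N1 N2).
have nn : n' = n by lia.
have pq : q = p.
  apply/eqP; rewrite -tofrac_eq; apply/eqP.
  have X0 : xyz ^+ maxn N1 N2 != 0 by rewrite expf_neq0 ?tofracX_neq0.
  by apply: (mulIf (invr_neq0 X0)); rewrite -Ef -Ef'.
rewrite nn pq in Nq; have := numerI Np Nq.
have -> : [set i] :&: [set j] = set0.
  by apply/setP => h; rewrite !inE; case: eqP => // ->; rewrite (negPf ij).
by move=> N0; apply: (numer_OP _ En N0 Ef); rewrite m0 orbT.
Qed.

(* H^1(O(m)) = 0: at a Laurent monomial u the cocycle is split by the chart p(u),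
   the first coordinate in which u has no pole. *)
Lemma OP_cocycle m (z : 'I_3 -> 'I_3 -> K) : 0 <= m ->
    (forall i j, OP m [set i; j] (z i j)) ->
    (forall i j h, z j h - z i h + z i j = 0) ->
  exists y : 'I_3 -> K, (forall i, OP m [set i] (y i)) /\ (forall i j, z i j = y j - y i).
Proof.
move=> m0 Oz cz.
have Im I : (I != set0) || (0 <= m) by rewrite m0 orbT.
have [N HN] : exists N, forall i j, exists n p,
    [/\ n%:Z = m + (N * 3)%N%:Z, numer n N [set i; j] p & z i j = p%:F / xyz ^+ N].
  have ex (i j : 'I_3) := OP_numer (Oz i j).
  have [N1 HN1] := boolp.choice (fun ij : 'I_3 * 'I_3 => ex ij.1 ij.2).
  exists (\max_ij N1 ij) => i j; apply: (HN1 (i, j)); exact: leq_bigmax.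
have [n En] : exists n, n%:Z = m + (N * 3)%N%:Z.
  by have [n [_ [En _ _]]] := HN ord0 ord0; exists n.
have {}HN i j : exists p, numer n N [set i; j] p /\ z i j = p%:F / xyz ^+ N.
  by have [n' [p [En' Np Ez]]] := HN i j; exists p; rewrite (_ : n = n'); last by lia.
have [p Hp] := boolp.choice (fun ij : 'I_3 * 'I_3 => HN ij.1 ij.2).
have X0 : xyz ^+ N != 0 by rewrite expf_neq0 ?tofracX_neq0.
have cp i j h : p (j, h) - p (i, h) + p (i, j) = 0.
  apply/eqP; rewrite -tofrac_eq0; apply/eqP; apply: (mulIf (invr_neq0 X0)).
  rewrite mul0r -(cz i j h) tofracD tofracB mulrDl mulrBl.
  by rewrite -(Hp (j, h)).2 -(Hp (i, h)).2 -(Hp (i, j)).2.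
(* A monomial of degree m + 3N has an exponent at least N, since m >= 0; the default value is not
   reached for it. *)
pose pk (u : 'X_{1..3}) := odflt (ord0 : 'I_3) [pick h | (N <= u h)%N].
have pkP u : mdeg u = n -> (N <= u (pk u))%N.
  move=> un; rewrite /pk; case: pickP => //= none.
  have sum : (mdeg u = u ord0 + u (lift ord0 ord0) + u (lift ord0 (lift ord0 ord0)))%N.
    by rewrite mdegE !big_ord_recl big_ord0 addn0 addnA.
  have := none ord0; have := none (lift ord0 ord0); have := none (lift ord0 (lift ord0 ord0)).
  by lia.
(* At each monomial the splitting compares the chart [j] with the chart [pk u]; the cocycle identity
   makes the difference of two such terms equal to [z i j]. *)
pose y j : K := (hpoly n (fun u => (p (pk u, j))@_u))%:F / xyz ^+ N.
exists y; split=> [i|i j].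
  apply: (numer_OP _ En _ erefl); first exact: Im.
  split; first exact: hpoly_homog.
  move=> u; rewrite mcoeff_hpoly; case: ifP => [/eqP un|]; last by rewrite eqxx.
  move=> pu h; rewrite inE => hi; have [->|hp] := eqVneq h (pk u); first exact: pkP.
  by have [_ sp] := (Hp (pk u, i)).1; apply: sp pu _ _; rewrite !inE negb_or hp.
rewrite (Hp (i, j)).2 /y -mulrBl -tofracB; congr (_%:F / _).
apply/mpolyP => u; rewrite mcoeffB !mcoeff_hpoly; case: ifPn => un; last first.
  have [[hp _] _] := Hp (i, j).
  by rewrite subrr; exact: dhomog_nemf_coeff hp un.
have := congr1 (mcoeff u) (cp (pk u) i j); rewrite mcoeffD mcoeffB mcoeff0 => e.
by apply/eqP; rewrite -subr_eq0 -e; apply/eqP; ring.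
Qed.

End LineBundles.

(** * Symmetric multilinear forms *)

Section SymmetricForms.
Variable F : fieldType.
Local Notation S := {mpoly F[3]}.
Local Notation K := {fraction S}.
Local Notation "p %:F" := (@FracField.tofrac S p).
Implicit Types (I J : {set 'I_3}).

Local Notation symmetric_form := Defs.symmetric_form.
Local Notation form := Defs.form.
Local Notation RK := (subvs_of (@Rgen F)).
Local Notation RKdual := 'Hom(RK, K^o).
Local Notation x h := (('X_h : S)%:F).

Lemma x_neq0 (h : 'I_3) : x h != 0.
Proof. exact: tofracX_neq0. Qed.

Definition Rcoord (h : 'I_3) (r : RK) : K^o := vsval r 0 h.

Lemma Rcoord_is_linear h : linear (Rcoord h).
Proof. by move=> c r s; rewrite /Rcoord linearP !mxE. Qed.
HB.instance Definition _ h :=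
  GRing.isLinear.Build K RK K^o *:%R (Rcoord h) (Rcoord_is_linear h).

Definition xi (h : 'I_3) : RKdual := linfun (Rcoord h).

Lemma xiE h (r : RK) : xi h r = vsval r 0 h.
Proof. by rewrite lfunE. Qed.

(* On U_p the sheaf R is free on the rel p h, h != p; rel p p = 0. *)
Definition rel_row (p h : 'I_3) : 'rV[K]_3 := delta_mx 0 h - (x h / x p) *: delta_mx 0 p.
Definition rel (p h : 'I_3) : RK := vsproj (@Rgen F) (rel_row p h).

Lemma taut_delta (h : 'I_3) : taut (delta_mx 0 h : 'rV[K]_3) = x h.
Proof.
rewrite /taut (bigD1 h) //= mxE !eqxx mulr1 big1 ?addr0 // => i ih.
by rewrite mxE (negPf ih) andbF mulr0.
Qed.

Lemma val_rel (p h : 'I_3) : vsval (rel p h) = rel_row p h.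
Proof.
rewrite vsprojK // memRgen /rel_row linearB linearZ /= !taut_delta.
by rewrite /GRing.scale /= divfK ?x_neq0 // subrr.
Qed.

Lemma rel_expand (p : 'I_3) (r : RK) : r = \sum_h vsval r 0 h *: rel p h.
Proof.
apply: val_inj; rewrite /= linear_sum /=.
have -> : \sum_h vsval (vsval r 0 h *: rel p h) =
    \sum_h (vsval r 0 h *: delta_mx 0 h - (vsval r 0 h * (x h / x p)) *: delta_mx 0 p).
  by apply: eq_bigr => h _; rewrite linearZ /= val_rel /rel_row scalerBr scalerA.
rewrite sumrB -scaler_suml.
have -> : \sum_h vsval r 0 h * (x h / x p) = taut (vsval r) / x p.
  by rewrite /taut mulr_suml; apply: eq_bigr => h _; rewrite mulrCA mulrA.
have := subvsP r; rewrite memRgen => /eqP ->; rewrite mul0r scale0r subr0.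
by rewrite {1}[vsval r]row_sum_delta.
Qed.

Lemma xi_expand (p : 'I_3) (lam : RKdual) : lam = \sum_h lam (rel p h) *: xi h.
Proof.
apply/lfunP => r; rewrite sum_lfunE {1}(rel_expand p r) linear_sum /=.
apply: eq_bigr => h _; rewrite linearZ scale_lfunE /= xiE.
by rewrite /GRing.scale /= mulrC.
Qed.

(** Dual of the tautological sequence: the relation by which R^dual is a quotient of V^dual (x)
    O. *)
Lemma xi_rel : \sum_h x h *: xi h = 0.
Proof.
apply/lfunP => r; rewrite sum_lfunE lfunE /=.
have := subvsP r; rewrite memRgen => /eqP t0; rewrite -[RHS]t0 /taut.
by apply: eq_bigr => h _; rewrite scale_lfunE xiE.
Qed.

Lemma xi_relE (p h k : 'I_3) : xi k (rel p h) = (k == h)%:R - (x h / x p) * (k == p)%:R.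
Proof. by rewrite xiE val_rel !mxE !eqxx. Qed.

Lemma Rdual_xi I h : Rdual I (xi h).
Proof. by move=> r Rr; rewrite xiE; exact: Rr. Qed.

Lemma OP_bool m I (b : bool) (f : K) : (I != set0) || (0 <= m) -> OP m I f -> OP m I (f * b%:R).
Proof. by case: b => Im Of; rewrite ?mulr1 // mulr0; exact: OP0. Qed.

(** By [xi_expand] these values are coefficients of [lam] with respect to the [xi h], which
    therefore generate R^dual over U_I. *)
Lemma Rdual_rel I (p h : 'I_3) (lam : RKdual) : p \in I -> Rdual I lam -> OP 0 I (lam (rel p h)).
Proof.
move=> pI; apply => i; have I0 : (I != set0) || (0 <= 0 :> int) by rewrite orbT.
rewrite val_rel !mxE !eqxx /=; apply: OPB => //.
  by rewrite -[_%:R]mul1r; apply: OP_bool => //; rewrite -tofrac1 -mpolyC1; exact: OPC.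
apply: OP_bool => //; rewrite -(addrN (1 : int)); apply: OPM; first exact: OPX.
by have := OP_Xinv F 1 pI; rewrite expr1.
Qed.

Lemma updE d (l : {ffun 'I_d -> RKdual}) i y j :
  upd l i y j = if j == i then y else l j.
Proof. by rewrite ffunE. Qed.

Lemma upd_id d (l : {ffun 'I_d -> RKdual}) i : upd l i (l i) = l.
Proof. by apply/ffunP => j; rewrite updE; case: eqP => [->|]. Qed.

Lemma multilin0 d (phi : form F d) l i : multilin phi -> phi (upd l i 0) = 0.
Proof.
move=> ml; have := ml l i 1 0 0; rewrite scaler0 addr0 mul1r => /eqP.
by rewrite -subr_eq0 opprD addrA subrr sub0r oppr_eq0 => /eqP.
Qed.

Lemma multilin_sum d (phi : form F d) l i (c : 'I_3 -> K) (y : 'I_3 -> RKdual) :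
  multilin phi -> phi (upd l i (\sum_h c h *: y h)) = \sum_h c h * phi (upd l i (y h)).
Proof.
move=> ml; elim: (index_enum _) => [|h r IH]; first by rewrite !big_nil multilin0.
by rewrite !big_cons ml IH.
Qed.

Definition xis d (w : {ffun 'I_d -> 'I_3}) : {ffun 'I_d -> RKdual} := [ffun j => xi (w j)].

(** Expansion of all arguments in the [xi h]. Here [C] stands for the ring of the coefficients and
    [Q] for the module of the values, so that both identities and regularity statements can be
    derived. *)
Lemma multilin_ind d (phi : form F d) (C Q : K -> Prop) : multilin phi ->
    Q 0 -> (forall a b, Q a -> Q b -> Q (a + b)) -> (forall c a, C c -> Q a -> Q (c * a)) ->
    (forall w, Q (phi (xis w))) ->
  forall (l : {ffun 'I_d -> RKdual}) (c : 'I_d -> 'I_3 -> K),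
    (forall j, l j = \sum_h c j h *: xi h) -> (forall j h, C (c j h)) -> Q (phi l).
Proof.
move=> ml Q0 QD QM Qxi l c lE Cc.
(* The arguments below [k] are still to be expanded, the others are already of the form [xi h]. *)
suff H k (l' : {ffun 'I_d -> RKdual}) :
    (forall j : 'I_d, (j < k)%N -> l' j = \sum_h c j h *: xi h) ->
    (forall j : 'I_d, (k <= j)%N -> exists h, l' j = xi h) -> Q (phi l').
  by apply: (H d) => j; [rewrite lE | rewrite leqNgt ltn_ord].
elim: k l' => [|k IH] l' lo hi.
  have -> : l' = xis [ffun j => odflt ord0 [pick h | l' j == xi h]].
    apply/ffunP => j; rewrite !ffunE; case: pickP => [h /eqP //|no].
    by have [h /eqP] := hi j (leq0n _); rewrite no.
  exact: Qxi.
have [kd|kd] := ltnP k d; last first.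
  apply: IH => j jk; first by apply: lo; exact: leqW.
  by have := ltn_ord j; lia.
pose i := Ordinal kd; rewrite -(upd_id l' i) lo // multilin_sum //.
elim/big_ind: _ => // h _; apply: QM => //; apply: IH => j jk.
  rewrite updE; case: eqP => [ji|_]; last by apply: lo; exact: leqW.
  by move: jk; rewrite ji ltnn.
rewrite updE; case: eqP => [_|ji]; first by exists h.
apply: hi; rewrite ltn_neqAle jk andbT; apply/eqP => kj; apply: ji; exact: val_inj.
Qed.

Lemma multilin_ext d (phi psi : form F d) : multilin phi -> multilin psi ->
  (forall w, phi (xis w) = psi (xis w)) -> forall l, phi l = psi l.
Proof.
move=> ml1 ml2 E l; apply/eqP; rewrite -subr_eq0; apply/eqP.
pose chi : form F d := fun l => phi l - psi l.
have ml : multilin chi.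
  by move=> l' i c u v; rewrite /chi ml1 ml2 mulrBr opprD addrACA.
apply: (multilin_ind (C := fun _ => True) (Q := fun a => a = 0) (phi := chi) ml
  _ _ _ _ (fun j => xi_expand ord0 (l j))) => //.
- by move=> a b -> ->; rewrite addr0.
- by move=> c a _ ->; rewrite mulr0.
- by move=> w; rewrite /chi E subrr.
Qed.

Definition cnt d (w : {ffun 'I_d -> 'I_3}) : 'X_{1..3} :=
  [multinom count_mem h (codom w) | h < 3].

Lemma cntE d (w : {ffun 'I_d -> 'I_3}) h : cnt w h = count_mem h (codom w).
Proof. exact: mnmE. Qed.

Lemma mdeg_cnt d (w : {ffun 'I_d -> 'I_3}) : mdeg (cnt w) = d.
Proof.
have sumE (s : seq 'I_3) : (\sum_i count_mem i s = size s)%N.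
  elim: s => [|y s IH] /=; first by rewrite big1.
  by rewrite big_split /= IH (bigD1 y) //= eqxx big1 ?add1n // => i /negPf; rewrite eq_sym => ->.
have sz := size_codom w; rewrite card_ord in sz; rewrite -[RHS]sz -sumE mdegE.
by apply: eq_bigr => i _; rewrite cntE.
Qed.

Definition letters (b : 'X_{1..3}) : seq 'I_3 :=
  flatten [seq nseq (b h) h | h <- enum 'I_3].

Definition word d (b : 'X_{1..3}) : {ffun 'I_d -> 'I_3} :=
  [ffun j : 'I_d => nth ord0 (letters b) j].

Lemma count_letters b h : count_mem h (letters b) = b h.
Proof.
rewrite /letters count_flatten -map_comp sumnE big_map big_enum /=.
rewrite (bigD1 h) //= count_nseq /= eqxx mul1n big1 ?addn0 // => i /negPf ih.
by rewrite count_nseq /= ih mul0n.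
Qed.

Lemma cnt_word d b : mdeg b = d -> cnt (word d b) = b.
Proof.
move=> bd; apply/mnmP => h; rewrite cntE -[RHS]count_letters; congr (count_mem h _).
have sz : size (letters b) = d.
  rewrite -bd mdegE /letters size_flatten /shape -map_comp sumnE big_map big_enum.
  by apply: eq_bigr => i _ /=; rewrite size_nseq.
apply: (@eq_from_nth _ ord0); rewrite size_codom card_ord // => i lt.
rewrite (nth_map (Ordinal lt)) ?size_enum_ord // ffunE.
by rewrite nth_enum_ord.
Qed.

Lemma cnt_perm d (w w' : {ffun 'I_d -> 'I_3}) : cnt w = cnt w' ->
  exists s : 'S_d, w = [ffun j => w' (s j)].
Proof.
move=> e; have /tuple_permP[s es] : perm_eq [tuple w j | j < d] [tuple w' j | j < d].
  apply/allP => h _ /=; have := congr1 (fun u : 'X_{1..3} => u h) e.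
  by rewrite !cntE => e'; apply/eqP; exact: e'.
exists s; apply/ffunP => j; rewrite ffunE.
by have := congr1 (fun t => tnth t j) (val_inj es); rewrite !tnth_mktuple.
Qed.

Lemma cnt_comp d (w : {ffun 'I_d -> 'I_3}) (s : 'S_d) : cnt [ffun j => w (s j)] = cnt w.
Proof.
apply/mnmP => h; rewrite !cntE; apply/seq.permP.
have -> : codom [ffun j => w (s j)] = map w (map s (enum 'I_d)).
  by rewrite -map_comp; apply: eq_map => j /=; rewrite ffunE.
apply: perm_map; apply: uniq_perm.
- by rewrite (map_inj_uniq (@perm_inj _ s)) enum_uniq.
- exact: enum_uniq.
move=> j; rewrite mem_enum; apply/mapP; exists ((s^-1)%g j); rewrite ?mem_enum //.
by rewrite permKV.
Qed.

(* The image of phi in D^d V (x) O. *)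
Definition hat d (phi : form F d) (b : 'X_{1..3}) : K := phi (xis (word d b)).

Lemma hatE d (phi : form F d) w : symmetric_form phi -> phi (xis w) = hat phi (cnt w).
Proof.
move=> sym; rewrite /hat.
have [s ->] := cnt_perm (cnt_word (mdeg_cnt w)).
rewrite -(sym (xis w) s); congr phi; apply/ffunP => j.
by rewrite !ffunE.
Qed.

(* The equations defining D^d R inside D^d V (x) O. *)
Definition rel_on d (H : 'X_{1..3} -> K) : Prop :=
  forall c, (mdeg c).+1 = d -> \sum_h x h * H (c + U_(h))%MM = 0.

Lemma hat_rel d (phi : form F d) : multilin phi -> symmetric_form phi -> rel_on d (hat phi).
Proof.
case: d phi => [|d] phi ml sym c // [cd].
pose w h : {ffun 'I_d.+1 -> 'I_3} :=
  [ffun j => if unlift ord0 j is Some j' then word d c j' else h].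
have cw h : cnt (w h) = (c + U_(h))%MM.
  apply/mnmP => h'; rewrite mnmDE mnm1E cntE /codom /image_mem enum_ordSl /=.
  rewrite ffunE unlift_none addnC; congr (_ + _)%N.
  rewrite -[in RHS](cnt_word cd) cntE -map_comp; congr (count_mem h' _).
  by apply: eq_map => j /=; rewrite ffunE liftK.
have E h : hat phi (c + U_(h))%MM = phi (upd (xis (w ord0)) ord0 (xi h)).
  rewrite -cw -hatE //; congr phi; apply/ffunP => j; rewrite updE !ffunE.
  by case: unliftP => [j' ->|->] //=; rewrite eqxx.
under eq_bigr do rewrite E.
by rewrite -multilin_sum // xi_rel multilin0.
Qed.

(** As x_0 is invertible in [K], the relation at c determines the value at [c + U_(ord0)] from
    values with a smaller exponent at [ord0]. *)
Lemma rel_on_ext d H H' : rel_on d H -> rel_on d H' ->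
    (forall b, mdeg b = d -> b ord0 = 0%N -> H b = H' b) ->
  forall b, mdeg b = d -> H b = H' b.
Proof.
move=> rH rH' E0 b; move En: (b ord0) => n; elim: n b En => [|n IH] b b0 bd; first exact: E0.
have Eb : b = (b - U_(ord0) + U_(ord0))%MM.
  apply/mnmP => h; rewrite mnmDE mnmBE mnm1E; case: eqP => [<-|_]; last by rewrite subn0 addn0.
  by rewrite b0 subn1 addn1.
have dc : (mdeg (b - U_(ord0))%MM).+1 = d by rewrite -bd [in RHS]Eb mdegD mdeg1 addn1.
have := etrans (rH _ dc) (esym (rH' _ dc)); rewrite !big_ord_recl !big_ord0 -Eb.
have step (h : 'I_3) : h != ord0 -> H (b - U_(ord0) + U_(h))%MM = H' (b - U_(ord0) + U_(h))%MM.
  move=> h0; apply: IH; last by rewrite mdegD mdeg1 addn1.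
  by rewrite mnmDE mnmBE !mnm1E (negPf h0) eqxx b0 subn1 addn0.
by rewrite !step // => e; apply: (mulfI (x_neq0 ord0)); exact: addIr e.
Qed.

(** The inverse of [hat]: by [xi_expand], [l j (rel ord0 h)] is a coefficient of [l j] along [xi h],
    and this is the multilinear expansion of a form whose value on a word depends only on the
    content. *)
Definition mkform d (H : 'X_{1..3} -> K) : form F d :=
  fun l => \sum_(w : {ffun 'I_d -> 'I_3}) (\prod_j l j (rel ord0 (w j))) * H (cnt w).

Lemma mkform_multilin d H : multilin (@mkform d H).
Proof.
move=> l i c y y'; rewrite /mkform mulr_sumr -big_split; apply: eq_bigr => w _ /=.
have E t : \prod_j upd l i t j (rel ord0 (w j)) =
    t (rel ord0 (w i)) * \prod_(j | j != i) l j (rel ord0 (w j)).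
  rewrite (bigD1 i) //= updE eqxx; congr (_ * _); apply: eq_bigr => j ji.
  by rewrite updE (negPf ji).
by rewrite !E add_lfunE scale_lfunE /GRing.scale /= !mulrDl !mulrA.
Qed.

Lemma mkform_symmetric d H : symmetric_form (@mkform d H).
Proof.
move=> l s; rewrite /mkform.
have inj : injective (fun w : {ffun 'I_d -> 'I_3} => [ffun j => w (s j)]).
  move=> w w' /ffunP e; apply/ffunP => j; have := e ((s^-1)%g j).
  by rewrite !ffunE permKV.
rewrite (reindex_inj inj); apply: eq_bigr => w _; rewrite cnt_comp; congr (_ * _).
rewrite [RHS](reindex_inj (@perm_inj _ s)); apply: eq_bigr => j _ /=.
by rewrite !ffunE.
Qed.

(** It suffices to compare words without the letter [ord0]; on those, [xi] and [rel ord0] are dual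
    to each other and a single summand survives. *)
Lemma hat_mkform d H : rel_on d H -> forall b, mdeg b = d -> hat (@mkform d H) b = H b.
Proof.
move=> rH; apply: rel_on_ext => //.
  by apply: hat_rel; [exact: mkform_multilin | exact: mkform_symmetric].
move=> b bd b0; rewrite /hat /mkform; set w0 := word d b.
have nz j : w0 j != ord0.
  have : ord0 \notin codom w0.
    by rewrite -has_pred1 has_count -cntE cnt_word // b0.
  by apply: contraNN => /eqP <-; exact: codom_f.
have E (w : {ffun 'I_d -> 'I_3}) : \prod_j xis w0 j (rel ord0 (w j)) = (w0 == w)%:R.
  have Ej j : xis w0 j (rel ord0 (w j)) = (w0 j == w j)%:R.
    by rewrite ffunE xi_relE (negPf (nz j)) mulr0 subr0.
  under eq_bigr do rewrite Ej.
  case: (w0 =P w) => [->|/eqP ne]; first by rewrite big1 // => j _; rewrite eqxx.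
  have /existsP[j nj] : [exists j, w0 j != w j].
    apply: contraNT ne; rewrite negb_exists => /forallP e; apply/eqP/ffunP => j.
    by apply/eqP; rewrite -[_ == _]negbK.
  by rewrite (bigD1 j) //= (negPf nj) mul0r.
rewrite (bigD1 w0) //= E eqxx mul1r cnt_word // big1 ?addr0 // => w ww0.
by rewrite E eq_sym (negPf ww0) mul0r.
Qed.

End SymmetricForms.

(** * Sections of the twist of D^d R, the torus action and local lifts *)

Section Weights.
Variable F : fieldType.
Local Notation S := {mpoly F[3]}.
Local Notation K := {fraction S}.
Local Notation "p %:F" := (@FracField.tofrac S p).
Implicit Types (I J : {set 'I_3}).
Local Notation form := Defs.form.
Local Notation symmetric_form := Defs.symmetric_form.
Local Notation RK := (subvs_of (@Rgen F)).
Local Notation RKdual := 'Hom(RK, K^o).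
Local Notation x h := (('X_h : S)%:F).

Local Notation scal c := ((c%:MP : S)%:F).

Lemma set1_cond m (i : 'I_3) : ([set i] != set0) || (0 <= m :> int).
Proof. by apply/orP; left; apply/set0Pn; exists i; rewrite set11. Qed.

(** For the converse, O(k) is trivialized on U_I by the k-th power of x_p; dividing by it leaves an
    untwisted form, whose regularity follows by expanding its arguments in the [xi h]. *)
Lemma twistP d (k : nat) I (p : 'I_3) (phi : form F d) : p \in I ->
  twist (@DR F d) k I phi <->
  [/\ multilin phi, symmetric_form phi & forall b, mdeg b = d -> OP k I (hat phi b)].
Proof.
move=> pI; have Im m : (I != set0) || (0 <= m :> int).
  by apply/orP; left; apply/set0Pn; exists p.
split=> [[n [f [psi [Of Rpsi phiE]]]]|[ml sym Ophi]].
  split.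
  - move=> l i c y y'; rewrite !phiE mulr_sumr -big_split; apply: eq_bigr => j _ /=.
    by have [ml _ _] := Rpsi j; rewrite ml mulrDr mulrCA.
  - by move=> l s; rewrite !phiE; apply: eq_bigr => j _; have [_ sym _] := Rpsi j; rewrite sym.
  - move=> b bd; rewrite /hat phiE; apply: OP_sum => // j _.
    rewrite -[k%:Z]addr0; apply: OPM (Of j) _; have [_ _] := Rpsi j; apply => j'.
    by rewrite ffunE; exact: Rdual_xi.
pose y : K := ('X_p ^+ k : S)%:F.
have y0 : y != 0 by rewrite /y tofracXn expf_neq0 // x_neq0.
exists 1%N, (fun _ => y), (fun _ l => phi l / y); split.
- move=> _; apply: (@OP_homog _ _ _ k) => //; rewrite mpolyXn dhomogX /=.
  by rewrite mdegMn mdeg1 mul1n.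
- move=> _; split.
  + by move=> l i c u v; rewrite ml mulrDl mulrA.
  + by move=> l s; rewrite sym.
  + move=> l Rl.
    apply: (multilin_ind (C := OP 0 I) (Q := fun a => OP 0 I (a / y)) ml _ _ _ _
              (fun j => xi_expand p (l j))).
    * by rewrite mul0r; exact: OP0.
    * by move=> a b Oa Ob; rewrite mulrDl; exact: OPD.
    * by move=> c a Oc Oa; rewrite -mulrA -[0]addr0; exact: OPM.
    * move=> w; rewrite hatE //.
      have -> : 0 = k%:Z + - k%:Z by rewrite subrr.
      by apply: OPM; [apply: Ophi; exact: mdeg_cnt | exact: OP_Xinv].
    * by move=> j h; exact: Rdual_rel.
- by move=> l; rewrite big_ord1 mulrC divfK.
Qed.

Lemma sigmaK_scal t (c : F) : torus t -> sigmaK t (scal c) = scal c.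
Proof. by move=> t1; rewrite sigmaK_tofrac // /sigma comp_mpolyC. Qed.

Lemma actRdual_xi t (h : 'I_3) : torus t ->
  actRdual (tinv t) (xi F h) = scal (t h) *: xi F h.
Proof.
move=> t1; have t1' := torus_tinv t1; apply/lfunP => r.
rewrite actRdualE // tinvK scale_lfunE !xiE vsval_actR // mxE sigmaKM //.
by rewrite sigmaK_scal // sigmaKVK.
Qed.

Lemma actRdual_semilinear t (c : K) (y y' : RKdual) : torus t ->
  actRdual t (c *: y + y') = sigmaK t c *: actRdual t y + actRdual t y'.
Proof.
move=> t1; apply/lfunP => r; rewrite add_lfunE scale_lfunE !actRdualE //.
by rewrite add_lfunE scale_lfunE sigmaKD // /GRing.scale /= sigmaKM.
Qed.

Lemma act_multilin d t (phi : form F d) : torus t -> multilin phi -> multilin (act_form t phi).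
Proof.
move=> t1 ml l i c y y'; have t1' := torus_tinv t1; rewrite /act_form.
have E u : [ffun j => actRdual (tinv t) (upd l i u j)] =
    upd [ffun j => actRdual (tinv t) (l j)] i (actRdual (tinv t) u).
  by apply/ffunP => j; rewrite !ffunE; case: eqP.
rewrite !E actRdual_semilinear // ml sigmaKD // sigmaKM //; congr (_ * _ + _).
by rewrite -{1}[t]tinvK sigmaKVK.
Qed.

Lemma multilin_scale d (phi : form F d) (c : 'I_d -> K) (l : {ffun 'I_d -> RKdual}) :
  multilin phi -> phi [ffun j => c j *: l j] = (\prod_j c j) * phi l.
Proof.
move=> ml; suff H k : (k <= d)%N ->
    phi [ffun j : 'I_d => if (j < k)%N then c j *: l j else l j] =
    (\prod_(j < d | (j < k)%N) c j) * phi l.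
  rewrite -[X in phi X](_ : [ffun j : 'I_d => if (j < d)%N then c j *: l j else l j] = _).
    by rewrite H //; congr (_ * _); apply: eq_bigl => j; rewrite ltn_ord.
  by apply/ffunP => j; rewrite !ffunE ltn_ord.
elim: k => [|k IH] kd.
  rewrite big1 // mul1r; congr phi; apply/ffunP => j; by rewrite ffunE.
pose i := Ordinal kd; set L := [ffun j : 'I_d => if (j < k)%N then c j *: l j else l j] in IH.
have -> : [ffun j : 'I_d => if (j < k.+1)%N then c j *: l j else l j] = upd L i (c i *: L i + 0).
  apply/ffunP => j; rewrite updE !ffunE addr0 ltnn.
  case: (j =P i) => [->|ji]; first by rewrite ltnSn.
  rewrite ltnS leq_eqVlt; case: eqP => // jk; case: ji; exact: val_inj.
rewrite ml multilin0 // addr0 upd_id IH ?(ltnW kd) // mulrA; congr (_ * _).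
rewrite [RHS](bigD1 i) /= ?ltnSn //; congr (_ * _); apply: eq_bigl => j.
by rewrite ltnS ltn_neqAle andbC.
Qed.

Definition tpow (t : 'I_3 -> F) (b : 'X_{1..3}) : F := \prod_(h < 3) t h ^+ b h.

Lemma tpowD t b b' : tpow t (b + b')%MM = tpow t b * tpow t b'.
Proof. by rewrite /tpow -big_split; apply: eq_bigr => h _; rewrite mnmDE exprD. Qed.

Lemma tpowU t h : tpow t U_(h)%MM = t h.
Proof.
rewrite /tpow (bigD1 h) //= mnm1E eqxx expr1 big1 ?mulr1 // => i /negPf ih.
by rewrite mnm1E eq_sym ih.
Qed.

Lemma tpow_cnt d t (w : {ffun 'I_d -> 'I_3}) : \prod_j t (w j) = tpow t (cnt w).
Proof.
have -> : \prod_j t (w j) = \prod_(y <- codom w) t y.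
  by rewrite /codom /image_mem big_map big_enum.
rewrite /tpow; under [RHS]eq_bigr do rewrite cntE.
elim: (codom w) => [|y s IH]; first by rewrite big_nil big1.
rewrite big_cons IH /=; under [RHS]eq_bigr do rewrite exprD.
rewrite big_split /=; congr (_ * _).
rewrite (bigD1 y) //= eqxx expr1 big1 ?mulr1 // => i /negPf.
by rewrite eq_sym => ->.
Qed.

Lemma act_xis d t (phi : form F d) w : torus t -> multilin phi ->
  act_form t phi (xis F w) = scal (tpow t (cnt w)) * sigmaK t (phi (xis F w)).
Proof.
move=> t1 ml; rewrite /act_form.
have -> : [ffun j => actRdual (tinv t) (xis F w j)] = [ffun j => scal (t (w j)) *: xis F w j].
  by apply/ffunP => j; rewrite !ffunE actRdual_xi.
rewrite multilin_scale // sigmaKM //; congr (_ * _).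
rewrite -(rmorph_prod (@FracField.tofrac S)) -(rmorph_prod (@mpolyC 3 F)) /=.
by rewrite sigmaK_scal // tpow_cnt.
Qed.

Lemma act_weight d t (phi : form F d) a : torus t -> multilin phi ->
    (forall w, scal (tpow t (cnt w)) * sigmaK t (phi (xis F w)) =
       scal (tpow t a) * phi (xis F w)) ->
  forall l, act_form t phi l = scal (tpow t a) * phi l.
Proof.
move=> t1 ml E; have ml2 : multilin (fun l => scal (tpow t a) * phi l).
  by move=> l i c y y'; rewrite ml mulrDr mulrCA.
by apply: (multilin_ext (act_multilin t1 ml) ml2) => w; rewrite act_xis // E.
Qed.

(** The equation that the sum of x_h v(c + U_h) is W(c) is solved for v(c + U_i), starting from 0
    where the exponent at [i] is 0; [n] is that exponent. *)
Fixpoint liftn (i : 'I_3) (W : 'X_{1..3} -> K) (n : nat) (b : 'X_{1..3}) : K :=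
  if n is n'.+1 then
    (W (b - U_(i))%MM - \sum_(h | h != i) x h * liftn i W n' (b - U_(i) + U_(h))%MM) / x i
  else 0.

(* A local lift, over U_i, of a section W of D^(d-1) V (x) O(e). *)
Definition local_lift i W (b : 'X_{1..3}) := liftn i W (b i) b.

Lemma local_lift_rel i W c : \sum_h x h * local_lift i W (c + U_(h))%MM = W c.
Proof.
rewrite (bigD1 i) //= {1}/local_lift mnmDE mnm1E eqxx addn1 /= addmK.
rewrite mulrC divfK ?x_neq0 //.
rewrite -[RHS](subrK (\sum_(h | h != i) x h * liftn i W (c i) (c + U_(h))%MM)).
congr (_ + _); apply: eq_bigr => h hi.
by rewrite /local_lift mnmDE mnm1E (negPf hi) addn0.
Qed.

Lemma local_lift_OP d (k : nat) i W b :
    (forall c, (mdeg c).+1 = d -> OP k.+1 set0 (W c)) -> mdeg b = d ->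
  OP k [set i] (local_lift i W b).
Proof.
move=> OW; rewrite /local_lift; have Im m := set1_cond m i.
move En: (b i) => n; elim: n b En => [|n IH] b bi bd; first exact: OP0.
have le : (U_(i) <= b)%MM.
  by apply/mnm_lepP => h; rewrite mnm1E; case: eqP => // <-; rewrite bi.
have dc : (mdeg (b - U_(i))%MM).+1 = d by rewrite -bd -[in RHS](submK le) mdegD mdeg1 addn1.
have -> : k%:Z = k.+1%:Z - 1 by lia.
rewrite /=; apply: OPM; last by have := OP_Xinv F 1 (set11 i); rewrite expr1.
apply: OPB => //; first by apply: OP_subset (OW _ dc) => //; exact: sub0set.
apply: OP_sum => // h hi; have -> : k.+1%:Z = 1 + k%:Z by lia.
apply: OPM; first exact: OPX.
apply: IH; last by rewrite mdegD mdeg1 addn1.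
by rewrite mnmDE mnmBE !mnm1E (negPf hi) eqxx bi addn0 subn1.
Qed.

Lemma local_lift_sum (T : finType) i (y : T -> K) (W : T -> 'X_{1..3} -> K) b :
  local_lift i (fun c => \sum_s y s * W s c) b = \sum_s y s * local_lift i (W s) b.
Proof.
rewrite /local_lift; move: (b i) => n; elim: n b => [|n IH] b /=.
  by rewrite big1 // => s _; rewrite mulr0.
have -> : \sum_(h | h != i) x h * liftn i (fun c => \sum_s y s * W s c) n (b - U_(i) + U_(h))%MM
   = \sum_s y s * \sum_(h | h != i) x h * liftn i (W s) n (b - U_(i) + U_(h))%MM.
  under [RHS]eq_bigr do rewrite mulr_sumr.
  rewrite exchange_big; apply: eq_bigr => h _; rewrite IH mulr_sumr.
  by apply: eq_bigr => s _; rewrite mulrCA.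
rewrite -sumrB mulr_suml; apply: eq_bigr => s _.
by rewrite -mulrBr mulrA.
Qed.

Definition weight_at t a (W : 'X_{1..3} -> K) c : Prop :=
  scal (tpow t c) * sigmaK t (W c) = scal (tpow t a) * W c.

Lemma scalM (c c' : F) : scal (c * c') = scal c * scal c'.
Proof. by rewrite mpolyCM tofracM. Qed.

Lemma scal_neq0 (c : F) : c != 0 -> scal c != 0.
Proof. by move=> c0; rewrite tofrac_eq0 mpolyC_eq0. Qed.

Lemma sigmaK_x t h : torus t -> sigmaK t (x h) = scal (t h) * x h.
Proof. by move=> t1; rewrite sigmaK_tofrac // sigmaX -mul_mpolyC tofracM. Qed.

(** The recursion uses only the variables, which are weight vectors, so the lift inherits the weight
    of [W]. *)
Lemma local_lift_weight d t a i W b : torus t ->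
    (forall c, (mdeg c).+1 = d -> weight_at t a W c) -> mdeg b = d ->
  weight_at t a (local_lift i W) b.
Proof.
move=> t1 wW; rewrite /weight_at /local_lift.
have s0 : sigmaK t 0 = 0 by rewrite -(tofrac0 S) sigmaK_tofrac // rmorph0.
move En: (b i) => n; elim: n b En => [|n IH] b bi bd; first by rewrite /= s0 !mulr0.
have le : (U_(i) <= b)%MM.
  by apply/mnm_lepP => h; rewrite mnm1E; case: eqP => // <-; rewrite bi.
have dc : (mdeg (b - U_(i))%MM).+1 = d by rewrite -bd -[in RHS](submK le) mdegD mdeg1 addn1.
have ti0 := scal_neq0 (torus_neq0 t1 i).
rewrite /=; set c := (b - U_(i))%MM; set s := \sum_(h | h != i) _.
have sV : sigmaK t ((x i)^-1) = (scal (t i) * x i)^-1.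
  apply: (mulIf (mulf_neq0 ti0 (x_neq0 F i))); rewrite mulVf ?mulf_neq0 ?x_neq0 //.
  by rewrite -sigmaK_x // -sigmaKM // mulVf ?x_neq0 // -(tofrac1 S) sigmaK_tofrac // rmorph1.
have -> : tpow t b = tpow t c * t i by rewrite -tpowU -tpowD /c submK.
have Es : scal (tpow t c) * sigmaK t s = scal (tpow t a) * s.
  rewrite /s (big_morph (sigmaK t) (fun f g => sigmaKD f g t1) s0) !mulr_sumr.
  apply: eq_bigr => h hi; rewrite sigmaKM // sigmaK_x //.
  have := IH (c + U_(h))%MM; rewrite tpowD tpowU scalM.
  rewrite mnmDE /c mnmBE !mnm1E (negPf hi) eqxx bi addn0 subn1 mdegD mdeg1 addn1.
  move=> /(_ erefl dc) e; rewrite [RHS]mulrCA -e; ring.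
have sN : sigmaK t (- s) = - sigmaK t s.
  by apply/eqP; rewrite -addr_eq0 -sigmaKD // addNr s0.
rewrite sigmaKM // sV sigmaKD // sN scalM invfM.
have Ew := wW _ dc; rewrite /weight_at -/c in Ew.
transitivity ((scal (tpow t c) * sigmaK t (W c) - scal (tpow t c) * sigmaK t s) / x i
   * (scal (t i) / scal (t i))); first by ring.
by rewrite divff // mulr1 Ew Es -mulrBr mulrA.
Qed.

End Weights.

(** * The connecting homomorphism *)

Section Connecting.
Variable F : fieldType.
Local Notation S := {mpoly F[3]}.
Local Notation K := {fraction S}.
Local Notation "p %:F" := (@FracField.tofrac S p).
Implicit Types (I J : {set 'I_3}).
Local Notation form := Defs.form.
Local Notation symmetric_form := Defs.symmetric_form.
Local Notation RK := (subvs_of (@Rgen F)).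
Local Notation RKdual := 'Hom(RK, K^o).
Local Notation x h := (('X_h : S)%:F).

Local Notation scal c := ((c%:MP : S)%:F).
Local Notation family := ('X_{1..3} -> K).

Variables (d k : nat).
Implicit Types (W v : family).

(* Global sections of D^(d-1) V (x) O(k+1), and those coming from D^d V (x) O(k). *)
Definition section W : Prop := forall c, (mdeg c).+1 = d -> OP k.+1 set0 (W c).

Definition boundary W : Prop := exists v : family,
  (forall b, mdeg b = d -> OP k set0 (v b)) /\
  (forall c, (mdeg c).+1 = d -> W c = \sum_h x h * v (c + U_(h))%MM).

(* Of the sequence 0 -> D^d R(k) -> D^d V (x) O(k) -> D^(d-1) V (x) O(k+1) -> 0. *)
Definition connecting W : cochain1 F d :=
  fun i j => @mkform F d (fun b => local_lift j W b - local_lift i W b).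

Local Notation G := (twist (@DR F d) k).

Lemma mkform_ext (H H' : family) l : (forall b, mdeg b = d -> H b = H' b) ->
  @mkform F d H l = @mkform F d H' l.
Proof. by move=> E; apply: eq_bigr => w _; rewrite E // mdeg_cnt. Qed.

Lemma mkformB (H H' : family) l :
  @mkform F d (fun b => H b - H' b) l = mkform H l - mkform H' l.
Proof. by rewrite /mkform -sumrB; apply: eq_bigr => w _; rewrite mulrBr. Qed.

Lemma mkform_sum (T : finType) (y : T -> K) (H : T -> family) l :
  @mkform F d (fun b => \sum_s y s * H s b) l = \sum_s y s * mkform (H s) l.
Proof.
under [RHS]eq_bigr do rewrite mulr_sumr.
rewrite exchange_big; apply: eq_bigr => w _; rewrite mulr_sumr.
by apply: eq_bigr => s _; rewrite mulrCA.
Qed.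

Lemma rel_onB (H H' : family) :
  (forall c, (mdeg c).+1 = d -> \sum_h x h * H (c + U_(h))%MM = \sum_h x h * H' (c + U_(h))%MM) ->
  rel_on d (fun b => H b - H' b).
Proof.
move=> E c cd; under eq_bigr do rewrite mulrBr.
by rewrite sumrB E // subrr.
Qed.

Lemma mkform_twist I (p : 'I_3) (H : family) : p \in I -> rel_on d H ->
  (forall b, mdeg b = d -> OP k I (H b)) -> G I (@mkform F d H).
Proof.
move=> pI rH OH; apply/(twistP k _ pI); split.
- exact: mkform_multilin.
- exact: mkform_symmetric.
- by move=> b bd; rewrite hat_mkform //; exact: OH.
Qed.

Lemma mkform_hat (phi : form F d) : multilin phi -> symmetric_form phi ->
  forall l, phi l = @mkform F d (hat phi) l.
Proof.
move=> ml sym; apply: multilin_ext => // [|w]; first exact: mkform_multilin.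
rewrite !hatE //; last exact: mkform_symmetric.
by rewrite hat_mkform //; [exact: hat_rel | exact: mdeg_cnt].
Qed.

Lemma hat_mkformB (H H' : family) b : mdeg b = d ->
  (forall c, (mdeg c).+1 = d -> \sum_h x h * H (c + U_(h))%MM = \sum_h x h * H' (c + U_(h))%MM) ->
  hat (@mkform F d (fun b => H b - H' b)) b = H b - H' b.
Proof. by move=> bd E; rewrite hat_mkform //; exact: rel_onB. Qed.

Lemma connecting_rel W i j c :
  \sum_h x h * local_lift i W (c + U_(h))%MM = \sum_h x h * local_lift j W (c + U_(h))%MM.
Proof. by rewrite !local_lift_rel. Qed.

Lemma connecting_cocycle W : section W -> cocycle1 G (connecting W).
Proof.
move=> sW; split=> [i j|i j h l].
  apply: (mkform_twist (set21 i j)).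
    by apply: rel_onB => c _; exact: connecting_rel.
  have nz : ([set i; j] != set0) || (0 <= k%:Z).
    by apply/orP; left; apply/set0Pn; exists i; exact: set21.
  move=> b bd; apply: OPB => //.
    by apply: (OP_subset nz _ (local_lift_OP j sW bd)); rewrite sub1set set22.
  by apply: (OP_subset nz _ (local_lift_OP i sW bd)); rewrite sub1set set21.
rewrite /connecting !mkformB; ring.
Qed.

Lemma connecting_sum (T : finType) (y : T -> K) (W : T -> family) i j l :
  connecting (fun c => \sum_s y s * W s c) i j l = \sum_s y s * connecting (W s) i j l.
Proof.
rewrite /connecting -mkform_sum; apply: mkform_ext => b _.
rewrite !local_lift_sum -sumrB; by apply: eq_bigr => s _; rewrite mulrBr.
Qed.

Lemma connectingB W W' i j l :
  connecting (fun c => W c - W' c) i j l = connecting W i j l - connecting W' i j l.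
Proof.
(* A difference is a combination with coefficients 1 and -1 over the two booleans, to which
   [connecting_sum] applies. *)
have E W0 : connecting (fun c => W c - W' c) i j l =
    connecting (fun c => \sum_(s : bool) (if s then 1 else -1) * (if s then W c else W' c)) i j l.
  congr (connecting _ i j l); apply/boolp.funext => c.
  by rewrite big_bool /= mul1r mulN1r.
have -> : connecting (fun c => W c - W' c) i j l =
    connecting (fun c => \sum_(s : bool) (if s then 1 else -1) * (if s then W else W') c) i j l.
  congr (connecting _ i j l); apply/boolp.funext => c.
  by rewrite big_bool /= mul1r mulN1r.
by rewrite connecting_sum big_bool /= mul1r mulN1r.
Qed.

(** Once corrected by the cochain, the local lifts agree, so they glue to a global lift of [W]. *)
Lemma boundary_of_coboundary W : section W -> coboundary1 G (connecting W) -> boundary W.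
Proof.
move=> sW [B [GB EB]].
have GB' i := (twistP k (B i) (set11 i)).1 (GB i).
pose v i b := local_lift i W b - hat (B i) b.
have vij i j b : mdeg b = d -> v i b = v j b.
  move=> bd; have e : local_lift j W b - local_lift i W b = hat (B j) b - hat (B i) b.
    rewrite -(hat_mkformB bd (fun c _ => connecting_rel W j i c)); exact: EB.
  apply/eqP; rewrite /v -subr_eq0.
  have -> : local_lift i W b - hat (B i) b - (local_lift j W b - hat (B j) b) =
    hat (B j) b - hat (B i) b - (local_lift j W b - local_lift i W b) by ring.
  by rewrite e subrr.
have Ov i b : mdeg b = d -> OP k [set i] (v i b).
  move=> bd; apply: OPB; first exact: set1_cond.
    exact: (local_lift_OP i sW bd).
  by have [_ _] := GB' i; apply.
exists (v ord0); split=> [b bd|c cd].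
  apply: (@OP_glue F k ord0 (lift ord0 ord0)) => //; first exact: Ov.
  by rewrite (vij ord0 (lift ord0 ord0)) //; exact: Ov.
under eq_bigr do rewrite mulrBr.
rewrite sumrB local_lift_rel.
have [ml sym _] := GB' ord0; by rewrite (hat_rel ml sym) // subr0.
Qed.

Lemma coboundary_of_boundary W : section W -> boundary W -> coboundary1 G (connecting W).
Proof.
move=> sW [v [Ov Ev]].
exists (fun i => @mkform F d (fun b => local_lift i W b - v b)); split=> [i|i j l].
  apply: (mkform_twist (set11 i)).
    by apply: rel_onB => c cd; rewrite local_lift_rel -Ev.
  move=> b bd; apply: OPB; first exact: set1_cond.
    exact: (local_lift_OP i sW bd).
  by apply: OP_subset (Ov b bd); [exact: set1_cond | exact: sub0set].
by rewrite -mkformB; apply: mkform_ext => b _; ring.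
Qed.

(** Surjectivity of the connecting map, from H^1(O(k)) = 0: the cocycle splits in D^d V (x) O(k),
    coefficient by coefficient, and [W] is the common image of the splitting. *)
Lemma cocycle_connecting z : cocycle1 G z -> exists W, section W /\
  coboundary1 G (fun i j l => z i j l - connecting W i j l).
Proof.
move=> [Gz cz].
have Gz' i j := (twistP k (z i j) (set21 i j)).1 (Gz i j).
have ex b : exists y : 'I_3 -> K, mdeg b = d ->
    (forall i, OP k [set i] (y i)) /\ (forall i j, hat (z i j) b = y j - y i).
  have [bd|bd] := eqVneq (mdeg b) d; last by exists (fun _ => 0) => e; rewrite e eqxx in bd.
  have [y Hy] := @OP_cocycle F k (fun i j => hat (z i j) b) isT
    (fun i j => let: And3 _ _ H := Gz' i j in H b bd) (fun i j h => cz i j h _).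
  by exists y.
have [y Hy] := boolp.choice ex.
pose W c := \sum_h x h * y (c + U_(h))%MM ord0.
(* The image does not depend on the chart, because the differences satisfy the relations of D^d
   R. *)
have WE i c : (mdeg c).+1 = d -> \sum_h x h * y (c + U_(h))%MM i = W c.
  move=> cd; apply/eqP; rewrite -subr_eq0 /W -sumrB; apply/eqP.
  have [ml sym _] := Gz' ord0 i.
  rewrite -[RHS](hat_rel ml sym cd); apply: eq_bigr => h _.
  have [_ ->] := Hy (c + U_(h))%MM ltac:(by rewrite mdegD mdeg1 addn1).
  by rewrite mulrBr.
have sW : section W.
  move=> c cd; have O i : OP k.+1 [set i] (W c).
    rewrite -(WE i) //; apply: OP_sum; first exact: set1_cond.
    move=> h _; have -> : k.+1%:Z = 1 + k%:Z by lia.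
    apply: OPM; first exact: OPX.
    by have [O _] := Hy (c + U_(h))%MM ltac:(by rewrite mdegD mdeg1 addn1).
  by apply: (@OP_glue F _ ord0 (lift ord0 ord0)); rewrite ?O.
exists W; split=> //.
exists (fun i => @mkform F d (fun b => y b i - local_lift i W b)); split=> [i|i j l].
  apply: (mkform_twist (set11 i)).
    by apply: rel_onB => c cd; rewrite local_lift_rel WE.
  move=> b bd; apply: OPB; first exact: set1_cond.
    by have [O _] := Hy b bd.
  exact: (local_lift_OP i sW bd).
have [ml sym _] := Gz' i j; rewrite (mkform_hat ml sym) /connecting -!mkformB.
apply: mkform_ext => b bd; have [_ ->] := Hy b bd; ring.
Qed.

Lemma connecting_weight t a W : torus t ->
  (forall c, (mdeg c).+1 = d -> weight_at t a W c) ->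
  forall i j l, act_form t (connecting W i j) l = scal (tpow t a) * connecting W i j l.
Proof.
move=> t1 wW i j; apply: act_weight => //; first exact: mkform_multilin.
move=> w; rewrite hatE; last exact: mkform_symmetric.
have cd := mdeg_cnt w.
rewrite hat_mkformB //; last by move=> c _; exact: connecting_rel.
have sN f : sigmaK t (- f) = - sigmaK t f.
  apply/eqP; rewrite -addr_eq0 -sigmaKD // addNr.
  by rewrite -(tofrac0 S) sigmaK_tofrac // rmorph0.
rewrite sigmaKD // sN !mulrBr.
by rewrite (local_lift_weight j t1 wW cd) (local_lift_weight i t1 wW cd).
Qed.

(** The connecting map identifies H^1 with the cokernel on global sections and respects weights, so
    it carries a basis of weight vectors to one. *)
Theorem H1_of_coker n (W : 'I_n -> family) (a : 'I_n -> 'X_{1..3}) :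
    (forall j, section (W j)) ->
    (forall j t c, torus t -> (mdeg c).+1 = d -> weight_at t (a j) (W j) c) ->
    (forall W0, section W0 -> exists y : 'I_n -> F,
      boundary (fun c => W0 c - \sum_j scal (y j) * W j c)) ->
    (forall y : 'I_n -> F, boundary (fun c => \sum_j scal (y j) * W j c) -> forall j, y j = 0) ->
  H1_has_character G (\sum_j toA 'X_[a j]).
Proof.
move=> sW wW span indep; exists n, (fun j => connecting (W j)), a; split=> //.
- move=> j; split; first exact: connecting_cocycle.
  (* The cocycles themselves are weight vectors, hence the zero cochain. *)
  move=> t t1; exists (fun _ _ => 0); split=> [i|i h l].
    apply/(twistP k _ (set11 i)); split.
    + by move=> l i' c y y'; rewrite mulr0 addr0.
    + by [].
    + by move=> b _; apply: OP0; exact: set1_cond.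
  have := connecting_weight t1 (fun c => wW j t c t1) i h l.
  by rewrite /tpow => ->; rewrite !subrr.
- move=> z cz; have [W0 [sW0 [B [GB EB]]]] := cocycle_connecting cz.
  have [y bd] := span W0 sW0; exists y.
  have sub : section (fun c => W0 c - \sum_j scal (y j) * W j c).
    have Ik : ((set0 : {set 'I_3}) != set0) || (0 <= k.+1%:Z) by rewrite orbT.
    move=> c cd; apply: OPB => //; first exact: sW0.
    by apply: OP_sum => // j _; apply: OPZ; exact: sW.
  have [B' [GB' EB']] := coboundary_of_boundary sub bd.
  exists (fun i l => B i l + B' i l); split=> [i|i h l].
    have [ml sym O] := (twistP k (B i) (set11 i)).1 (GB i).
    have [ml' sym' O'] := (twistP k (B' i) (set11 i)).1 (GB' i).
    apply/(twistP k _ (set11 i)); split.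
    + by move=> l i' c u u'; rewrite ml ml' mulrDr addrACA.
    + by move=> l s; rewrite sym sym'.
    + by move=> b bd'; apply: OPD; [exact: set1_cond | exact: O | exact: O'].
  rewrite opprD addrACA -EB -EB' connectingB connecting_sum; ring.
- move=> y [B [GB EB]] j; apply: (indep y); apply: boundary_of_coboundary.
    have Ik : ((set0 : {set 'I_3}) != set0) || (0 <= k.+1%:Z) by rewrite orbT.
    by move=> c cd; apply: OP_sum => // j' _; apply: OPZ; exact: sW.
  by exists B; split=> // i h l; rewrite connecting_sum EB.
Qed.

End Connecting.

(** * Weight spaces *)

Section WeightSpaces.
Variable F : fieldType.
Local Notation S := {mpoly F[3]}.
Local Notation K := {fraction S}.
Local Notation "p %:F" := (@FracField.tofrac S p).
Implicit Types (I J : {set 'I_3}).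
Hypothesis char2 : 2%N \in [pchar F].
Local Notation x h := (('X_h : S)%:F).
Local Notation z := ('X + 1 : {poly F}).
Local Notation scal c := ((c%:MP : S)%:F).

Lemma big_ord3 (V : nmodType) (f : 'I_3 -> V) : \sum_h f h = f i0 + f i1 + f i2.
Proof. by rewrite !big_ord_recl big_ord0 addr0 addrA. Qed.

Lemma mdeg3 (u : 'X_{1..3}) : mdeg u = (u i0 + u i1 + u i2)%N.
Proof. by rewrite mdegE !big_ord_recl big_ord0 addn0 addnA. Qed.

Lemma forall_ord3 (P : 'I_3 -> Prop) : P i0 -> P i1 -> P i2 -> forall h, P h.
Proof.
move=> p0 p1 p2 [[|[|[|h]]] lt] //.
- by rewrite (_ : Ordinal lt = i0) //; exact: val_inj.
- by rewrite (_ : Ordinal lt = i1) //; exact: val_inj.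
- by rewrite (_ : Ordinal lt = i2) //; exact: val_inj.
Qed.

Definition dehomog_var (h : 'I_3) : {poly F} := if h == i0 then 'X else if h == i1 then 1 else z.

(* As X + 1 = -(X + 1), the kernel consists, in each degree, of the multiples of
   x_1 + x_2 + x_3. *)
Definition dehomog (p : S) : {poly F} := mmap polyC dehomog_var p.

Lemma dehomog_is_zmod_morphism : zmod_morphism dehomog.
Proof. exact: (rmorphB (mmap polyC dehomog_var)). Qed.
Lemma dehomog_is_monoid_morphism : monoid_morphism dehomog.
Proof.
by split; [exact: (rmorph1 (mmap polyC dehomog_var)) | exact: (rmorphM (mmap polyC dehomog_var))].
Qed.
HB.instance Definition _ :=
  GRing.isZmodMorphism.Build S {poly F} dehomog dehomog_is_zmod_morphism.
HB.instance Definition _ :=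
  GRing.isMonoidMorphism.Build S {poly F} dehomog dehomog_is_monoid_morphism.

Lemma dehomogX (u : 'X_{1..3}) : dehomog 'X_[u] = 'X^(u i0) * z ^+ u i2.
Proof.
rewrite /dehomog mmapX /mmap1 !big_ord_recl big_ord0 /dehomog_var /=.
by rewrite expr1n mul1r mulr1.
Qed.

Lemma dehomogZ c p : dehomog (c *: p) = c *: dehomog p.
Proof. by rewrite /dehomog mmapZ mul_polyC. Qed.

Lemma homog_mdeg n (p : S) (u : 'X_{1..3}) : p \is n.-homog -> u \in msupp p -> mdeg u = n.
Proof. by move=> /dhomogP h /h. Qed.

Definition ell : S := 'X_i0 + 'X_i1 + 'X_i2.

Lemma dehomog_ell : dehomog ell = 0.
Proof.
rewrite /ell !rmorphD /= !dehomogX !mnm1E /= !expr0 !mulr1 !mul1r !expr1.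
by rewrite (addrr_pchar2 (char2_poly char2)).
Qed.

Lemma mcoeff_ell p u : (ell * p)@_u = \sum_h (if (U_(h) <= u)%MM then p@_(u - U_(h)) else 0).
Proof.
have E h : ('X_h * p)@_u = if (U_(h) <= u)%MM then p@_(u - U_(h)) else 0.
  by case: ifPn => le; [exact: mcoeffXM | exact: mcoeffXM0].
by rewrite big_ord3 /ell !mulrDl !mcoeffD !E.
Qed.

(** * One weight: forms modulo [ell] and the ideal of the three powers *)

Section Degree.
Variable k : nat.

Definition hom_poly (r : {poly F}) : S :=
  \sum_(i < k.+2) r`_i *: 'X_[U_(i0) *+ i + U_(i1) *+ (k.+1 - i)].

Lemma mdeg_hom i : (i < k.+2)%N -> mdeg (U_(i0) *+ i + U_(i1) *+ (k.+1 - i))%MM = k.+1.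
Proof. by move=> lt; rewrite mdegD !mdegMn !mdeg1; lia. Qed.

Lemma dehomog_hom (r : {poly F}) : (size r <= k.+2)%N -> dehomog (hom_poly r) = r.
Proof.
move=> sr; rewrite /hom_poly rmorph_sum /= -[RHS](coefK r) poly_def.
have E i : dehomog (r`_i *: 'X_[U_(i0) *+ i + U_(i1) *+ (k.+1 - i)]) = r`_i *: 'X^i.
  by rewrite dehomogZ dehomogX !mnmDE !mulmnE !mnm1E /= !mul0n addn0 expr0 mulr1 mul1n.
rewrite [RHS](big_ord_widen k.+2 (fun i => r`_i *: 'X^i) sr) [RHS]big_mkcond.
by apply: eq_bigr => i _; rewrite E; case: ltnP => // le; rewrite nth_default ?scale0r.
Qed.

Lemma divide_ell p : (p : S) \is k.+1.-homog -> exists q (r : {poly F}),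
  [/\ q \is k.-homog, (size r <= k.+2)%N & p = ell * q + hom_poly r].
Proof.
pose P p := exists q (r : {poly F}),
  [/\ q \is k.-homog, (size r <= k.+2)%N & p = ell * q + hom_poly r].
have PD p1 p2 : P p1 -> P p2 -> P (p1 + p2).
  move=> [q1 [r1 [h1 s1 ->]]] [q2 [r2 [h2 s2 ->]]]; exists (q1 + q2), (r1 + r2); split.
  - exact: rpredD.
  - by rewrite (leq_trans (size_polyD _ _)) // geq_max s1.
  - rewrite mulrDr addrACA; congr (_ + _); rewrite /hom_poly -big_split.
    by apply: eq_bigr => i _; rewrite coefD scalerDl.
have PZ c p1 : P p1 -> P (c *: p1).
  move=> [q1 [r1 [h1 s1 ->]]]; exists (c *: q1), (c *: r1); split.
  - exact: dhomogZ.
  - exact: leq_trans (size_scale_leq _ _) s1.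
  - rewrite scalerDr scalerAr; congr (_ + _); rewrite /hom_poly scaler_sumr.
    by apply: eq_bigr => i _; rewrite coefZ scalerA.
have P0 : P 0.
  exists 0, 0; split; [exact: dhomog0 | by rewrite size_poly0 |].
  by rewrite mulr0 add0r /hom_poly big1 // => i _; rewrite coef0 scale0r.
have PX u : mdeg u = k.+1 -> P 'X_[u].
  move Eu: (u i2) => n; elim: n u Eu => [|n IH] u u2 ud.
    have lt : (u i0 < k.+2)%N by move: ud; rewrite mdeg3; lia.
    exists 0, 'X^(u i0); split; [exact: dhomog0 | by rewrite size_polyXn |].
    rewrite mulr0 add0r /hom_poly (bigD1 (Ordinal lt)) //= coefXn eqxx scale1r.
    rewrite big1 ?addr0.
      congr 'X_[_]; apply/mnmP; apply: forall_ord3; rewrite !mnmDE !mulmnE !mnm1E /=.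
      - lia.
      - by move: ud; rewrite mdeg3; lia.
      - lia.
    by move=> i; rewrite coefXn -val_eqE /= => /negPf ->; rewrite scale0r.
  have le : (U_(i2) <= u)%MM by apply/mnm_lepP; apply: forall_ord3; rewrite mnm1E //= u2.
  have wd : mdeg (u - U_(i2))%MM = k.
    by have := congr1 (fun m => mdeg m) (submK le); rewrite mdegD mdeg1 ud; lia.
  (* Writing x_3 as ell - x_1 - x_2 lowers the exponent of x_3. *)
  have -> : 'X_[u] = ell * 'X_[u - U_(i2)] + (-1) *: 'X_[u - U_(i2) + U_(i0)]
      + (-1) *: 'X_[u - U_(i2) + U_(i1)] :> S.
    rewrite -{1}(submK le) !mpolyXD /ell !scaleN1r; ring.
  have IH' (h : 'I_3) : h != i2 -> P 'X_[u - U_(i2) + U_(h)].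
    move=> h2; apply: IH; last by rewrite mdegD mdeg1 wd addn1.
    by rewrite mnmDE mnmBE !mnm1E (negPf h2) eqxx u2 addn0 subn1.
  apply: (PD); last by apply: PZ; exact: IH'.
  apply: (PD); last by apply: PZ; exact: IH'.
  exists 'X_[u - U_(i2)], 0; split; [by rewrite dhomogX /= wd | by rewrite size_poly0 |].
  by rewrite /hom_poly big1 ?addr0 // => i _; rewrite coef0 scale0r.
move=> hp; rewrite -/(P p) (mpolyE p) big_seq.
apply: (big_ind P); [exact: P0 | exact: PD | move=> u uP].
by apply: PZ; apply: PX; exact: homog_mdeg hp uP.
Qed.

Lemma dehomog_eq0 p : (p : S) \is k.+1.-homog -> dehomog p = 0 ->
  exists2 q, q \is k.-homog & p = ell * q.
Proof.
move=> /divide_ell[q [r [hq sr ->]]]; rewrite rmorphD rmorphM /= dehomog_ell mul0r add0r.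
rewrite dehomog_hom // => ->; exists q => //.
by rewrite /hom_poly big1 ?addr0 // => i _; rewrite coef0 scale0r.
Qed.

Variable a : 'X_{1..3}.

Definition in_ideal (r : {poly F}) : bool :=
  (poly_rV r <= ideal_mx F k.+1 (a i0).+1 (a i1).+1 (a i2).+1)%MS.

Lemma in_ideal0 : in_ideal 0.
Proof. by rewrite /in_ideal linear0 sub0mx. Qed.

Lemma in_idealD r s : in_ideal r -> in_ideal s -> in_ideal (r + s).
Proof. by rewrite /in_ideal linearD => ir js; rewrite addmx_sub. Qed.

Lemma in_idealZ c r : in_ideal r -> in_ideal (c *: r).
Proof. by rewrite /in_ideal linearZ => ir; rewrite scalemx_sub. Qed.

Lemma in_idealB r s : in_ideal r -> in_ideal s -> in_ideal (r - s).
Proof. by move=> ir js; rewrite -scaleN1r; apply: in_idealD => //; exact: in_idealZ. Qed.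

Lemma size_dehomogX (u : 'X_{1..3}) : (size (dehomog 'X_[u]) <= (mdeg u).+1)%N.
Proof.
rewrite dehomogX (size_mulzX char2) ?expf_neq0 ?polyX_eq0 // size_polyXn mdeg3; lia.
Qed.

Lemma in_ideal_monomial (u : 'X_{1..3}) : mdeg u = k.+1 -> ~~ (u <= a)%MM ->
  in_ideal (dehomog 'X_[u]).
Proof.
move=> ud nu; apply/(ideal_mxP char2); first by rewrite -ud; exact: size_dehomogX.
have d3 := mdeg3 u; rewrite ud in d3; rewrite dehomogX.
have [h0|h0] := ltnP (a i0) (u i0).
  exists ('X^(u i0 - (a i0).+1) * z ^+ u i2), 0, 0; split; rewrite ?size_poly0 //.
    by rewrite mul0r !addr0 mulrAC -exprD subnK.
  by rewrite (size_mulzX char2) ?expf_neq0 ?polyX_eq0 // size_polyXn; lia.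
have [h1|h1] := ltnP (a i1) (u i1).
  exists 0, ('X^(u i0) * z ^+ u i2), 0; split; rewrite ?size_poly0 //.
    by rewrite !mul0r addr0 add0r.
  by rewrite (size_mulzX char2) ?expf_neq0 ?polyX_eq0 // size_polyXn; lia.
have [h2|h2] := ltnP (a i2) (u i2); last first.
  by move/negP: nu; case; apply/mnm_lepP; exact: forall_ord3.
exists 0, 0, ('X^(u i0) * z ^+ (u i2 - (a i2).+1)); split; rewrite ?size_poly0 //.
  by rewrite mul0r !add0r -mulrA -exprD subnK.
by rewrite (size_mulzX char2) ?expf_neq0 ?polyX_eq0 // size_polyXn; lia.
Qed.

Lemma in_ideal_outside p : (p : S) \is k.+1.-homog ->
  (forall u, (u <= a)%MM -> p@_u = 0) -> in_ideal (dehomog p).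
Proof.
move=> hp out; rewrite (mpolyE p) rmorph_sum /= big_seq; apply: (big_ind in_ideal) => [||u uP].
- exact: in_ideal0.
- exact: in_idealD.
rewrite dehomogZ; apply: in_idealZ; apply: in_ideal_monomial.
  exact: homog_mdeg hp uP.
by apply: contraTN uP => /out; rewrite mcoeff_msupp => ->; rewrite eqxx.
Qed.

(** Each of the three terms is homogenized with its power x_h^(a_h + 1) kept as a factor, so all
    monomials of the lift lie outside the range u <= a. *)
Lemma in_ideal_lift r : in_ideal r -> (size r <= k.+2)%N ->
  exists p, [/\ (p : S) \is k.+1.-homog, (forall u, (u <= a)%MM -> p@_u = 0) & dehomog p = r].
Proof.
move=> ir sr; have [f [g [h [-> sf sg sh]]]] := (ideal_mxP char2 _ _ _ sr) ir.
pose P r := exists p,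
  [/\ (p : S) \is k.+1.-homog, (forall u, (u <= a)%MM -> p@_u = 0) & dehomog p = r].
have PD r1 r2 : P r1 -> P r2 -> P (r1 + r2).
  move=> [p1 [h1 o1 <-]] [p2 [h2 o2 <-]]; exists (p1 + p2); split.
  - exact: rpredD.
  - by move=> u ua; rewrite mcoeffD o1 // o2 // addr0.
  - by rewrite rmorphD.
have PS (m : nat) (r1 : {poly F}) (E : nat -> {poly F}) : (size r1 <= m)%N ->
    (forall i, (i < m)%N -> exists2 u, mdeg u = k.+1 /\ ~~ (u <= a)%MM & dehomog 'X_[u] = E i) ->
    P (\sum_(i < m) r1`_i *: E i).
  move=> _ HE; apply: (big_ind P) => [||i _]; [|exact: PD|].
    by exists 0; split; [exact: dhomog0 | move=> u _; rewrite mcoeff0 | rewrite rmorph0].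
  have [u [ud nu] <-] := HE i (ltn_ord i).
  exists (r1`_i *: 'X_[u]); split; [by apply: dhomogZ; rewrite dhomogX /= ud | | exact: dehomogZ].
  move=> v va; rewrite mcoeffZ mcoeffX; case: (u =P v) => [uv|_]; last by rewrite mulr0.
  by move: nu; rewrite uv va.
have expand (r1 : {poly F}) m (y : {poly F}) : (size r1 <= m)%N ->
    r1 * y = \sum_(i < m) r1`_i *: ('X^i * y).
  move=> s1; rewrite -{1}(coefK r1) poly_def mulr_suml.
  rewrite [LHS](big_ord_widen m (fun i => r1`_i *: 'X^i * y) s1) [LHS]big_mkcond.
  apply: eq_bigr => i _; rewrite scalerAl; case: ltnP => // le.
  by rewrite nth_default // scale0r mul0r.
apply: (PD); first apply: (PD).
- rewrite (expand _ _ _ sf); apply: (PS _ _ (fun i => 'X^i * 'X^((a i0).+1)) sf) => i lt.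
  exists (U_(i0) *+ (i + (a i0).+1) + U_(i1) *+ (k.+1 - (i + (a i0).+1)))%MM.
    split; first by rewrite mdeg_hom //; lia.
    apply/negP => /mnm_lepP/(_ i0); rewrite !mnmDE !mulmnE !mnm1E /=; lia.
  by rewrite dehomogX !mnmDE !mulmnE !mnm1E /= !mul0n addn0 expr0 mulr1 mul1n exprD.
- rewrite -[g]mulr1 (expand _ _ _ sg); apply: (PS _ _ (fun i => 'X^i * 1) sg) => i lt.
  exists (U_(i0) *+ i + U_(i1) *+ (k.+1 - i))%MM.
    split; first by rewrite mdeg_hom //; lia.
    apply/negP => /mnm_lepP/(_ i1); rewrite !mnmDE !mulmnE !mnm1E /=; lia.
  by rewrite dehomogX !mnmDE !mulmnE !mnm1E /= !mul0n addn0 expr0 !mulr1 mul1n.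
- rewrite (expand _ _ _ sh); apply: (PS _ _ (fun i => 'X^i * z ^+ (a i2).+1) sh) => i lt.
  exists (U_(i0) *+ i + U_(i1) *+ (k.+1 - (a i2).+1 - i) + U_(i2) *+ (a i2).+1)%MM.
    split; first by rewrite !mdegD !mdegMn !mdeg1; lia.
    apply/negP => /mnm_lepP/(_ i2); rewrite !mnmDE !mulmnE !mnm1E /=; lia.
  by rewrite dehomogX !mnmDE !mulmnE !mnm1E /= !mul0n !addn0 !mul1n.
Qed.

(* The sections of weight a that come from D^d V (x) O(k) are those whose
   dehomogenization lies in the ideal of the syzygies. *)
Lemma in_ideal_ellP p : (p : S) \is k.+1.-homog -> in_ideal (dehomog p) <->
  exists2 q, q \is k.-homog & forall u, (u <= a)%MM -> p@_u = (ell * q)@_u.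
Proof.
have homL q : q \is k.-homog -> ell * q \is k.+1.-homog.
  move=> hq; apply: (@dhomogM 3 F mdeg 1%N ell k q) => //.
  by rewrite /ell !rpredD // dhomogX /= mdeg1.
have sz q : q \is k.+1.-homog -> (size (dehomog q) <= k.+2)%N.
  move=> hq; rewrite (mpolyE q) rmorph_sum /= big_seq.
  apply: (big_ind (fun r : {poly F} => (size r <= k.+2)%N)) => [|r s sr ss|u uP].
  - by rewrite size_poly0.
  - by rewrite (leq_trans (size_polyD _ _)) // geq_max sr.
  rewrite dehomogZ (leq_trans (size_scale_leq _ _)) // (leq_trans (size_dehomogX _)) //.
  by rewrite (homog_mdeg hq uP).
move=> hp; split=> [ip|[q hq E]].
  have [p1 [h1 o1 E1]] := in_ideal_lift ip (sz p hp).
  have Ed : dehomog (p - p1) = 0 by rewrite dehomog_is_zmod_morphism E1 subrr.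
  have [q hq Eq] := dehomog_eq0 (rpredB hp h1) Ed.
  by exists q => // u ua; rewrite -Eq mcoeffB o1 // subr0.
have -> : dehomog p = dehomog (p - ell * q).
  by rewrite rmorphB rmorphM /= dehomog_ell mul0r subr0.
apply: in_ideal_outside; first by apply: rpredB => //; exact: homL.
by move=> u ua; rewrite mcoeffB E // subrr.
Qed.

End Degree.

(** * Splitting global sections into weight components *)

Section Assembly.
Variables (d k : nat).
Implicit Types (g v : 'X_{1..3} -> S) (a b c u : 'X_{1..3}) (r : {poly F}).

(* The component of weight a of the section g of D^(d-1) V (x) O(k+1). *)
Definition part a g : S :=
  hpoly k.+1 (fun u => if (u <= a)%MM then (g (a - u)%MM)@_u else 0).

Lemma mcoeff_part a g u : (part a g)@_u =
  if mdeg u == k.+1 then if (u <= a)%MM then (g (a - u)%MM)@_u else 0 else 0.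
Proof. exact: mcoeff_hpoly. Qed.

Definition part_in a g : bool := in_ideal k a (dehomog (part a g)).

Lemma subKm u a : (u <= a)%MM -> (a - (a - u) = u)%MM.
Proof. by move=> /mnm_lepP le; apply/mnmP => h; rewrite !mnmBE subKn. Qed.

Lemma mcoeff_relation v c u :
  (\sum_h 'X_h * v (c + U_(h))%MM)@_u =
  \sum_h (if (U_(h) <= u)%MM then (v (c + U_(h))%MM)@_(u - U_(h)) else 0).
Proof.
rewrite raddf_sum; apply: eq_bigr => h _ /=.
by case: ifPn => le; [exact: mcoeffXM | exact: mcoeffXM0].
Qed.

Lemma mdeg_subU u (h : 'I_3) : (U_(h) <= u)%MM -> (mdeg (u - U_(h))%MM).+1 = mdeg u.
Proof. by move=> le; rewrite -[in RHS](submK le) mdegD mdeg1 addn1. Qed.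

(** On components of weight [a] the map from D^d V (x) S_k to D^(d-1) V (x) S_(k+1) is
    multiplication by [ell], up to monomials not below [a]. *)
Lemma part_in_boundary g v a : (forall b, mdeg b = d -> v b \is k.-homog) ->
    (forall c, (mdeg c).+1 = d -> g c = \sum_h 'X_h * v (c + U_(h))%MM) ->
    mdeg a = (d + k)%N ->
  part_in a g.
Proof.
move=> hv Eg ad; apply/in_ideal_ellP; first exact: hpoly_homog.
exists (hpoly k (fun u => if (u <= a)%MM then (v (a - u)%MM)@_u else 0)); first exact: hpoly_homog.
move=> u ua; rewrite mcoeff_ell mcoeff_hpoly ua.
case: ifPn => [/eqP ud|ud]; last first.
  rewrite big1 // => h _; case: ifP => // le; rewrite mcoeff_hpoly.
  by rewrite -eqSS mdeg_subU // (negPf ud).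
have cd : (mdeg (a - u)%MM).+1 = d.
  by have := congr1 (fun m => mdeg m) (submK ua); rewrite mdegD ud ad; lia.
rewrite Eg // mcoeff_relation; apply: eq_bigr => h _; case: ifP => // le.
rewrite mcoeff_hpoly -eqSS mdeg_subU // ud eqxx.
have -> : (u - U_(h) <= a)%MM.
  by apply/mnm_lepP => h'; rewrite mnmBE (leq_trans (leq_subr _ _)) //; exact/mnm_lepP.
by rewrite submBA // [(a - u + _)%MM]addmC addmBA // [(a + _)%MM]addmC.
Qed.

(** The quotients by [ell] found in the separate weights are reassembled: the coefficient of [v b]
    at u comes from weight b + u. *)
Lemma boundary_part_in g : (forall c, (mdeg c).+1 = d -> g c \is k.+1.-homog) ->
    (forall a, mdeg a = (d + k)%N -> part_in a g) ->
  exists v, (forall b, mdeg b = d -> v b \is k.-homog) /\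
    (forall c, (mdeg c).+1 = d -> g c = \sum_h 'X_h * v (c + U_(h))%MM).
Proof.
move=> hg pg.
have ex a : exists q, mdeg a = (d + k)%N -> q \is k.-homog /\
    forall u, (u <= a)%MM -> (part a g)@_u = (ell * q)@_u.
  have [ad|ad] := eqVneq (mdeg a) (d + k)%N; last by exists 0 => e; rewrite e eqxx in ad.
  by have [q hq E] := (in_ideal_ellP a (hpoly_homog _ _)).1 (pg a ad); exists q.
have [q Hq] := boolp.choice ex.
pose v b := hpoly k (fun u => (q (b + u)%MM)@_u).
exists v; split=> [b _|c cd]; first exact: hpoly_homog.
apply/mpolyP => u; rewrite mcoeff_relation.
have [ud|ud] := eqVneq (mdeg u) k.+1; last first.
  rewrite (dhomog_nemf_coeff (hg c cd)) // big1 // => h _; case: ifP => // le.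
  by rewrite /v mcoeff_hpoly -eqSS mdeg_subU // (negPf ud).
have ad : mdeg (c + u)%MM = (d + k)%N by rewrite mdegD ud -cd; lia.
have [_ /(_ u (lem_addl _ _))] := Hq _ ad.
rewrite mcoeff_hpoly ud eqxx lem_addl addmK => ->; rewrite mcoeff_ell.
apply: eq_bigr => h _; case: ifP => // le.
by rewrite /v mcoeff_hpoly -eqSS mdeg_subU // ud eqxx -addmA [(U_(h) + _)%MM]addmC submK.
Qed.

Lemma part_sum (T : finType) (y : T -> F) (g : T -> 'X_{1..3} -> S) a :
  part a (fun c => \sum_s y s *: g s c) = \sum_s y s *: part a (g s).
Proof.
apply/mpolyP => u; rewrite mcoeff_part [RHS]raddf_sum.
under [RHS]eq_bigr do rewrite /= mcoeffZ mcoeff_part.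
case: ifP => _; last by rewrite big1 // => s _; rewrite mulr0.
case: ifP => _; last by rewrite big1 // => s _; rewrite mulr0.
by rewrite raddf_sum; apply: eq_bigr => s _ /=; rewrite mcoeffZ.
Qed.

Lemma partB g g' a : part a (fun c => g c - g' c) = part a g - part a g'.
Proof.
apply/mpolyP => u; rewrite mcoeffB !mcoeff_part; case: ifP => _; last by rewrite subr0.
by case: ifP => _; rewrite ?mcoeffB ?subr0.
Qed.

(* A lift of r to a section of weight a. *)
Definition rep a r c : S :=
  if (c <= a)%MM && ((a - c)%MM i2 == 0%N) then r`_((a - c)%MM i0) *: 'X_[a - c] else 0.

Lemma rep_homog a r c : mdeg a = (d + k)%N -> (mdeg c).+1 = d -> rep a r c \is k.+1.-homog.
Proof.
move=> ad cd; rewrite /rep; case: ifP => [/andP[le _]|_]; last exact: dhomog0.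
apply: dhomogZ; rewrite dhomogX /=; apply/eqP.
by have := congr1 (fun m => mdeg m) (submK le); rewrite mdegD ad; lia.
Qed.

Lemma hom_polyE r : hom_poly k r = hpoly k.+1 (fun u => if u i2 == 0%N then r`_(u i0) else 0).
Proof.
apply/mpolyP => u; rewrite mcoeff_hpoly /hom_poly raddf_sum /=.
under eq_bigr do rewrite mcoeffZ mcoeffX.
case: ifPn => [/eqP ud|ud]; last first.
  rewrite big1 // => i _; case: eqP => [e|_]; last by rewrite mulr0.
  by move: ud; rewrite -e mdeg_hom // eqxx.
case: ifPn => [/eqP u2|u2]; last first.
  rewrite big1 // => i _; case: eqP => [e|_]; last by rewrite mulr0.
  by move: u2; rewrite -e !mnmDE !mulmnE !mnm1E.
rewrite mdeg3 in ud; have lt : (u i0 < k.+2)%N by lia.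
rewrite (bigD1 (Ordinal lt)) //= big1 ?addr0.
  case: eqP => [_|[]]; first by rewrite mulr1.
  apply/mnmP; apply: forall_ord3; rewrite !mnmDE !mulmnE !mnm1E /=; lia.
move=> i; rewrite -val_eqE /= => ne; case: eqP => [e|_]; last by rewrite mulr0.
by move: ne; rewrite -e !mnmDE !mulmnE !mnm1E /= mul1n mul0n addn0 eqxx.
Qed.

(** The component is the homogenization of [r] without the monomials not below [a], and these
    dehomogenize into the ideal. *)
Lemma part_rep a r : (size r <= k.+2)%N -> in_ideal k a (dehomog (part a (rep a r)) - r).
Proof.
move=> sr; rewrite -[X in _ - X](dehomog_hom sr) -dehomog_is_zmod_morphism.
apply: in_ideal_outside => //.
  by apply: rpredB; rewrite ?hom_polyE; exact: hpoly_homog.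
move=> u ua; rewrite mcoeffB hom_polyE mcoeff_part mcoeff_hpoly ua /rep lem_subr subKm //=.
case: ifP => _; last by rewrite subr0.
by case: ifP => _; rewrite ?mcoeffZ ?mcoeffX ?eqxx ?mulr1 ?mcoeff0 ?subrr.
Qed.

Lemma part_rep_neq a a' r : a != a' -> part a' (rep a r) = 0.
Proof.
move=> ne; apply/mpolyP => u; rewrite mcoeff0 mcoeff_part.
case: ifP => // _; case: ifP => // ua; rewrite /rep.
case: ifP => [/andP[le _]|]; last by rewrite mcoeff0.
rewrite mcoeffZ mcoeffX; case: eqP => [e|_]; last by rewrite mulr0.
by move: ne; rewrite -(submK le) e addmC submK // eqxx.
Qed.

Lemma sigma_monomial t u : sigma t ('X_[u] : S) = tpow t u *: 'X_[u].
Proof.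
rewrite mpolyXE_id rmorph_prod /= /tpow -scaler_prod; apply: eq_bigr => h _.
by rewrite rmorphXn /= sigmaX exprZn.
Qed.

Lemma sigmaZ t (c : F) (p : S) : sigma t (c *: p) = c *: sigma t p.
Proof. by rewrite -!mul_mpolyC (rmorphM (sigma t)) /= {1}/sigma comp_mpolyC. Qed.

Lemma rep_weight t a r c : torus t -> weight_at t a (fun c => (rep a r c)%:F) c.
Proof.
move=> t1; rewrite /weight_at sigmaK_tofrac // -!tofracM !mul_mpolyC /rep.
congr (_%:F); case: ifP => [/andP[le _]|_]; last by rewrite rmorph0 !scaler0.
rewrite sigmaZ sigma_monomial !scalerA.
have -> : tpow t a = tpow t (a - c)%MM * tpow t c by rewrite -tpowD submK.
by congr (_ *: _); ring.
Qed.

Lemma boundaryP g : boundary d k (fun c => (g c)%:F) <->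
  exists v, (forall b, mdeg b = d -> v b \is k.-homog) /\
    (forall c, (mdeg c).+1 = d -> g c = \sum_h 'X_h * v (c + U_(h))%MM).
Proof.
have E v c : \sum_h x h * (v (c + U_(h))%MM)%:F = (\sum_h 'X_h * v (c + U_(h))%MM)%:F :> K.
  by rewrite rmorph_sum; apply: eq_bigr => h _ /=; rewrite tofracM.
split=> [[v [Ov Ev]]|[v [hv Ev]]]; last first.
  exists (fun b => (v b)%:F); split=> [b bd|c cd]; first by apply: OP_homog (hv b bd).
  by rewrite E Ev.
have ex b : exists q, mdeg b = d -> q \is k.-homog /\ v b = q%:F.
  have [bd|bd] := eqVneq (mdeg b) d; last by exists 0 => e; rewrite e eqxx in bd.
  have [n [q [[En] hq Eq]]] := OP_set0 (Ov b bd); exists q.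
  by rewrite -En.
have [q Hq] := boolp.choice ex; exists q; split=> [b /Hq[]//|c cd].
apply/eqP; rewrite -tofrac_eq; apply/eqP; rewrite Ev // -E.
apply: eq_bigr => h _; have [|_ ->] := Hq (c + U_(h))%MM => //.
by rewrite mdegD mdeg1 addn1.
Qed.

End Assembly.

Lemma sum_enum_val (T : finType) (V : nmodType) (f : T -> V) :
  \sum_(j < #|T|) f (enum_val j) = \sum_s f s.
Proof. by rewrite [RHS](reindex _ (onW_bij _ (@enum_val_bij T))). Qed.

(** * A basis of weight vectors and the character *)

Section Basis.
Variables (d k : nat).

Local Notation weights := {a : 'X_{1..3 < (d + k).+1} | mdeg a == (d + k)%N}.
Local Notation wt a := (bmnm (val a) : 'X_{1..3}).
Local Notation M a := (ideal_mx F k.+1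
  ((a : 'X_{1..3}) i0).+1 ((a : 'X_{1..3}) i1).+1 ((a : 'X_{1..3}) i2).+1).
Local Notation basis_index := {a : weights & 'I_(\rank (M (wt a))^C)}.

Local Notation idx a i := (@Tagged weights a (fun a => 'I_(\rank (M (wt a))^C)) i).

Definition basis_poly (s : basis_index) : {poly F} :=
  rVpoly (row (tagged s) (row_base (M (wt (tag s)))^C%MS)).

Definition basis_rep (s : basis_index) (c : 'X_{1..3}) : S :=
  rep (wt (tag s)) (basis_poly s) c.

Lemma wt_deg (a : weights) : mdeg (wt a) = (d + k)%N.
Proof. exact/eqP/(valP a). Qed.

Lemma part_basis_sum (y : basis_index -> F) (a : weights) :
  in_ideal k (wt a) (dehomog (part k (wt a) (fun c => \sum_s y s *: basis_rep s c))
    - \sum_(i < \rank (M (wt a))^C) y (idx a i) *: basis_poly (idx a i)).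
Proof.
have -> : dehomog (part k (wt a) (fun c => \sum_s y s *: basis_rep s c)) =
    \sum_(b : weights) \sum_(i < \rank (M (wt b))^C)
      dehomog (y (idx b i) *: part k (wt a) (basis_rep (idx b i))).
  rewrite part_sum raddf_sum sig_big_dep /=.
  by apply: eq_big => [[b i]|[b i] _].
rewrite (bigD1 a) //= [X in _ + X - _]big1 ?addr0.
  rewrite -sumrB; apply: (big_ind (in_ideal k (wt a))) => [||i _].
  - exact: in_ideal0.
  - exact: in_idealD.
  rewrite dehomogZ -scalerBr; apply: in_idealZ; apply: part_rep => //.
  exact: size_rVpoly.
move=> b ba; rewrite big1 // => i _; rewrite /basis_rep part_rep_neq ?scaler0 ?raddf0 //.
Qed.

Lemma basis_polyE (a : weights) (y : 'I_(\rank (M (wt a))^C) -> F) :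
  poly_rV (\sum_i y i *: basis_poly (idx a i)) = (\row_i y i) *m row_base (M (wt a))^C%MS.
Proof.
rewrite raddf_sum mulmx_sum_row; apply: eq_bigr => i _ /=.
by rewrite linearZ /= rVpolyK mxE.
Qed.

Lemma boundary_ext (W W' : 'X_{1..3} -> K) : (forall c, (mdeg c).+1 = d -> W c = W' c) ->
  boundary d k W -> boundary d k W'.
Proof. by move=> E [v [Ov Ev]]; exists v; split=> // c cd; rewrite -E // Ev. Qed.

Theorem H1_character : H1_has_character (twist (@DR F d) k)
  (\sum_(a : weights) toA 'X_[wt a] *+
     coker_dim F k.+1 (wt a i0).+1 (wt a i1).+1 (wt a i2).+1).
Proof.
pose W s c : K := (basis_rep s c)%:F.
have -> : \sum_(a : weights) toA 'X_[wt a] *+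
      coker_dim F k.+1 (wt a i0).+1 (wt a i1).+1 (wt a i2).+1
    = \sum_(j < #|{: basis_index}|) toA 'X_[wt (tag (enum_val j))].
  rewrite (sum_enum_val (fun s : basis_index => toA 'X_[wt (tag s)])).
  transitivity (\sum_(a : weights) \sum_(i < \rank (M (wt a))^C) toA 'X_[wt a]).
    by apply: eq_bigr => a _; rewrite sumr_const card_ord mxrank_compl.
  rewrite (sig_big_dep _ (fun a : weights => xpredT)) /=.
  by apply: eq_big => [[b i]|[b i] _].
have sumW (y : basis_index -> F) c :
    \sum_(j < #|{: basis_index}|) scal (y (enum_val j)) * W (enum_val j) c
    = (\sum_s y s *: basis_rep s c)%:F.
  rewrite (sum_enum_val (fun s : basis_index => scal (y s) * W s c)) rmorph_sum.
  by apply: eq_bigr => s _ /=; rewrite -mul_mpolyC tofracM.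
have hW s c : (mdeg c).+1 = d -> basis_rep s c \is k.+1.-homog.
  by move=> cd; apply: rep_homog cd; exact: wt_deg.
have hsum (y : basis_index -> F) c : (mdeg c).+1 = d -> \sum_s y s *: basis_rep s c \is k.+1.-homog.
  by move=> cd; apply: rpred_sum => s _; apply: dhomogZ; exact: hW.
apply: (H1_of_coker (W := fun j => W (enum_val j))).
- by move=> j c cd; apply: OP_homog (hW _ c cd).
- by move=> j t c t1 _; exact: rep_weight.
- move=> W0 sW0.
  have ex c : exists p, (mdeg c).+1 = d -> p \is k.+1.-homog /\ W0 c = p%:F.
    have [cd|cd] := eqVneq (mdeg c).+1 d; last by exists 0 => e; rewrite e eqxx in cd.
    by have [n [p [[<-] hp Ep]]] := OP_set0 (sW0 c cd); exists p.
  have [g0 Hg0] := boolp.choice ex.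
  (* The coefficients are indexed by [nat] so that the type does not depend on [a] and choice can be
     applied. *)
  have exy (a : weights) : exists y : nat -> F,
      in_ideal k (wt a) (dehomog (part k (wt a) g0)
        - \sum_(i < \rank (M (wt a))^C) y i *: basis_poly (idx a i)).
    set r := dehomog _.
    have /sub_addsmxP[[u v] /= Er] : (poly_rV r <= M (wt a) + (M (wt a))^C)%MS.
      by apply: submx_full; exact: addsmx_compl_full.
    have /submxP[y Ey] : (v *m (M (wt a))^C <= row_base (M (wt a))^C%MS)%MS.
      by rewrite eq_row_base submxMl.
    exists (fun n => odflt 0 (omap (y 0) (insub n))).
    rewrite /in_ideal linearB /= (basis_polyE (fun i => odflt 0 (omap (y 0) (insub (i : nat))))).
    have -> : \row_i odflt 0 (omap (y 0) (insub (i : nat))) = y.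
      by apply/rowP => i; rewrite mxE valK.
    by rewrite Er -Ey addrK submxMl.
  have [y Hy] := boolp.choice exy.
  pose y' (s : basis_index) := y (tag s) (nat_of_ord (tagged s)).
  exists (fun j => y' (enum_val j)).
  apply: (boundary_ext (W := fun c => (g0 c - \sum_s y' s *: basis_rep s c)%:F)).
    move=> c cd; have [_ ->] := Hg0 c cd.
    by rewrite tofracB -sumW.
  apply/boundaryP; apply: (boundary_part_in) => [c cd|a ad].
    by apply: rpredB; [have [] := Hg0 c cd | exact: hsum].
  have lt : (mdeg a < (d + k).+1)%N by rewrite ad.
  have wa : mdeg (Sub a lt : 'X_{1..3 < (d + k).+1}) == (d + k)%N by rewrite ad.
  pose b : weights := Sub (Sub a lt : 'X_{1..3 < (d + k).+1}) wa.
  have -> : a = wt b by [].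
  rewrite /part_in partB dehomog_is_zmod_morphism.
  have e (p q r : {poly F}) : p - q = p - r - (q - r) by rewrite opprB addrA subrK.
  rewrite (e _ _ (\sum_(i < \rank (M (wt b))^C) y b i *: basis_poly (idx b i))).
  by apply: in_idealB; [exact: Hy | exact: (part_basis_sum y' b)].
- move=> y0 bd; pose y s := y0 (enum_rank s).
  have {}bd : boundary d k (fun c => (\sum_s y s *: basis_rep s c)%:F).
    apply: boundary_ext bd => c _; rewrite -sumW; apply: eq_bigr => j _.
    by rewrite /y enum_valK.
  have [v [hv Ev]] := (boundaryP d k _).1 bd.
  suff y_0 s : y s = 0 by move=> j; rewrite -(y_0 (enum_val j)) /y enum_valK.
  case: s => a i.
  have pa := part_in_boundary hv Ev (wt_deg a).
  have pb := part_basis_sum y a.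
  (* The combination of basis polynomials lies in the ideal and in its complement, so it is 0. *)
  have := in_idealB pa pb; rewrite opprB addrC subrK /in_ideal.
  rewrite (basis_polyE (fun i => y (idx a i))) => sM.
  set C := row_base _ in sM; have sC : ((\row_i y (idx a i)) *m C <= (M (wt a))^C)%MS.
    by rewrite (submx_trans (submxMl _ _)) // /C eq_row_base.
  have : ((\row_i y (idx a i)) *m C <= M (wt a) :&: (M (wt a))^C)%MS by rewrite sub_capmx sM.
  rewrite capmx_compl submx0 => /eqP y00.
  have /rowP/(_ i) : \row_i y (idx a i) = 0.
    by apply: (row_free_inj (row_base_free (M (wt a))^C%MS)); rewrite y00 mul0mx.
  by rewrite !mxE.
Qed.

End Basis.

End WeightSpaces.

(** * Truncated Schur functions *)

Local Notation triple q := ('I_q * 'I_q * 'I_q)%type.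

Definition mon3 q (t : triple q) : A := monA t.1.1 t.1.2 t.2.
Definition sum3 q (t : triple q) : nat := t.1.1 + t.1.2 + t.2.

Lemma monAM a b c a' b' c' :
  monA a b c * monA a' b' c' = monA (a + a') (b + b') (c + c').
Proof. by rewrite /monA !exprD; ring. Qed.

Lemma sum_triple (V : nmodType) q (f : nat -> nat -> nat -> V) (P : nat -> nat -> nat -> bool) :
  \sum_(a < q) \sum_(b < q) \sum_(c < q | P a b c) f a b c =
  \sum_(t : triple q | P t.1.1 t.1.2 t.2) f t.1.1 t.1.2 t.2.
Proof.
under eq_bigr do under eq_bigr do rewrite big_mkcond.
rewrite [RHS]big_mkcond pair_bigA /= pair_bigA /=.
by apply: eq_bigr => -[[a b] c] _.
Qed.

Lemma htruncE q m : htrunc q m = \sum_(t : triple q | (sum3 t)%:Z == m) mon3 t.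
Proof. by rewrite /htrunc (sum_triple q monA (fun a b c => (a + b + c)%N%:Z == m)). Qed.

Definition window (q v r : nat) : bool := (v <= r < v + q)%N.

Lemma sum_window (V : nmodType) q v (f : nat -> V) : (v < q)%N ->
  \sum_(u < q) f (u + v)%N = \sum_(r < 2 * q | window q v r) f r.
Proof.
move=> vq; rewrite -(big_mkord xpredT (fun u => f (u + v)%N)) -(big_mkord (window q v) f).
have -> : \sum_(0 <= u < q) f (u + v)%N = \sum_(v <= r < v + q) f r.
  by rewrite -{2}[v]add0n big_addn addKn.
rewrite (@big_nat_widen _ _ _ v (v + q) (2 * q)); last by lia.
rewrite (@big_nat_widenl _ _ _ v 0) //; apply: eq_bigl => r.
by rewrite /window /= andbC.
Qed.

Definition window3 q (v : triple q) (r : triple (2 * q)) : bool :=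
  [&& window q v.1.1 r.1.1, window q v.1.2 r.1.2 & window q v.2 r.2].

Lemma htrunc_mon3 q m (v : triple q) : htrunc q m * mon3 v =
  \sum_(r : triple (2 * q) | window3 v r && ((sum3 r)%:Z == m + (sum3 v)%:Z)) mon3 r.
Proof.
case: v => -[v0 v1] v2.
pose f a b c : A := if (a + b + c)%N%:Z == m + (v0 + v1 + v2)%N%:Z then monA a b c else 0.
transitivity (\sum_(a < q) \sum_(b < q) \sum_(c < q) f (a + v0)%N (b + v1)%N (c + v2)%N).
  rewrite /htrunc mulr_suml; apply: eq_bigr => a _; rewrite mulr_suml; apply: eq_bigr => b _.
  rewrite mulr_suml big_mkcond; apply: eq_bigr => c _; rewrite /f monAM /=.
  by congr (if _ then _ else _); apply/eqP/eqP; lia.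
rewrite (sum_window (fun a => \sum_(b < q) \sum_(c < q) f a (b + v1)%N (c + v2)%N)) //.
under eq_bigr do (rewrite (sum_window (fun b => \sum_(c < q) f _ b (c + v2)%N)) //;
  under eq_bigr do rewrite (sum_window (fun c => f _ _ c)) //).
rewrite big_mkcond; under eq_bigr do rewrite [X in if _ then X else _]big_mkcond /=.
rewrite [RHS]big_mkcond -(sum_triple _ (fun a b c =>
   if [&& window q v0 a, window q v1 b & window q v2 c]
   && ((a + b + c)%N%:Z == m + (v0 + v1 + v2)%N%:Z) then monA a b c else 0) (fun _ _ _ => true)).
apply: eq_bigr => a _; case: (window q v0 a) => /=; last first.
  by rewrite big1 // => b _; rewrite big1.
apply: eq_bigr => b _; case: (window q v1 b) => /=; last by rewrite big1.
by rewrite big_mkcond; apply: eq_bigr => c _; case: (window q v2 c).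
Qed.

(** The number of ways to write r as a sum u + v with all entries of u and v below [q] and v of
    degree [m]: a coefficient of a product of two truncated functions. *)
Definition count3 q (m : int) (r : triple (2 * q)) : nat :=
  \sum_(v : triple q | (sum3 v)%:Z == m) window3 v r.

Lemma htruncM q m m' : htrunc q m * htrunc q m' =
  \sum_(r : triple (2 * q) | (sum3 r)%:Z == m + m') mon3 r *+ count3 m' r.
Proof.
rewrite [X in _ * X]htruncE mulr_sumr.
under eq_bigr do rewrite htrunc_mon3 big_mkcond.
rewrite exchange_big [RHS]big_mkcond /=; apply: eq_bigr => r _.
case: ifP => rm.
  rewrite -sumrMnr; apply: eq_bigr => v /eqP ->; rewrite rm andbT.
  by case: (window3 v r).
by rewrite big1 // => v /eqP ->; rewrite rm andbF.
Qed.

Lemma sum_between lo hi n : (hi <= n)%N -> (\sum_(i < n) (lo <= i < hi) = hi - lo)%N.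
Proof.
move=> le; suff -> : (\sum_(i < n) (lo <= i < hi) = minn n hi - lo)%N by lia.
by elim: n {le} => [|n IH]; rewrite ?big_ord0 ?big_ord_recr /= ?IH; lia.
Qed.

(** The third entry is fixed by the total degree b - 1. As r0 + r1 + r2 is large, the lower bounds
    on two entries imply that the remaining one is at most its r, so only lower bounds survive. *)
Lemma window_last q b r0 r1 r2 v0 v1 : (b <= q)%N -> (2 * q + b <= r0 + r1 + r2 + 2)%N ->
    (v0 + v1 + 1 <= b)%N ->
  [&& window q v0 r0, window q v1 r1 & window q (b - 1 - v0 - v1) r2] =
  (r0 - (q - 1) <= v0)%N && (r1 - (q - 1) <= v1 < b - (r2 - (q - 1)) - v0)%N.
Proof.
rewrite /window => bq sr le; apply/idP/idP.
  move=> /and3P[/andP[l0 u0] /andP[l1 u1] /andP[l2 u2]].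
  by apply/and3P; split; lia.
by move=> /and3P[h0 h1 h2]; apply/and3P; split; apply/andP; split; lia.
Qed.

Lemma count3E q (b : nat) (r : triple (2 * q)) : (b <= q)%N ->
    (2 * q + b <= sum3 r + 2)%N ->
  count3 (b%:Z - 1) r = (\sum_(v < q)
    (r.1.1 - (q - 1) <= v) * (b - (r.1.2 - (q - 1)) - (r.2 - (q - 1)) - v))%N.
Proof.
case: r => -[r0 r1] r2 bq; rewrite /sum3 /= => sr.
rewrite /count3 -(@sum_triple nat q
  (fun x y c => [&& window q x r0, window q y r1 & window q c r2] : nat)
  (fun x y c => (x + y + c)%N%:Z == b%:Z - 1)).
apply: eq_bigr => x _.
have inner (y : 'I_q) : (\sum_(c < q | (x + y + c)%N%:Z == (b%:Z - 1)%R)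
     [&& window q x r0, window q y r1 & window q c r2] =
   (r0 - (q - 1) <= x) * (r1 - (q - 1) <= y < b - (r2 - (q - 1)) - x))%N.
  have [le|lt] := leqP (x + y + 1) b; last first.
    rewrite big1 => [|c /eqP]; last by lia.
    by case: (_ <= x)%N => //=; lia.
  have cq : (b - 1 - x - y < q)%N by lia.
  rewrite (big_pred1 (Ordinal cq)) => [|c]; last first.
    by rewrite /= -val_eqE /=; apply/eqP/eqP; lia.
  by rewrite /= window_last // mulnb.
rewrite (eq_bigr _ (fun y _ => inner y)) -big_distrr sum_between; last by lia.
apply: (congr1 (muln _)); lia.
Qed.

(** With lower bounds only, the counts are triangular numbers, and consecutive ones differ by the
    length of one side. *)
Lemma count3S q (b : nat) (r : triple (2 * q)) : (b < q)%N ->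
    (2 * q + b <= sum3 r + 1)%N ->
  count3 b r = (count3 (b%:Z - 1)%R r +
    (b + 1 - ((r.1.1 - (q - 1)) + (r.1.2 - (q - 1)) + (r.2 - (q - 1)))))%N.
Proof.
move=> bq sr; have -> : b%:Z = b.+1%:Z - 1 by lia.
rewrite !count3E; try lia.
have hi : (b.+1 - (r.1.2 - (q - 1)) - (r.2 - (q - 1)) <= q)%N by lia.
have -> : (b + 1 - ((r.1.1 - (q - 1)) + (r.1.2 - (q - 1)) + (r.2 - (q - 1))) =
   \sum_(v < q) (r.1.1 - (q - 1) <= v < b.+1 - (r.1.2 - (q - 1)) - (r.2 - (q - 1))))%N.
  by rewrite sum_between //; lia.
rewrite -big_split; apply: eq_bigr => v _ /=.
by case: (_ <= v)%N => /=; lia.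
Qed.

(** The two products contribute the counts for [b] and [b - 1]; their difference is the expression
    that occurs in [level_dim_digits]. *)
Lemma struncE q (m b : nat) : (b < q)%N -> (2 * q <= m + 1)%N ->
  strunc q m b = \sum_(r : triple (2 * q) | sum3 r == (m + b)%N)
    mon3 r *+ (b + 1 - ((r.1.1 - (q - 1)) + (r.1.2 - (q - 1)) + (r.2 - (q - 1)))).
Proof.
move=> bq mq; rewrite /strunc !htruncM.
have -> : m%:Z + 1 + (b%:Z - 1) = m%:Z + b%:Z by lia.
rewrite -sumrB; apply: eq_big => r; first by apply/eqP/eqP; lia.
move=> /eqP sr; rewrite count3S //; last by lia.
by rewrite mulrnDr addrC addKr.
Qed.

Lemma toA_monomial (u : 'X_{1..3}) : toA 'X_[u] = monA (u i0) (u i1) (u i2).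
Proof.
rewrite mpolyXE_id rmorph_prod /= !big_ord_recl big_ord0 mulr1 !rmorphXn /= mulrA /monA.
congr (xA _ ^+ _ * xA _ ^+ _ * xA _ ^+ _); apply: val_inj => //=.
by rewrite inordK.
Qed.

Lemma frob_monA q a b c : frob q (monA a b c) = monA (q * a) (q * b) (q * c).
Proof.
rewrite /monA !rmorphM !rmorphXn /= !frob_xA -!exprM.
by [].
Qed.

Lemma frob_nimchar q l : frob q (nimchar l) =
  \sum_(t : triple (2 * l).+1 | (sum3 t == 2 * l)%N && xor0 t.1.1 t.1.2 t.2)
    monA (q * t.1.1) (q * t.1.2) (q * t.2).
Proof.
rewrite /nimchar (@sum_triple _ _ monA
  (fun a b c => (a + b + c == 2 * l)%N && xor0 a b c)) rmorph_sum.
by apply: eq_bigr => t _; rewrite /= frob_monA.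
Qed.

Lemma modn2X n i : (n %% 2 ^ i.+1 = n %% 2 ^ i + (n %/ 2 ^ i) %% 2 * 2 ^ i)%N.
Proof.
have q0 : (0 < 2 ^ i)%N by rewrite expn_gt0.
have lt := ltn_pmod n q0; have lt2 := ltn_pmod (n %/ 2 ^ i) (isT : 0 < 2)%N.
rewrite {1}(divn_eq n (2 ^ i)) {1}(divn_eq (n %/ 2 ^ i) 2) expnS mulnDl -mulnA -addnA.
rewrite modnMDl modn_small; first by rewrite addnC.
move: (n %% 2 ^ i)%N ((n %/ 2 ^ i) %% 2)%N lt lt2 => r b; case: b => [|[|b]] //; lia.
Qed.

Lemma rdigE i n : rdig i n = (n %% 2 ^ i)%N.
Proof.
rewrite /rdig /binval; elim: i => [|i IH]; first by rewrite big_ord0 modn1.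
by rewrite big_ord_recr /= IH modn2X.
Qed.

Lemma ldigE k i n : (i <= k)%N -> (n < 2 ^ k.+1)%N -> ldig k i n = (n %/ 2 ^ i.+1)%N.
Proof.
move=> ik nk; have -> : ldig k i n = rdig (k - i) (n %/ 2 ^ i.+1).
  by apply: eq_bigr => j _; rewrite /digit expnD divnMA.
rewrite rdigE modn_small // ltn_divLR ?expn_gt0 // -expnD.
by rewrite (_ : k - i + i.+1 = k.+1)%N //; lia.
Qed.

Local Notation weights D := {a : 'X_{1..3 < D.+1} | mdeg a == D}.
Local Notation wt a := (bmnm (val a) : 'X_{1..3}).

Lemma level_sum k d e i : (0 < i <= k)%N -> (0 < d)%N -> (d <= e)%N -> (e < 2 ^ k.+1)%N ->
  \sum_(a : weights (d + e.-1)) toA 'X_[wt a] *+ level_dim i (wt a i0) (wt a i1) (wt a i2) d =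
  if inI k d e i then frob (2 ^ i.+1) (nimchar (ldig k i d)) *
      strunc (2 ^ i) ((rdig i e)%:Z - 1 + (2 ^ i.+1)%N%:Z) (rdig i d)%:Z else 0.
Proof.
move=> /andP[i_gt0 ik] d0 de ek; have dk : (d < 2 ^ k.+1)%N by exact: leq_ltn_trans ek.
set D := (d + e.-1)%N.
have wD (a : weights D) : (wt a i0 + wt a i1 + wt a i2 = D)%N.
  by rewrite -mdeg3; exact/eqP/(valP a).
have wD1 (a : weights D) : (wt a i0 + wt a i1 + wt a i2 + 1 = d + e)%N by rewrite wD /D; lia.
have lev (a : weights D) := level_dim_digits i_gt0 (wD1 a) de.
rewrite /= in lev.
rewrite /inI !rdigE !ldigE // i_gt0 ik /digit /=.
case: ifPn => [/and4P[d1 e1 le re]|no]; last first.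
  rewrite big1 // => a _; rewrite lev; case: ifPn => [h|_]; last by rewrite mulr0n.
  by case/negP: no; move: h => /and5P[-> -> -> -> _].
set q := (2 ^ i)%N in lev d1 e1 re *; set Q := (2 ^ i.+1)%N in lev le *.
set l := (d %/ Q)%N in lev le *.
have EQ : Q = (2 * q)%N by rewrite /Q expnS.
have q0 : (0 < q)%N by rewrite expn_gt0.
have Q0 : (0 < Q)%N by rewrite expn_gt0.
have dig n : ((n %/ q) %% 2 == 1 -> n = Q * (n %/ Q) + q + n %% q)%N.
  move=> /eqP n1; rewrite {1}(divn_eq n q) {1}(divn_eq (n %/ q) 2) n1.
  rewrite EQ [(2 * q)%N]mulnC divnMA; lia.
have Ed := dig d d1; have Ee := dig e e1; rewrite -(eqP le) in Ee; rewrite -/l in Ed.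
(* Both d and e are Q l + q plus their low parts; the two summands q make up the Q in the first
   index of the Schur function, and the -1 comes from the twist e - 1. *)
have keq S : (Q * (2 * l) + S == D)%N = (S == e %% q + Q - 1 + d %% q)%N.
  have -> : D = (Q * (2 * l) + (e %% q + Q - 1 + d %% q))%N.
    rewrite /D mulnCA; move: (d %% q)%N (e %% q)%N (Q * l)%N Ed Ee EQ q0 => rd re' Ql.
    by clear; lia.
  by rewrite eqn_add2l.
have -> : (e %% q)%N%:Z - 1 + Q%:Z = (e %% q + Q - 1)%N by lia.
rewrite frob_nimchar struncE; [|by rewrite ltn_mod|by lia].
rewrite big_distrlr pair_big /=.
pose mk (t : triple (2 * l).+1 * triple (2 * q)) : 'X_{1..3} :=
  [multinom nth 0 [:: Q * t.1.1.1 + t.2.1.1; Q * t.1.1.2 + t.2.1.2; Q * t.1.2 + t.2.2]%N h | h < 3].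
have mk0 t : mk t i0 = (Q * t.1.1.1 + t.2.1.1)%N by rewrite mnmE.
have mk1 t : mk t i1 = (Q * t.1.1.2 + t.2.1.2)%N by rewrite mnmE.
have mk2 t : mk t i2 = (Q * t.1.2 + t.2.2)%N by rewrite mnmE.
have le3 u v w n : (u + v + w = n -> [/\ u <= n, v <= n & w <= n])%N.
  by clear; move=> <-; split; lia.
have Qlt x : (x %% Q < 2 * q)%N by rewrite -EQ ltn_mod.
pose h (a : weights D) : triple (2 * l).+1 * triple (2 * q) :=
  ((inord (wt a i0 %/ Q), inord (wt a i1 %/ Q), inord (wt a i2 %/ Q)),
   (Ordinal (Qlt (wt a i0)), Ordinal (Qlt (wt a i1)), Ordinal (Qlt (wt a i2)))).
(* Partial, because [mk t] is a weight only if its degree is [D]. *)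
pose h' t : option (weights D) :=
  obind (fun b : 'X_{1..3 < D.+1} => insub b) (insub (mk t)).
have h'E t : mdeg (mk t) = D -> exists2 a : weights D, h' t = Some a & wt a = mk t.
  move=> md; have lt : (mdeg (mk t) < D.+1)%N by rewrite md.
  have md' : mdeg (Sub (mk t) lt : 'X_{1..3 < D.+1}) == D by rewrite /= md.
  exists (Sub (Sub (mk t) lt : 'X_{1..3 < D.+1}) md') => //.
  rewrite /h' (insubT (fun m => mdeg m < D.+1)%N lt) /=.
  by rewrite (insubT (fun b : 'X_{1..3 < D.+1} => mdeg b == D) md').
have mkdeg t : mdeg (mk t) = (Q * sum3 t.1 + sum3 t.2)%N.
  by rewrite mdeg3 mk0 mk1 mk2 /sum3; lia.
have io x : (x <= 2 * l)%N -> (inord x : 'I_(2 * l).+1) = x :> nat.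
  by move=> le2; rewrite inordK.
rewrite [RHS](reindex_omap h h'); last first.
  move=> t /andP[/andP[/eqP s1 _] /eqP s2].
  have [|a -> wa] := h'E t; first by apply/eqP; rewrite mkdeg s1 keq s2.
  rewrite /= /h wa mk0 mk1 mk2; case: t {wa s1 s2} => -[[a0 a1] a2] [[r0 r1] r2] /=.
  have dv x (r : 'I_(2 * q)) : ((Q * x + r) %/ Q = x)%N.
    by rewrite mulnC divnMDl // divn_small ?addn0 // EQ.
  have md x (r : 'I_(2 * q)) : ((Q * x + r) %% Q = r)%N.
    by rewrite mulnC modnMDl modn_small // EQ.
  congr (Some ((_, _, _), (_, _, _))); apply: val_inj => /=; rewrite ?dv ?md ?inordK //.
pose P (a : weights D) := xor0 (wt a i0 %/ Q) (wt a i1 %/ Q) (wt a i2 %/ Q) &&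
  (wt a i0 %/ Q + wt a i1 %/ Q + wt a i2 %/ Q == 2 * l)%N.
(* Weights whose quotients violate [P] have [level_dim] equal to 0. *)
rewrite (bigID P) /= [X in _ + X]big1 ?addr0 => [|a nP]; last first.
  by rewrite lev; case: ifPn => [/and5P[_ _ _ _]|_]; [rewrite -/(P a) (negPf nP) | rewrite mulr0n].
apply: eq_big => [a|a Pa].
  have eqn x : (x = Q * (x %/ Q) + x %% Q)%N by rewrite {1}(divn_eq x Q) mulnC.
  apply/idP/idP => [/andP[xa /eqP sa]|/andP[/andP[/andP[s1 x1] s2] /eqP ha]].
    have [l0 l1 l2] : [/\ wt a i0 %/ Q <= 2 * l, wt a i1 %/ Q <= 2 * l & wt a i2 %/ Q <= 2 * l]%N.
      exact: le3 sa.
    have mkh : mk (h a) = wt a.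
      apply/mnmP; apply: forall_ord3; rewrite ?mk0 ?mk1 ?mk2 /= io // -eqn //.
    have md : mdeg (mk (h a)) = D by rewrite mkh; exact/eqP/(valP a).
    have s1 : sum3 (h a).1 == (2 * l)%N by rewrite /sum3 /= !io // sa.
    have [b hb wb] := h'E _ md.
    rewrite s1 /= !io // xa /= hb; apply/andP; split; last first.
      apply/eqP; congr Some; apply/val_inj/val_inj; exact: etrans wb mkh.
    by move/eqP: md; rewrite mkdeg (eqP s1) keq.
  have [|b hb wb] := h'E (h a); first by apply/eqP; rewrite mkdeg (eqP s1) keq.
  have mkh : mk (h a) = wt a by move: ha; rewrite hb => /Some_inj ba; rewrite -wb ba.
  have dv (c y : nat) : (Q * c + y %% Q = y)%N -> (y %/ Q = c)%N.
    by rewrite {2}[y](divn_eq y Q) mulnC => /addIn/eqP; rewrite eqn_pmul2r // => /eqP.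
  have e0 := congr1 (fun u : 'X_{1..3} => u i0) mkh.
  have e1' := congr1 (fun u : 'X_{1..3} => u i1) mkh.
  have e2 := congr1 (fun u : 'X_{1..3} => u i2) mkh.
  rewrite /= mk0 in e0; rewrite /= mk1 in e1'; rewrite /= mk2 in e2.
  rewrite /P (dv _ _ e0) (dv _ _ e1') (dv _ _ e2).
  by move: s1 x1; rewrite /sum3 /= => -> ->.
rewrite lev; have [xa /eqP sa] := andP Pa.
rewrite d1 e1 le re xa sa eqxx /= toA_monomial mulrnAr monAM.
have eqn x : (Q * (x %/ Q) + x %% Q = x)%N by rewrite [RHS](divn_eq x Q) mulnC.
have [l0 l1 l2] := le3 _ _ _ _ sa.
by rewrite !io ?eqn.
Qed.

Unset Implicit Arguments.

Theorem theorem1p9 (F : closedFieldType) (char2 : 2%N \in [pchar F])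
    (k d e : nat) (k_ge1 : (1 <= k)%N)
    (d_ge : (2 ^ k <= d)%N) (d_le_e : (d <= e)%N)
    (e_le : (e <= 2 ^ k.+1 - 2)%N) :
  @H1_has_character F d (twist (@DR F d) (e%:Z - 1))
    (\sum_(1 <= i < k.+1 | inI k d e i)
        frob (2 ^ i.+1) (nimchar (ldig k i d)) *
        strunc (2 ^ i) ((rdig i e)%:Z - 1 + (2 ^ i.+1)%N%:Z) (rdig i d)%:Z).
Proof.
have q0 : (0 < 2 ^ k)%N by rewrite expn_gt0.
have Eq : (2 ^ k.+1 = 2 * 2 ^ k)%N by rewrite expnS.
have d0 : (0 < d)%N by exact: leq_trans d_ge.
have e0 : (0 < e)%N by exact: leq_trans d_le_e.
have ek : (e < 2 ^ k.+1)%N by lia.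
have -> : e%:Z - 1 = (e.-1)%:Z by rewrite -[in LHS](prednK e0) -addn1 PoszD addrK.
have := H1_character char2 d e.-1; rewrite (prednK e0).
congr (H1_has_character _ _).
(* Every term of the formula is a sum over weights; after exchanging the sums, the multiplicity of
   each weight is compared with the dimension of its cokernel. *)
have level i (ik : (1 <= i < k.+1)%N) := level_sum ik d0 d_le_e ek.
rewrite [RHS]big_mkcond /= -(eq_big_nat _ _ level) exchange_big /=.
apply: eq_bigr => a _; rewrite sumrMnr; congr (_ *+ _).
apply: (coker_dim_levels char2 d_le_e); last exact: leq_ltn_trans ek.
by have := valP a; rewrite mdeg3 => /eqP ->; lia.
Qed.
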